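(* Let $\Gamma_+ \subset \mathbb{R}^3_{\geqslant 0}$ be a convenient Newton polyhedron and let $P \in \mathbb{N}_0^3 \setminus \Gamma_+$ be a lattice point lying under $\Gamma_+$. Put $\Gamma_+^P := \operatorname{conv}(\Gamma_+ \cup \{P\})$, which is again a convenient Newton polyhedron. Write $\Gamma_+^P - \Gamma_+ := \overline{\Gamma_+^P \setminus \Gamma_+}$ for the closure of the set-theoretical difference, and let $\nu$ denote the Newton number. Then: (1) $\nu(\Gamma_+^P) \leqslant \nu(\Gamma_+)$; (2) $\nu(\Gamma_+^P) = \nu(\Gamma_+)$ if, and only if, there exists a coordinate plane $H$ of $\mathbb{R}^3$ (one of $\{x=0\}$, $\{y=0\}$, $\{z=0\}$) such that $P \in H$ and $\Gamma_+^P - \Gamma_+$ is a pyramid with base $(\Gamma_+^P - \Gamma_+) \cap H$ and of height equal to $1$.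
   Context: $\mathbb{N}_0 = \{0,1,2,\ldots\}$ and $\mathbb{R}^n_{\geqslant 0}$ is the set of points of $\mathbb{R}^n$ with all coordinates non-negative. Below, $n=3$ in the theorem. Newton polyhedron: a subset $\Gamma_+ \subset \mathbb{R}^n_{\geqslant 0}$ is a Newton polyhedron if there is a subset $A \subset \mathbb{N}_0^n$ with $\Gamma_+ = \operatorname{conv}\left(\bigcup_{i \in A} (i + \mathbb{R}^n_{\geqslant 0})\right)$. It is called convenient if it intersects all the coordinate axes of $\mathbb{R}^n$. Polyhedra: a convex $n$-polyhedron in $\mathbb{R}^n$ is an intersection of a finite family of closed half-spaces having non-empty interior; an $n$-polyhedron in $\mathbb{R}^n$ is a union of finitely many convex $n$-polyhedra. For $k \leqslant n$, a $k$-polyhedron in $\mathbb{R}^n$ is a finite union of $k$-polyhedra in $k$-dimensional affine subspaces of $\mathbb{R}^n$. Polyhedral difference: for two $k$-polyhedra $\mathbb{P}, \mathbb{Q}$ in $\mathbb{R}^n$, $\mathbb{P} - \mathbb{Q} := \overline{\mathbb{P} \setminus \mathbb{Q}}$ (closure of the set-theoretical difference). Region under $\Gamma_+$: for a convenient Newton polyhedron $\Gamma_+$, put $\Gamma_- := \overline{\mathbb{R}^n_{\geqslant 0} \setminus \Gamma_+}$, which is compact (possibly empty). For $\varnothing \neq I \subset \{1,\ldots,n\}$ let $\mathbb{R}^I_{\geqslant 0} := \{(x_1,\ldots,x_n) \in \mathbb{R}^n_{\geqslant 0} : x_i = 0 \text{ for } i \notin I\}$ and $\Gamma_-^I := \Gamma_-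 \cap \mathbb{R}^I_{\geqslant 0}$; this set has finite $(\#I)$-dimensional volume. Newton number: for a convenient Newton polyhedron $\Gamma_+$, $$\nu(\Gamma_+) := n!\,V_n - (n-1)!\,V_{n-1} + \cdots + (-1)^{n-1}\,1!\,V_1 + (-1)^n V_0,$$ where, for $1 \leqslant i \leqslant n$, $V_i$ is the sum of the $i$-dimensional volumes of $\Gamma_-^I$ over all $I \subset \{1,\ldots,n\}$ with $\#I = i$, and $V_0 = 1$ if $\Gamma_- \neq \varnothing$, $V_0 = 0$ if $\Gamma_- = \varnothing$. In particular, for $n=3$, $\nu(\Gamma_+) = 6V_3 - 2V_2 + V_1 - V_0$, and $\nu(\mathbb{R}^3_{\geqslant 0}) = 0$. Pyramid: let $B$ be a compact $(n-1)$-polyhedron in an $(n-1)$-dimensional hyperplane $H \subset \mathbb{R}^n$ and $Q \in \mathbb{R}^n \setminus H$. The pyramid with apex $Q$ and base $B$ is the cone with vertex $Q$ and base $B$, i.e. the union of all segments joining $Q$ to points of $B$. Its height is the distance from $Q$ to $H$. *)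

(* Defs.v *)
(* Points of R^n are row vectors over an abstract realType. *)
From mathcomp Require Import all_boot all_order all_algebra.
From mathcomp Require Import all_classical all_reals all_analysis.
Set Implicit Arguments.
Unset Strict Implicit.
Unset Printing Implicit Defensive.
Import Order.TTheory GRing.Theory Num.Theory.
Import numFieldNormedType.Exports.
Local Open Scope classical_set_scope.
Local Open Scope ring_scope.

Definition lattice_point (R : realType) n (a : 'rV[nat]_n) : 'rV[R]_n :=
  map_mx (fun k : nat => k%:R) a.

Definition orthant (R : realType) n : set 'rV[R]_n :=
  [set x | forall i, 0 <= x 0 i].

Definition convex_hull (R : realType) n (S : set 'rV[R]_n) : set 'rV[R]_n :=
  smallest (@convex_set R 'rV[R]_n) S.

Definition newton_polyhedron (R : realType) n (G : set 'rV[R]_n) : Prop :=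
  exists A : set 'rV[nat]_n,
    G = convex_hull (\bigcup_(a in A)
          [set lattice_point R a + v | v in @orthant R n]).

Definition coord_axis (R : realType) n (i : 'I_n) : set 'rV[R]_n :=
  [set x | forall j, j != i -> x 0 j = 0].

Definition coord_hyperplane (R : realType) n (i : 'I_n) : set 'rV[R]_n :=
  [set x | x 0 i = 0].

Definition convenient (R : realType) n (G : set 'rV[R]_n) : Prop :=
  forall i, (G `&` @coord_axis R n i) !=set0.

Definition polyhedral_diff (R : realType) n (S T : set 'rV[R]_n) :
  set 'rV[R]_n := closure (S `\` T).

(* Gamma_-, for G = Gamma_+. *)
Definition region_under (R : realType) n (G : set 'rV[R]_n) : set 'rV[R]_n :=
  polyhedral_diff (@orthant R n) G.

(* V_k is the sum of the k-dimensional volumes of A `&` R^I_{>=0} over all sets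
   I of k coordinates, for a closed subset A of the orthant of R^3. The trace of
   A on the coordinate subspace R^I is read in its coordinates (taken in
   increasing order), i.e. as a subset of R, R * R or (R * R) * R, and is measured
   there by Lebesgue measure. [fine] is harmless: for G convenient, A = Gamma_- is
   compact and all these volumes are finite. *)
Section coordinate_volumes.
Context {R : realType}.
Implicit Types A : set 'rV[R]_3.
Let e (i : 'I_3) : 'rV[R]_3 := delta_mx 0 i.

Definition V3 A : R :=
  fine (((@lebesgue_measure R \x @lebesgue_measure R) \x @lebesgue_measure R)%E
    [set p : (R * R) * R |
       A (p.1.1 *: e ord0 + p.1.2 *: e (inord 1) + p.2 *: e (inord 2))]).

Definition V2 A : R :=
  \sum_(i < 3) \sum_(j < 3 | (i < j)%N)
    fine ((@lebesgue_measure R \x @lebesgue_measure R)%E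
      [set p : R * R | A (p.1 *: e i + p.2 *: e j)]).

Definition V1 A : R :=
  \sum_(i < 3) fine (@lebesgue_measure R [set t : R | A (t *: e i)]).

Definition V0 A : R := if `[< A !=set0 >] then 1 else 0.

End coordinate_volumes.

Definition newton_number (R : realType) (G : set 'rV[R]_3) : R :=
  let A := region_under G in
  3`!%:R * V3 A - 2`!%:R * V2 A + 1`!%:R * V1 A - V0 A.

Definition dot (R : realType) n (a x : 'rV[R]_n) : R :=
  \sum_i a 0 i * x 0 i.

Definition hyperplane (R : realType) n (H : set 'rV[R]_n) : Prop :=
  exists (a : 'rV[R]_n) (c : R), a != 0 /\ H = [set x | dot a x = c].

(* Closed half-spaces of an affine subspace L; the linear form must not be
   constant on L. *)
Definition half_space_in (R : realType) n (L S : set 'rV[R]_n) : Prop :=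
  exists (a : 'rV[R]_n) (c : R),
    (exists x y, [/\ L x, L y & dot a x != dot a y]) /\
    S = L `&` [set x | dot a x <= c].

(* Convex k-polyhedra in a k-dimensional affine subspace L: interior is taken
   relative to L. *)
Definition convex_polyhedron_in (R : realType) n (L C : set 'rV[R]_n) : Prop :=
  exists (m : nat) (S : 'I_m -> set 'rV[R]_n),
    [/\ forall k, half_space_in L (S k),
        C = L `&` \bigcap_k S k &
        exists U, [/\ open U, (U `&` L) !=set0 & U `&` L `<=` C]].

Definition polyhedron_in (R : realType) n (L B : set 'rV[R]_n) : Prop :=
  exists (m : nat) (C : 'I_m -> set 'rV[R]_n),
    (forall k, convex_polyhedron_in L (C k)) /\ B = \bigcup_k C k.

Definition segment (R : realType) n (x y : 'rV[R]_n) : set 'rV[R]_n :=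
  [set (1 - t) *: x + t *: y | t in `[0, 1]].

Definition cone_over (R : realType) n (Q : 'rV[R]_n) (B : set 'rV[R]_n) :
  set 'rV[R]_n := \bigcup_(b in B) segment Q b.

(* H is the hyperplane of the base B; Q is the apex. *)
Definition pyramid (R : realType) n (H B : set 'rV[R]_n) (Q : 'rV[R]_n)
    (D : set 'rV[R]_n) : Prop :=
  [/\ hyperplane H, compact B /\ polyhedron_in H B, ~ H Q & D = cone_over Q B].

(* Euclidean distance; the norm of the library on row vectors is the sup norm. *)
Definition dist_to (R : realType) n (Q : 'rV[R]_n) (H : set 'rV[R]_n) : R :=
  inf [set Num.sqrt (dot (Q - x) (Q - x)) | x in H].

Definition pyramid_with_height (R : realType) n (H B : set 'rV[R]_n) (h : R)
    (D : set 'rV[R]_n) : Prop :=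
  exists Q, pyramid H B Q D /\ dist_to Q H = h.

(* Main.v *)
From HB Require Import structures.
Require Import Defs.
From mathcomp Require Import all_boot all_order all_algebra.
From mathcomp Require Import all_classical all_reals all_analysis.
From mathcomp Require Import measurable_realfun.
From mathcomp Require Import zify lra ring.
Import Order.TTheory GRing.Theory Num.Theory.
Import numFieldNormedType.Exports.
Local Open Scope classical_set_scope.
Local Open Scope ring_scope.
Set Implicit Arguments.
Unset Strict Implicit.
Unset Printing Implicit Defensive.

(** The Newton number is a signed sum of volumes, areas and lengths. The
    difference of the two Newton numbers is therefore the same signed sum [nu_drop]
    of the set D of the points of the join of G and P outside G, minus one when P is
    the origin ([newton_number_diff]). Closures may be ignored: they only add points
    of a Newton boundary, on which no two points are comparable, so that it meets
    each line parallel to an axis at most once ([nu_drop_antichain]). A coordinate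
    plane that avoids P does not meet D.

    If P is in no coordinate plane, only the volume of D counts and the drop is
    positive. If P is in one coordinate plane, or on one axis, let it climb
    vertically, in each coordinate plane that contains it, until it enters G. Between
    the heights t and t' the join loses a layer of volume at least (t' - t) / 3 times
    the area of the shadow of D, its projection along the vertical axis
    ([volume_step]), whereas the area lost in a vertical coordinate plane through P
    is at most (t' - t) / 2 times the length of the trace of the shadow
    ([area_step]). Summing over finer and finer subdivisions ([telescoping]), the
    drop is non-negative once, at all heights, twice the area of the shadow is at
    least the length of its trace, or the sum of its two traces minus one when P is
    on an axis ([climb_ge0]); and if the drop vanishes, this inequality is an
    equality at the initial height ([climb_eq0]).

    The inequality at a given height is lattice geometry. The edge from P that bounds
    the join in a vertical coordinate plane ends at a lattice point a, and the next
    face contains a lattice point b off that plane, hence at distance at least one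
    from it ([extreme_side]). The triangle P a b projects into the shadow, and the
    trace does not extend beyond a. In a plane this gives one triangle on each side
    of P ([static_middle]); on an axis, one triangle for each of the two planes, or a
    single one with legs m and n for which m n >= m + n - 1 ([static_two_sides]).
    Equality forces b to be a lattice point at distance one which, together with
    the directions in the plane and the upward ones, spans G from P ([apex_y]). Then D
    is contained in the half-open pyramid with apex b over its trace on the plane,
    and a comparison of volumes shows that it fills this pyramid ([apex_y_cone]).
    Conversely the terms of a pyramid of height one cancel in pairs
    ([cone_y_nu_drop]).

    When P is the origin, D is such a pyramid as soon as a unit vector is in G
    ([unit_cone]); otherwise joining G with a unit vector first shows that the drop
    exceeds one ([nu_drop_origin]).

    These arguments take place in triples of real numbers, where G is a finite
    intersection of half-spaces with positive coefficients: it is obtained by joining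
    finitely many lattice points, one at a time, to the region above a simplex
    ([pjoin_polyE], [newton_data_hull]). The closures of the statement are then given
    by explicit inequalities ([closure_sbelow]) and its pyramids correspond to
    half-open ones ([pyramid_cone_y], [cone_y_pyramid]). *)

(** * Volumes of cones by slicing *)

Section cone_volumes.
Context {R : realType}.
Local Notation mu1 := (@lebesgue_measure R).
Local Notation mu2 := ((@lebesgue_measure R \x @lebesgue_measure R)%E).
Local Notation mu3 := (((@lebesgue_measure R \x @lebesgue_measure R) \x @lebesgue_measure R)%E).

(** The product measure is defined by integrating over the first factor.
    Integrating over the second one defines a measure with the same values on
    rectangles, hence the same measure. *)
Lemma product_measure_ysection d1 d2 (T1 : measurableType d1)
    (T2 : measurableType d2) (m1 : {sigma_finite_measure set T1 -> \bar R})
    (m2 : {sigma_finite_measure set T2 -> \bar R}) (A : set (T1 * T2)) :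
  measurable A ->
  (m1 \x m2)%E A = (\int[m2]_y m1 [set x | A (x, y)])%E.
Proof.
move=> mA.
rewrite (@product_measure_unique _ _ _ _ _ m1 m2 (m1 \x^ m2)%E) //; last first.
  by move=> B C mB mC; exact: product_measure2E.
rewrite /product_measure2 /=.
by apply: eq_integral => y _ /=; congr (m1 _); rewrite ysectionE.
Qed.

Lemma product_measure_xsection d1 d2 (T1 : measurableType d1)
    (T2 : measurableType d2) (m1 : {sigma_finite_measure set T1 -> \bar R})
    (m2 : {sigma_finite_measure set T2 -> \bar R}) (A : set (T1 * T2)) :
  (m1 \x m2)%E A = (\int[m1]_x m2 [set y | A (x, y)])%E.
Proof.
rewrite /product_measure1.
by apply: eq_integral => y _ /=; congr (m2 _); rewrite xsectionE.
Qed.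

Lemma measurable_affine (c k : R) : measurable_fun setT (fun x : R => (x - c) / k).
Proof. by apply: measurable_funM => //; apply: measurable_funB. Qed.

Lemma pushforward_scaled_measure d1 d2 (T1 : measurableType d1)
    (T2 : measurableType d2) (m : {measure set T1 -> \bar R}) (f : T1 -> T2)
    (r : {nonneg R}) : measurable_fun setT f ->
  exists nu : {measure set T2 -> \bar R},
    forall A, nu A = (r%:num%:E * m (f @^-1` A))%E.
Proof.
move=> mf.
have [nu0 nu0E] : exists nu : {measure set T2 -> \bar R},
    forall A, nu A = m (f @^-1` A).
  by unshelve (eexists; move=> A; refine (erefl (pushforward m f A))).
exists (mscale r nu0) => A.
exact: (congr1 (fun t => r%:num%:E * t)%E (nu0E A)).
Qed.

(** Both sides are measures in [B], so it is enough to compare them on half-open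
    intervals. *)
Lemma lebesgue_homothety (c k : R) (B : set R) : 0 < k -> measurable B ->
  mu1 [set x | B ((x - c) / k)] = (k%:E * mu1 B)%E.
Proof.
move=> k0 mB.
pose f := (fun x : R => (x - c) / k).
have mf : measurable_fun setT (f : measurableTypeR R -> measurableTypeR R).
  exact: measurable_affine.
have kn : 0 <= k^-1 by rewrite invr_ge0 ltW.
have [nu nuE] := pushforward_scaled_measure mu1 (NngNum kn) mf.
have E : forall X, ocitv X -> mu1 X = nu X.
  move=> X [[a b] _ /= <-].
  rewrite nuE /=.
  have -> : f @^-1` `]a, b]%classic = `]k * a + c, k * b + c]%classic.
    by apply/seteqP; split => x /=; rewrite /f !in_itv /=;
      rewrite ltr_pdivlMr // ler_pdivrMr // => /andP[h1 h2]; apply/andP; split; lra.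
  rewrite !lebesgue_measure_itv /= !lte_fin.
  have -> : (k * a + c < k * b + c) = (a < b) by rewrite ltrD2r ltr_pM2l.
  case: ifP => _; last by rewrite mule0.
  by rewrite -!EFinB -EFinM; congr EFin; field; rewrite gt_eqF.
rewrite (lebesgue_measure_unique E mB) nuE /=.
by rewrite muleA -EFinM mulfV ?gt_eqF // mul1e.
Qed.

Lemma lebesgue2_homothety (c d k l : R) (B : set (R * R)) :
  0 < k -> 0 < l -> measurable B ->
  mu2 [set p | B ((p.1 - c) / k, (p.2 - d) / l)] = ((k * l)%:E * mu2 B)%E.
Proof.
move=> k0 l0 mB.
pose f := (fun p : R * R => ((p.1 - c) / k, (p.2 - d) / l)).
have mf : measurable_fun setT
    (f : measurableTypeR R * measurableTypeR R ->
         measurableTypeR R * measurableTypeR R).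
  apply/measurable_fun_pairP; split.
    by apply: (measurableT_comp (measurable_affine c k)); exact: measurable_fst.
  by apply: (measurableT_comp (measurable_affine d l)); exact: measurable_snd.
have kl0 : 0 < k * l by rewrite mulr_gt0.
have kn : 0 <= (k * l)^-1 by rewrite invr_ge0 ltW.
have [nu nuE] := pushforward_scaled_measure mu2 (NngNum kn) mf.
have k2 : k * l != 0 by rewrite gt_eqF.
rewrite [X in _ = (_ * X)%E](@product_measure_unique _ _ _ _ _ mu1 mu1 nu) //.
  by rewrite nuE /= muleA -EFinM mulfV // mul1e.
move=> X Y mX mY.
rewrite nuE /=.
have -> : f @^-1` (X `*` Y) =
    [set x | X ((x - c) / k)] `*` [set x | Y ((x - d) / l)] by [].
rewrite product_measure1E; last 2 first.
- by rewrite -[X in measurable X]setTI; exact: measurable_affine.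
- by rewrite -[X in measurable X]setTI; exact: measurable_affine.
transitivity ((k * l)^-1%:E * ((k%:E * mu1 X) * (l%:E * mu1 Y)))%E.
  by congr (_ * (_ * _))%E; exact: lebesgue_homothety.
rewrite (muleACA k%:E) -(EFinM k l).
by rewrite (muleA _ (k * l)%:E) -EFinM mulVf // mul1e.
Qed.

Lemma integral_onem_exp (n : nat) :
  (\int[mu1]_(u in `[0%R, 1%R]) ((1 - u) ^+ n)%:E = (n.+1%:R^-1)%:E)%E.
Proof.
rewrite -[in RHS]Rintegral_onemXn /Rintegral fineK //.
have /integrable_fin_num := integrable_XMonemX (R := R) 0 n.
by under eq_integral do rewrite /= XMonemX0n; apply.
Qed.

(** The base point, at height [0], of the line through [(x, u)] and the apex
    [(q, 1)]. *)
Definition cone_chart (q x u : R) : R := (x - u * q) / (1 - u).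

(** Written with a real power, the chart is a product of functions that are
    measurable on the whole line. *)
Lemma cone_chart_powR (q x u : R) : u < 1 ->
  cone_chart q x u = (x - u * q) * ((1 - u) `^ (-1)).
Proof. by move=> u1; rewrite /cone_chart powR_inv1 // subr_ge0 ltW. Qed.

Lemma measurable_cone_chart d (T : measurableType d) (q : R) (f g : T -> R) :
  measurable_fun setT f -> measurable_fun setT g ->
  measurable_fun setT (fun p => (f p - g p * q) * ((1 - g p) `^ (-1))).
Proof.
move=> mf mg; apply: measurable_funM.
  by apply: measurable_funB => //; apply: measurable_funM.
by apply: (measurableT_comp (measurable_powR (-1))); apply: measurable_funB.
Qed.

(** The slice at height [u] is the base scaled by [1 - u]. The apex, where the
    chart has no meaning, is left out. *)
Lemma cone_measure2 (q : R) (B : set R) : measurable B ->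
  measurable [set p : R * R | 0 <= p.2 < 1 /\ B (cone_chart q p.1 p.2)] /\
  mu2 [set p : R * R | 0 <= p.2 < 1 /\ B (cone_chart q p.1 p.2)] =
  (2^-1%:E * mu1 B)%E.
Proof.
move=> mB.
have mC : measurable [set p : R * R | 0 <= p.2 < 1 /\ B (cone_chart q p.1 p.2)].
  pose f (p : R * R) := (p.1 - p.2 * q) * ((1 - p.2) `^ (-1)).
  rewrite (_ : mkset _ = (snd @^-1` `[0, 1[%classic) `&` f @^-1` B); last first.
    apply/seteqP; split => p /=; rewrite in_itv /= => -[/andP[p0 p1] h];
      by move: h; rewrite cone_chart_powR // p0 p1.
  apply: measurableI.
    by rewrite -[X in measurable X]setTI; exact: measurable_snd.
  rewrite -[X in measurable X]setTI.
  by apply: measurable_cone_chart.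
split; first exact: mC.
etransitivity; first exact: product_measure_ysection.
transitivity (\int[mu1]_(u in `[0%R, 1%R]) (((1 - u) ^+ 1)%:E * mu1 B))%E; last first.
  rewrite ge0_integralZr //; last 2 first.
  - by apply/measurable_EFinP; apply: measurable_funX; exact: measurable_funB.
  - by move=> u /=; rewrite in_itv /= => /andP[_ u1]; rewrite lee_fin exprn_ge0 // subr_ge0.
  by rewrite integral_onem_exp.
rewrite [RHS]integral_mkcond; apply: eq_integral => u _ /=.
rewrite patchE; case: ifPn => [|]; rewrite ?inE /= ?notin_setE /= in_itv /=.
  move=> /andP[u0]; rewrite le_eqVlt => /orP[/eqP ->|u1].
    rewrite subrr expr1 mul0e (_ : mkset _ = set0) ?measure0 //.
    by apply/seteqP; split => x //= [/andP[_]]; rewrite ltxx.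
  rewrite expr1 -(lebesgue_homothety (u * q)) ?subr_gt0 //.
  by congr (mu1 _); apply/seteqP; split => x /=; [case | split; rewrite ?u0].
move=> /negP uN; rewrite (_ : mkset _ = set0) ?measure0 //.
by apply/seteqP; split => x //= [/andP[u0 u1]]; case: uN; rewrite u0 ltW.
Qed.

(** The sigma-finite structure is given explicitly, since unification would look
    for that of a product of probabilities. *)
Definition lebesgue2 :
  {sigma_finite_measure set (measurableTypeR R * measurableTypeR R)%type -> \bar R} :=
  HB.pack (product_measure1 mu1 mu1)
    (lebesgue_integral_fubini.measure_function_Measure_isSigmaFinite__to__measure_function_isSigmaFinite
       mu1 mu1)
    (lebesgue_integral_fubini.measure_function_Measure_isSigmaFinite__to__measure_function_isSFinite
       mu1 mu1).

Lemma lebesgue3_ysection (A : set (R * R * R)) : measurable A ->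
  mu3 A = (\int[mu1]_z mu2 [set p | A (p, z)])%E.
Proof.
by move=> mA; exact: (@product_measure_ysection _ _ _ _ lebesgue2 mu1 A mA).
Qed.

Lemma lebesgue3_xsection (A : set (R * R * R)) : measurable A ->
  mu3 A = (\int[mu2]_p mu1 [set z | A (p, z)])%E.
Proof. by move=> mA; exact: (@product_measure_xsection _ _ _ _ lebesgue2 mu1 A). Qed.

Local Notation R3 := (measurableTypeR R * measurableTypeR R * measurableTypeR R)%type.

Lemma measurable_proj1 : measurable_fun setT (fun p : R3 => p.1.1).
Proof. exact: (measurableT_comp measurable_fst (@measurable_fst _ _ _ (measurableTypeR R))). Qed.

Lemma measurable_proj2 : measurable_fun setT (fun p : R3 => p.1.2).
Proof. exact: (measurableT_comp measurable_snd (@measurable_fst _ _ _ (measurableTypeR R))). Qed.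

(** The slice at height [u] is the base scaled by [1 - u] in both directions. *)
Lemma cone_measure3 (q1 q2 : R) (B : set (R * R)) : measurable B ->
  measurable [set p : R * R * R | 0 <= p.2 < 1 /\
    B (cone_chart q1 p.1.1 p.2, cone_chart q2 p.1.2 p.2)] /\
  mu3 [set p : R * R * R | 0 <= p.2 < 1 /\
    B (cone_chart q1 p.1.1 p.2, cone_chart q2 p.1.2 p.2)] = (3^-1%:E * mu2 B)%E.
Proof.
move=> mB.
set C := [set p : R * R * R | _].
have mC : measurable C.
  pose f (p : R * R * R) := ((p.1.1 - p.2 * q1) * ((1 - p.2) `^ (-1)),
    (p.1.2 - p.2 * q2) * ((1 - p.2) `^ (-1))).
  rewrite (_ : C = (snd @^-1` `[0, 1[%classic) `&` f @^-1` B); last first.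
    apply/seteqP; rewrite /C /f; split => p /=; rewrite in_itv /= => -[/andP[p0 p1] h];
      by move: h; rewrite !cone_chart_powR // p0 p1.
  apply: measurableI.
    by rewrite -[X in measurable X]setTI; exact: measurable_snd.
  have mf : measurable_fun setT f.
    apply/measurable_fun_pairP; split; apply: measurable_cone_chart;
      do ?exact: measurable_snd.
      exact: measurable_proj1.
    exact: measurable_proj2.
  by rewrite -[X in measurable X]setTI; exact: mf.
split; first exact: mC.
rewrite lebesgue3_ysection //.
transitivity (\int[mu1]_(u in `[0%R, 1%R]) (((1 - u) ^+ 2)%:E * mu2 B))%E; last first.
  rewrite ge0_integralZr //; last 2 first.
  - by apply/measurable_EFinP; apply: measurable_funX; exact: measurable_funB.
  - by move=> u /=; rewrite in_itv /= => /andP[_ u1]; rewrite lee_fin exprn_ge0 // subr_ge0.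
  by rewrite integral_onem_exp.
rewrite [RHS]integral_mkcond; apply: eq_integral => u _ /=.
rewrite patchE; case: ifPn => [|]; rewrite ?inE /= ?notin_setE /= in_itv /=.
  move=> /andP[u0]; rewrite le_eqVlt => /orP[/eqP ->|u1].
    rewrite subrr expr0n mul0e (_ : mkset _ = set0) ?measure0 //.
    by apply/seteqP; split => x //= [/andP[_]]; rewrite ltxx.
  rewrite expr2 -(lebesgue2_homothety (u * q1) (u * q2)) ?subr_gt0 //.
  by congr (mu2 _); apply/seteqP; split => x /=; [case | split; rewrite ?u0].
move=> /negP uN; rewrite (_ : mkset _ = set0) ?measure0 //.
by apply/seteqP; split => x //= [/andP[u0 u1]]; case: uN; rewrite u0 ltW.
Qed.

Lemma lebesgue2_swap (A : set (R * R)) : measurable A ->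
  measurable [set p : R * R | A (p.2, p.1)] /\ mu2 [set p : R * R | A (p.2, p.1)] = mu2 A.
Proof.
move=> mA.
have mf : measurable_fun setT
    ((fun p => (p.2, p.1)) : measurableTypeR R * measurableTypeR R ->
         measurableTypeR R * measurableTypeR R).
  by apply/measurable_fun_pairP; split; [exact: measurable_snd|exact: measurable_fst].
have mS : measurable [set p : R * R | A (p.2, p.1)].
  by rewrite -[X in measurable X]setTI; exact: mf.
by split=> //; rewrite product_measure_ysection // product_measure_xsection.
Qed.

Lemma lebesgue3_swap12 (A : set (R * R * R)) : measurable A ->
  measurable [set p : R * R * R | A (p.1.2, p.1.1, p.2)] /\
  mu3 [set p : R * R * R | A (p.1.2, p.1.1, p.2)] = mu3 A.
Proof.
move=> mA.
have mf : measurable_fun setT ((fun p => (p.1.2, p.1.1, p.2)) :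
    measurableTypeR R * measurableTypeR R * measurableTypeR R ->
    measurableTypeR R * measurableTypeR R * measurableTypeR R).
  apply/measurable_fun_pairP; split; last exact: measurable_snd.
  apply/measurable_fun_pairP; split.
    exact: measurable_proj2.
  exact: measurable_proj1.
have mS : measurable [set p : R * R * R | A (p.1.2, p.1.1, p.2)].
  by rewrite -[X in measurable X]setTI; exact: mf.
split; first exact: mS.
rewrite (lebesgue3_ysection mS) (lebesgue3_ysection mA); apply: eq_integral => z _.
have mAz : measurable [set p : R * R | A (p, z)].
  by have := measurable_ysection z mA; rewrite ysectionE.
have [_ <-] := lebesgue2_swap mAz.
by congr (mu2 _); apply/seteqP; split => -[x y].
Qed.

(** Slicing along the first coordinate, which Tonelli's theorem allows, reduces
    the exchange to that of two coordinates of the plane. *)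
Lemma lebesgue3_swap23 (A : set (R * R * R)) : measurable A ->
  measurable [set p : R * R * R | A (p.1.1, p.2, p.1.2)] /\
  mu3 [set p : R * R * R | A (p.1.1, p.2, p.1.2)] = mu3 A.
Proof.
move=> mA.
have mf : measurable_fun setT ((fun p => (p.1.1, p.2, p.1.2)) :
    measurableTypeR R * measurableTypeR R * measurableTypeR R ->
    measurableTypeR R * measurableTypeR R * measurableTypeR R).
  apply/measurable_fun_pairP; split; last first.
    exact: measurable_proj2.
  apply/measurable_fun_pairP; split; last exact: measurable_snd.
  exact: measurable_proj1.
have mS : measurable [set p : R * R * R | A (p.1.1, p.2, p.1.2)].
  by rewrite -[X in measurable X]setTI; exact: mf.
split; first exact: mS.
have E (B : set (R * R * R)) : measurable B ->
    mu3 B = (\int[mu1]_x mu2 [set p : R * R | B (x, p.1, p.2)])%E.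
  move=> mB; rewrite lebesgue3_xsection //.
  have mB1 : measurable_fun setT (fun p : measurableTypeR R * measurableTypeR R =>
      mu1 [set z | B (p, z)]).
    have := lebesgue_integral_fubini.measurable_fun_xsection mu1 mB.
    by apply: eq_measurable_fun => p _ /=; rewrite xsectionE.
  have H := @fubini_tonelli1 _ _ _ _ _ mu1 mu1 _ mB1 (fun _ => measure_ge0 _ _).
  etransitivity; first exact: H.
  apply: eq_integral => x _; rewrite /fubini_F product_measure_xsection.
  by [].
rewrite (E _ mS) (E _ mA); apply: eq_integral => x _.
have mAx : measurable [set p : R * R | A (x, p.1, p.2)].
  have mg : measurable_fun setT ((fun p => (x, p.1, p.2)) :
      measurableTypeR R * measurableTypeR R ->
      measurableTypeR R * measurableTypeR R * measurableTypeR R).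
    apply/measurable_fun_pairP; split; last exact: measurable_snd.
    by apply/measurable_fun_pairP; split; [exact: measurable_cst|exact: measurable_fst].
  by rewrite -[X in measurable X]setTI; exact: mg.
by have [_ <-] := lebesgue2_swap mAx.
Qed.

(** The triangle is a cone over the interval from [a] to [b], stretched
    vertically. *)
Lemma triangle_measure (a b q h : R) : a <= b -> 0 < h ->
  let T := [set p : R * R | [/\ 0 <= p.2, p.2 < h, a + (q - a) * (p.2 / h) < p.1 &
    p.1 < b + (q - b) * (p.2 / h)]] in
  measurable T /\ mu2 T = ((b - a) * h / 2)%:E.
Proof.
move=> ab h0 T.
have [mC mu2C] := cone_measure2 q (measurable_itv `]a, b[).
set C := (X in measurable X) in mC; rewrite -/C in mu2C.
have TE : T = [set p | C ((p.1 - 0) / 1, (p.2 - 0) / h)].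
  apply/seteqP; split => -[x y]; rewrite /T /C /cone_chart /= !subr0 divr1 in_itv /=.
    move=> [y0 yh h1 h2].
    have u1 : y / h < 1 by rewrite ltr_pdivrMr // mul1r.
    split; first by rewrite u1 divr_ge0 // ltW.
    by apply/andP; rewrite ltr_pdivlMr ?subr_gt0 // ltr_pdivrMr ?subr_gt0 //; split; lra.
  move=> [/andP[y0 u1]] /andP[].
  rewrite ltr_pdivlMr ?subr_gt0 // ltr_pdivrMr ?subr_gt0 // => h1 h2.
  split; [|by move: u1; rewrite ltr_pdivrMr // mul1r|lra|lra].
  by move: y0; rewrite pmulr_lge0 // invr_gt0.
have mT : measurable T.
  rewrite TE.
  have mf : measurable_fun setT ((fun p => ((p.1 - 0) / 1, (p.2 - 0) / h)) :
      measurableTypeR R * measurableTypeR R -> measurableTypeR R * measurableTypeR R).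
    apply/measurable_fun_pairP; split.
      exact: (measurableT_comp (measurable_affine 0 1) (@measurable_fst _ _ (measurableTypeR R) (measurableTypeR R))).
    exact: (measurableT_comp (measurable_affine 0 h) (@measurable_snd _ _ (measurableTypeR R) (measurableTypeR R))).
  by rewrite -[X in measurable X]setTI; exact: mf.
split; first exact: mT.
rewrite TE lebesgue2_homothety // mu2C lebesgue_measure_itv /= lte_fin mul1r.
case: ltP => [_|ba]; first by rewrite -EFinB -!EFinM; congr EFin; field.
have -> : b = a by apply/eqP; rewrite eq_le ab ba.
by rewrite subrr !mul0r !mule0.
Qed.
End cone_volumes.

(** * Polyhedra of the orthant and their joins with a point *)

Section polyhedra.
Context {R : realType}.
Implicit Types (p q a v : R * R * R) (s : seq (R * R * R)).

Definition ev a p : R := a.1.1 * p.1.1 + a.1.2 * p.1.2 + a.2 * p.2.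

Definition mix (r : R) p q : R * R * R :=
  ((1 - r) * p.1.1 + r * q.1.1, (1 - r) * p.1.2 + r * q.1.2, (1 - r) * p.2 + r * q.2).

Definition nonneg3 p := [/\ 0 <= p.1.1, 0 <= p.1.2 & 0 <= p.2].
Definition pos3 p := [/\ 0 < p.1.1, 0 < p.1.2 & 0 < p.2].
Definition pos_forms s := forall a, a \in s -> pos3 a.

(** The facets of a convenient Newton polyhedron that are not in coordinate
    planes have normal vectors with positive coordinates; scaling makes their
    constants equal to [1]. *)
Definition hpoly s : set (R * R * R) :=
  [set p | nonneg3 p /\ forall a, a \in s -> 1 <= ev a p].

(** The union of the segments from [p] to the points of [G]: for a nonempty
    convex [G], the convex hull of [G] and [p]. *)
Definition pjoin (G : set (R * R * R)) p : set (R * R * R) :=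
  [set v | exists r q, [/\ 0 <= r <= 1, G q & v = mix r p q]].

Lemma eq3 p q : p.1.1 = q.1.1 -> p.1.2 = q.1.2 -> p.2 = q.2 -> p = q.
Proof. by case: p q => [[x y] z] [[x' y'] z'] /= -> -> ->. Qed.

Lemma ev_mix a r p q : ev a (mix r p q) = (1 - r) * ev a p + r * ev a q.
Proof. by rewrite /ev /mix /=; ring. Qed.

Lemma ev_ge0 a p : pos3 a -> nonneg3 p -> 0 <= ev a p.
Proof.
by case=> a1 a2 a3 [p1 p2 p3]; rewrite !addr_ge0 // mulr_ge0 // ltW.
Qed.

Lemma le_ev a p q : pos3 a -> p.1.1 <= q.1.1 -> p.1.2 <= q.1.2 -> p.2 <= q.2 ->
  ev a p <= ev a q.
Proof. by case=> a1 a2 a3 h1 h2 h3; rewrite !lerD // ler_pM2l. Qed.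

Lemma exists_argmin (T : eqType) (f : T -> R) (s : seq T) (P : pred T) :
  (exists2 x, x \in s & P x) ->
  exists2 x, x \in s /\ P x & forall y, y \in s -> P y -> f x <= f y.
Proof.
elim: s => [[x]//|y s IH] [x xs Px].
have [/hasP h|/hasPn h] := boolP (has P s).
  have [z [zs Pz] zmin] := IH h.
  have [fyz|fzy] := leP (f y) (f z).
    have [Py|/negP Py] := boolP (P y).
      exists y; first by rewrite mem_head.
      move=> w; rewrite inE => /orP[/eqP -> //|ws Pw].
      by apply: (le_trans fyz); exact: zmin.
    exists z; first by rewrite inE zs orbT.
    by move=> w; rewrite inE => /orP[/eqP -> /Py //|]; exact: zmin.
  exists z; first by rewrite inE zs orbT.
  by move=> w; rewrite inE => /orP[/eqP -> _|]; [exact: ltW|exact: zmin].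
have xy : x = y.
  by move: xs; rewrite inE => /orP[/eqP //|/h]; rewrite Px.
exists y; first by rewrite mem_head -xy.
by move=> w; rewrite inE => /orP[/eqP -> //|/h /negP].
Qed.

(** One step of Fourier-Motzkin elimination: each pair (b, k) of the list stands
    for the inequality [0 <= b + k * u] in the unknown [u], for which the
    largest lower bound is a solution. *)
Lemma fourier_motzkin (c : seq (R * R)) :
  (exists2 x, x \in c & 0 < x.2) ->
  (forall x, x \in c -> x.2 = 0 -> 0 <= x.1) ->
  (forall x y, x \in c -> y \in c -> 0 < x.2 -> y.2 < 0 ->
    0 <= x.1 * - y.2 + y.1 * x.2) ->
  exists u, forall x : R * R, x \in c -> 0 <= x.1 + x.2 * u.
Proof.
move=> pos zero pairs.
have [x [xc x2] xmin] := exists_argmin (fun x => x.1 / x.2) pos.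
exists (- (x.1 / x.2)) => y yc.
have [y2|y2|y2] := ltrgt0P y.2.
- have := xmin _ yc y2; rewrite ler_pdivlMr //; lra.
- have := pairs _ _ xc yc x2 y2.
  have -> : y.1 + y.2 * - (x.1 / x.2) = (x.1 * - y.2 + y.1 * x.2) / x.2.
    by field; rewrite gt_eqF.
  by move=> h; rewrite divr_ge0 // ltW.
- by rewrite y2 mul0r addr0; exact: zero.
Qed.

Definition scale3 (k : R) a : R * R * R := (k * a.1.1, k * a.1.2, k * a.2).
Definition add3 a b : R * R * R := (a.1.1 + b.1.1, a.1.2 + b.1.2, a.2 + b.2).

Lemma ev_scale k a p : ev (scale3 k a) p = k * ev a p.
Proof. by rewrite /ev /=; ring. Qed.
Lemma ev_add a b p : ev (add3 a b) p = ev a p + ev b p.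
Proof. by rewrite /ev /=; ring. Qed.

(** The forms satisfied at [p] are kept. Each form violated at [p] is rescaled,
    completed by a multiple of a coordinate positive at [p], or combined with a
    form that exceeds [1] at [p], so as to take the value [1] at [p]. *)
Definition pjoin_forms s p : seq (R * R * R) :=
  [seq a <- s | 1 <= ev a p] ++
  [seq scale3 (ev a p)^-1 a | a <- s & 0 < ev a p < 1] ++
  [seq add3 a ((1 - ev a p) / p.1.1, 0, 0) | a <- s & (ev a p < 1) && (0 < p.1.1)] ++
  [seq add3 a (0, (1 - ev a p) / p.1.2, 0) | a <- s & (ev a p < 1) && (0 < p.1.2)] ++
  [seq add3 a (0, 0, (1 - ev a p) / p.2) | a <- s & (ev a p < 1) && (0 < p.2)] ++
  [seq scale3 (ev ab.2 p - ev ab.1 p)^-1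
     (add3 (scale3 (ev ab.2 p - 1) ab.1) (scale3 (1 - ev ab.1 p) ab.2))
   | ab <- [seq (a, b) | a <- s, b <- s] & (ev ab.1 p < 1) && (1 < ev ab.2 p)].

Lemma pos_pjoin_forms s p : pos_forms s -> pos_forms (pjoin_forms s p).
Proof.
move=> ps x; rewrite /pjoin_forms !mem_cat => /orP[|/orP[|/orP[|/orP[|/orP[|]]]]].
- by rewrite mem_filter => /andP[_ /ps].
- move=> /mapP[a]; rewrite mem_filter => /andP[/andP[h _] /ps [a1 a2 a3]] ->.
  by split; rewrite mulr_gt0 // invr_gt0.
- move=> /mapP[a]; rewrite mem_filter => /andP[/andP[h k] /ps [a1 a2 a3]] ->.
  by split; rewrite /= ?addr0 // addr_gt0 // divr_gt0 // subr_gt0.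
- move=> /mapP[a]; rewrite mem_filter => /andP[/andP[h k] /ps [a1 a2 a3]] ->.
  by split; rewrite /= ?addr0 // addr_gt0 // divr_gt0 // subr_gt0.
- move=> /mapP[a]; rewrite mem_filter => /andP[/andP[h k] /ps [a1 a2 a3]] ->.
  by split; rewrite /= ?addr0 // addr_gt0 // divr_gt0 // subr_gt0.
- move=> /mapP[ab]; rewrite mem_filter => /andP[/andP[h k]].
  move=> /allpairsP[[a b] /= [/ps [a1 a2 a3] /ps [b1 b2 b3] E]].
  rewrite {}E /= in h k *; move=> ->.
  have k1 : 0 < ev b p - 1 by lra.
  have k2 : 0 < 1 - ev a p by lra.
  have k3 : 0 < ev b p - ev a p by lra.
  by split; rewrite /= mulr_gt0 ?invr_gt0 // addr_gt0 // mulr_gt0.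
Qed.

Lemma hpoly_nonempty s : pos_forms s -> exists q, hpoly s q.
Proof.
move=> ps.
have [N [N0 hN]] : exists N : R, 0 <= N /\ forall a, a \in s -> 1 <= a.1.1 * N.
  elim: s ps => [_|a s IH ps]; first by exists 0.
  have [N [N0 hN]] : exists N : R, 0 <= N /\ forall a, a \in s -> 1 <= a.1.1 * N.
    by apply: IH => b bs; apply: ps; rewrite inE bs orbT.
  have [a1 _ _] := ps a (mem_head _ _).
  exists (N + a.1.1^-1); split; first by rewrite addr_ge0 // invr_ge0 ltW.
  move=> b; rewrite inE => /orP[/eqP ->|bs].
    by rewrite mulrDr divff ?gt_eqF // lerDr mulr_ge0 // ltW.
  rewrite mulrDr (le_trans (hN b bs)) // lerDl mulr_ge0 ?invr_ge0 ?(ltW a1) //.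
  by have [/ltW ? _ _] := ps b (mem_behead (s := a :: s) bs).
exists (N, 0, 0); split=> //= a /hN; rewrite /ev /=; lra.
Qed.

(** A point [v] is in the join when some weight [u] of [p] satisfies finitely
    many affine inequalities, from which [u] is eliminated. If the elimination
    only yields [u = 1], then [v] dominates [p] coordinatewise, and either [v =
    p] or a slightly smaller weight works. *)
Lemma pjoin_polyE s p : pos_forms s -> nonneg3 p ->
  pjoin (hpoly s) p = hpoly (pjoin_forms s p).
Proof.
move=> ps [p1 p2 p3]; apply/seteqP; split=> v.
  move=> [r [q [/andP[r0 r1] [[q1 q2 q3] hq] ->]]].
  have r1' : 0 <= 1 - r by rewrite subr_ge0.
  have H a : a \in s -> (1 - r) * ev a p + r <= ev a (mix r p q).
    by move=> /hq h; rewrite ev_mix lerD2l ler_peMr.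
  have v1 : (1 - r) * p.1.1 <= (mix r p q).1.1 by rewrite /= lerDl mulr_ge0.
  have v2 : (1 - r) * p.1.2 <= (mix r p q).1.2 by rewrite /= lerDl mulr_ge0.
  have v3 : (1 - r) * p.2 <= (mix r p q).2 by rewrite /= lerDl mulr_ge0.
  move: (mix r p q) H v1 v2 v3 => w H v1 v2 v3.
  split; first by split; [move: v1|move: v2|move: v3]; apply: le_trans; rewrite mulr_ge0.
  move=> x; rewrite /pjoin_forms !mem_cat => /orP[|/orP[|/orP[|/orP[|/orP[|]]]]].
  - rewrite mem_filter => /andP[h /H]; apply: le_trans; nra.
  - move=> /mapP[a]; rewrite mem_filter => /andP[/andP[h h1] /H k] ->.
    by rewrite ev_scale mulrC ler_pdivlMr // mul1r; apply: le_trans k; nra.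
  - move=> /mapP[a]; rewrite mem_filter => /andP[/andP[h k] /H ha] ->.
    rewrite ev_add /ev /= !mul0r !addr0 -/(ev a w).
    have -> : (1 - ev a p) / p.1.1 * w.1.1 = (1 - ev a p) * (w.1.1 / p.1.1) by ring.
    have : 1 - r <= w.1.1 / p.1.1 by rewrite ler_pdivlMr.
    nra.
  - move=> /mapP[a]; rewrite mem_filter => /andP[/andP[h k] /H ha] ->.
    rewrite ev_add /ev /= !mul0r !addr0 !add0r -/(ev a w).
    have -> : (1 - ev a p) / p.1.2 * w.1.2 = (1 - ev a p) * (w.1.2 / p.1.2) by ring.
    have : 1 - r <= w.1.2 / p.1.2 by rewrite ler_pdivlMr.
    nra.
  - move=> /mapP[a]; rewrite mem_filter => /andP[/andP[h k] /H ha] ->.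
    rewrite ev_add /ev /= !mul0r !add0r -/(ev a w).
    have -> : (1 - ev a p) / p.2 * w.2 = (1 - ev a p) * (w.2 / p.2) by ring.
    have : 1 - r <= w.2 / p.2 by rewrite ler_pdivlMr.
    nra.
  - move=> /mapP[ab]; rewrite mem_filter => /andP[/andP[h k]].
    move=> /allpairsP[[a b] /= [/H ha /H hb E]].
    rewrite {}E /= in h k *; move=> ->.
    rewrite ev_scale ev_add !ev_scale mulrC ler_pdivlMr; last by lra.
    nra.
move=> [[v1 v2 v3] hv].
pose c : seq (R * R) := [:: (0, 1); (1, -1); (v.1.1, - p.1.1); (v.1.2, - p.1.2); (v.2, - p.2)]
  ++ [seq (ev a v - 1, 1 - ev a p) | a <- s].
have cpos (x : R * R) : x \in c -> 0 < x.2 ->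
    x = (0, 1) \/ exists2 a, a \in s & ev a p < 1 /\ x = (ev a v - 1, 1 - ev a p).
  rewrite mem_cat !inE -!orbA => /orP[/eqP ->|]; first by left.
  do 4 (move=> /orP[/eqP -> /=|]; first by move=> ?; exfalso; lra).
  by move=> /mapP[a aS -> /=]; rewrite subr_gt0 => h; right; exists a.
have cneg (x : R * R) : x \in c -> x.2 < 0 -> x = (1, -1) \/
    [\/ 0 < p.1.1 /\ x = (v.1.1, - p.1.1), 0 < p.1.2 /\ x = (v.1.2, - p.1.2),
        0 < p.2 /\ x = (v.2, - p.2) |
        exists2 a, a \in s & 1 < ev a p /\ x = (ev a v - 1, 1 - ev a p)].
  rewrite mem_cat !inE -!orbA => /orP[/eqP -> /=|]; first by move=> ?; exfalso; lra.
  move=> /orP[/eqP -> _|]; first by left.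
  move=> /orP[/eqP -> /=|]; first by rewrite oppr_lt0 => h; right; constructor 1.
  move=> /orP[/eqP -> /=|]; first by rewrite oppr_lt0 => h; right; constructor 2.
  move=> /orP[/eqP -> /=|]; first by rewrite oppr_lt0 => h; right; constructor 3.
  move=> /mapP[a aS -> /=]; rewrite subr_lt0 => h.
  by right; constructor 4; exists a.
have F1 a : a \in s -> 1 <= ev a p -> 1 <= ev a v.
  by move=> aS h; apply: hv; rewrite mem_cat mem_filter h aS.
have F2 a : a \in s -> ev a p < 1 -> ev a p <= ev a v.
  move=> aS h; have [k|k] := ltP 0 (ev a p); last first.
    by apply: (le_trans k); exact: ev_ge0 (ps _ aS) _.
  have /hv : scale3 (ev a p)^-1 a \in pjoin_forms s p.
    rewrite !mem_cat; apply/orP; right; apply/orP; left.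
    by apply: map_f; rewrite mem_filter k h.
  by rewrite ev_scale mulrC ler_pdivlMr // mul1r.
have F3 a : a \in s -> ev a p < 1 -> 0 < p.1.1 ->
    p.1.1 <= p.1.1 * ev a v + (1 - ev a p) * v.1.1.
  move=> aS h k.
  have /hv : add3 a ((1 - ev a p) / p.1.1, 0, 0) \in pjoin_forms s p.
    rewrite !mem_cat; do 2 (apply/orP; right); apply/orP; left.
    by apply/mapP; exists a => //; rewrite mem_filter h k.
  rewrite ev_add {2}/ev /= !mul0r !addr0 -(ler_pM2l k) mulr1 mulrDr.
  have -> : p.1.1 * ((1 - ev a p) / p.1.1 * v.1.1) = (1 - ev a p) * v.1.1 by field; rewrite gt_eqF.
  by [].
have F4 a : a \in s -> ev a p < 1 -> 0 < p.1.2 ->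
    p.1.2 <= p.1.2 * ev a v + (1 - ev a p) * v.1.2.
  move=> aS h k.
  have /hv : add3 a (0, (1 - ev a p) / p.1.2, 0) \in pjoin_forms s p.
    rewrite !mem_cat; do 3 (apply/orP; right); apply/orP; left.
    by apply/mapP; exists a => //; rewrite mem_filter h k.
  rewrite ev_add {2}/ev /= !mul0r add0r !addr0 -(ler_pM2l k) mulr1 mulrDr.
  have -> : p.1.2 * ((1 - ev a p) / p.1.2 * v.1.2) = (1 - ev a p) * v.1.2 by field; rewrite gt_eqF.
  by [].
have F5 a : a \in s -> ev a p < 1 -> 0 < p.2 ->
    p.2 <= p.2 * ev a v + (1 - ev a p) * v.2.
  move=> aS h k.
  have /hv : add3 a (0, 0, (1 - ev a p) / p.2) \in pjoin_forms s p.
    rewrite !mem_cat; do 4 (apply/orP; right); apply/orP; left.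
    by apply/mapP; exists a => //; rewrite mem_filter h k.
  rewrite ev_add {2}/ev /= !mul0r !add0r -(ler_pM2l k) mulr1 mulrDr.
  have -> : p.2 * ((1 - ev a p) / p.2 * v.2) = (1 - ev a p) * v.2 by field; rewrite gt_eqF.
  by [].
have F6 a b : a \in s -> b \in s -> ev a p < 1 -> 1 < ev b p ->
    ev b p - ev a p <= (ev b p - 1) * ev a v + (1 - ev a p) * ev b v.
  move=> aS bS h k.
  have /hv : scale3 (ev b p - ev a p)^-1
     (add3 (scale3 (ev b p - 1) a) (scale3 (1 - ev a p) b)) \in pjoin_forms s p.
    rewrite !mem_cat; do 5 (apply/orP; right).
    apply/mapP; exists (a, b) => //; rewrite mem_filter h k /=.
    by apply/allpairsP; exists (a, b).
  by rewrite ev_scale ev_add !ev_scale mulrC ler_pdivlMr ?mul1r //; lra.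
have [u hu] : exists u, forall x : R * R, x \in c -> 0 <= x.1 + x.2 * u.
  apply: fourier_motzkin.
  - by exists (0, 1); [rewrite mem_cat !inE eqxx|rewrite ltr01].
  - move=> x; rewrite mem_cat !inE -!orbA => /orP[/eqP -> //|].
    do 4 (move=> /orP[/eqP -> //|]).
    by move=> /mapP[a aS -> /=] h; have := F1 _ aS; lra.
  move=> x y /cpos xc /cneg yc /xc{}xc /yc{}yc.
  case: xc => [->|[a aS [ha ->]]] /=.
    case: yc => [-> /=|[[h ->]|[h ->]|[h ->]|[b bS [h ->]]]] /=; rewrite ?mul0r ?add0r ?mulr1 //.
    by have := F1 _ bS (ltW h); lra.
  case: yc => [-> /=|[[h ->]|[h ->]|[h ->]|[b bS [h ->]]]] /=.
  - by have := F2 _ aS ha; lra.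
  - by have := F3 _ aS ha h; lra.
  - by have := F4 _ aS ha h; lra.
  - by have := F5 _ aS ha h; lra.
  - by have := F6 _ _ aS bS ha h; lra.
have u0 : 0 <= u.
  by have := hu (0, 1); rewrite mem_cat !inE eqxx add0r mul1r => /(_ isT).
have u1 : u <= 1.
  by have := hu (1, -1); rewrite mem_cat !inE eqxx orbT mulN1r subr_ge0 => /(_ isT).
have w1 : u * p.1.1 <= v.1.1.
  by have := hu (v.1.1, - p.1.1); rewrite mem_cat !inE eqxx !orbT /= mulNr subr_ge0 mulrC; apply.
have w2 : u * p.1.2 <= v.1.2.
  by have := hu (v.1.2, - p.1.2); rewrite mem_cat !inE eqxx !orbT /= mulNr subr_ge0 mulrC; apply.
have w3 : u * p.2 <= v.2.
  by have := hu (v.2, - p.2); rewrite mem_cat !inE eqxx !orbT /= mulNr subr_ge0 mulrC; apply.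
have wa a : a \in s -> 1 - u <= ev a v - u * ev a p.
  move=> aS; have := hu (ev a v - 1, 1 - ev a p).
  rewrite mem_cat; have -> : (ev a v - 1, 1 - ev a p) \in [seq (ev a v - 1, 1 - ev a p) | a <- s].
    by apply/mapP; exists a.
  by rewrite orbT => /(_ isT) /=; lra.
have evq a r : 0 < r -> ev a ((v.1.1 - (1 - r) * p.1.1) / r, (v.1.2 - (1 - r) * p.1.2) / r,
    (v.2 - (1 - r) * p.2) / r) = (ev a v - (1 - r) * ev a p) / r.
  by move=> r0; rewrite /ev /=; field; rewrite gt_eqF.
have mixq r : 0 < r -> v = mix r p ((v.1.1 - (1 - r) * p.1.1) / r,
   (v.1.2 - (1 - r) * p.1.2) / r, (v.2 - (1 - r) * p.2) / r).
  move=> r0; case: v {hv v1 v2 v3 c cpos cneg F1 F2 F3 F4 F5 F6 hu w1 w2 w3 wa evq} => [[x y] z].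
  by rewrite /mix /=; congr (_, _, _); field; rewrite gt_eqF.
have [ult1|uge1] := ltP u 1.
  have r0 : 0 < 1 - u by rewrite subr_gt0.
  exists (1 - u), ((v.1.1 - (1 - (1 - u)) * p.1.1) / (1 - u),
     (v.1.2 - (1 - (1 - u)) * p.1.2) / (1 - u), (v.2 - (1 - (1 - u)) * p.2) / (1 - u)).
  split; [by rewrite (ltW r0) gerBl| |exact: mixq].
  split; first by split; rewrite /= subKr divr_ge0 ?subr_ge0 ?(ltW ult1).
  by move=> a /wa h; rewrite evq // subKr ler_pdivlMr // mul1r.
have ue : u = 1 by apply/eqP; rewrite eq_le u1 uge1.
move: w1 w2 w3 wa; rewrite {}ue !mul1r => w1 w2 w3 wa {u0 u1 uge1 hu}.
have [E|vp] := eqVneq v p.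
  have [q qs] := hpoly_nonempty ps; exists 0, q; split => //.
    by rewrite lexx ler01.
  by rewrite E /mix subr0 !mul1r !mul0r !addr0; case: (p) => [[x y] z].
have gap a : pos3 a -> ev a p < ev a v.
  move=> [a1 a2 a3]; rewrite lt_neqAle le_ev // andbT; apply: contraNneq vp => E.
  have d1 : 0 <= a.1.1 * (v.1.1 - p.1.1) by rewrite mulr_ge0 ?subr_ge0 // ltW.
  have d2 : 0 <= a.1.2 * (v.1.2 - p.1.2) by rewrite mulr_ge0 ?subr_ge0 // ltW.
  have d3 : 0 <= a.2 * (v.2 - p.2) by rewrite mulr_ge0 ?subr_ge0 // ltW.
  have : a.1.1 * (v.1.1 - p.1.1) + a.1.2 * (v.1.2 - p.1.2) + a.2 * (v.2 - p.2) == 0.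
    by apply/eqP; transitivity (ev a v - ev a p); [rewrite /ev; ring|rewrite E subrr].
  rewrite !paddr_eq0 ?addr_ge0 // !mulf_eq0 (gt_eqF a1) (gt_eqF a2) (gt_eqF a3).
  rewrite /= !subr_eq0 => /andP[/andP[/eqP e1 /eqP e2] /eqP e3].
  by apply/eqP; exact: eq3.
have [r [r0 r1 hr]] : exists r, [/\ 0 < r, r <= 1 & forall a, a \in s -> r <= ev a v - ev a p].
  elim: s ps {hv c cpos cneg F1 F2 F3 F4 F5 F6 wa} => [|a s IH] ps; first by exists 1.
  have [|r [r0 r1 hr]] := IH; first by move=> b bs; apply: ps; rewrite inE bs orbT.
  have := gap _ (ps a (mem_head _ _)); rewrite -subr_gt0 => ga.
  exists (Num.min r (ev a v - ev a p)); split; first by rewrite lt_min r0.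
    by rewrite ge_min r1.
  by move=> b; rewrite inE ge_min => /orP[/eqP ->|/hr ->]; rewrite ?lexx ?orbT.
exists r, ((v.1.1 - (1 - r) * p.1.1) / r, (v.1.2 - (1 - r) * p.1.2) / r,
    (v.2 - (1 - r) * p.2) / r).
split; [by rewrite r1 ltW| |exact: mixq].
have q_ge0 y z : 0 <= y -> y <= z -> 0 <= (z - (1 - r) * y) / r.
  move=> y0 yz; rewrite divr_ge0 ?(ltW r0) // subr_ge0 (le_trans _ yz) //.
  by rewrite ler_piMl // gerBl ltW.
split; first by split; exact: q_ge0.
move=> a aS; rewrite evq // ler_pdivlMr // mul1r.
have := hr _ aS; have := ev_ge0 (ps _ aS) (And3 p1 p2 p3); nra.
Qed.
End polyhedra.

(** * Newton polyhedra in coordinates *)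

Section newton_data.
Context {R : realType}.
Implicit Types (p q v : R * R * R) (s : seq (R * R * R)) (G : set (R * R * R)).

Definition le3 p q := [/\ p.1.1 <= q.1.1, p.1.2 <= q.1.2 & p.2 <= q.2].

Lemma hpoly_mix s r p q : 0 <= r <= 1 -> hpoly s p -> hpoly s q -> hpoly s (mix r p q).
Proof.
move=> /andP[r0 r1] [[p1 p2 p3] hp] [[q1 q2 q3] hq].
have r1' : 0 <= 1 - r by rewrite subr_ge0.
split; first by split; rewrite addr_ge0 // mulr_ge0.
move=> a aS; rewrite ev_mix; have := hp a aS; have := hq a aS; nra.
Qed.

Lemma hpoly_up s p q : pos_forms s -> hpoly s p -> le3 p q -> hpoly s q.
Proof.
move=> ps [[p1 p2 p3] hp] [h1 h2 h3]; split.
  by split; [exact: le_trans h1|exact: le_trans h2|exact: le_trans h3].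
by move=> a aS; apply: le_trans (hp a aS) _; apply: le_ev => //; exact: ps.
Qed.

Lemma notin_hpoly s p : nonneg3 p -> ~ hpoly s p -> exists2 a, a \in s & ev a p < 1.
Proof.
move=> p0 np; have [/hasP[a aS h]|/hasPn h] := boolP (has (fun a => ev a p < 1) s).
  by exists a.
by case: np; split => // a /h; rewrite -leNgt.
Qed.

Lemma pjoin_sub G p : G `<=` pjoin G p.
Proof.
move=> q Gq; exists 1, q; split => //; first by rewrite ler01 lexx.
by apply: eq3; rewrite /= subrr mul0r mul1r add0r.
Qed.

Lemma pjoin_apex G p : G !=set0 -> pjoin G p p.
Proof.
move=> [q Gq]; exists 0, q; split => //; first by rewrite ler01 lexx.
by apply: eq3; rewrite /= subr0 mul0r mul1r addr0.
Qed.

Lemma pjoin_mono G G' p : G `<=` G' -> pjoin G p `<=` pjoin G' p.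
Proof. by move=> GG v [r [q [r01 /GG Gq ->]]]; exists r, q. Qed.

Lemma pjoin_segment G p v r : pjoin G p v -> 0 <= r <= 1 -> pjoin G p (mix r p v).
Proof.
move=> [r' [q [/andP[r0 r1] Gq ->]]] /andP[h0 h1]; exists (r * r'), q; split=> //.
  by rewrite mulr_ge0 // mulr_ile1.
by apply: eq3; rewrite /=; ring.
Qed.

(** A coordinate plane that avoids [p] meets the join only in [G]: a segment
    from [p] reaches it at most at its end. *)
Lemma pjoin_coord0 G p v (f : R * R * R -> R) :
  (forall r p q, f (mix r p q) = (1 - r) * f p + r * f q) ->
  (forall q, G q -> 0 <= f q) -> 0 < f p -> pjoin G p v -> f v = 0 -> G v.
Proof.
move=> fmix fG fp [r [q [/andP[r0 r1] Gq ->]]]; rewrite fmix => E.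
have r_1 : r = 1 by have := fG q Gq; nra.
rewrite r_1 (_ : mix 1 p q = q) //.
by apply: eq3; rewrite /= subrr mul0r mul1r add0r.
Qed.

Definition emb (a : nat * nat * nat) : R * R * R := (a.1.1%:R, a.1.2%:R, a.2%:R).

Lemma emb_ge0 a : nonneg3 (emb a).
Proof. by split; rewrite ler0n. Qed.

(** The combinatorial data of a convenient Newton polyhedron [G]: finitely many
    lattice generators, seen only through the half-spaces that contain them, and
    a description by finitely many inequalities with positive coefficients. *)
Record newton_data G (A : seq (nat * nat * nat)) : Prop := NewtonData {
  newton_gen : forall a, a \in A -> G (emb a);
  newton_half : forall (al : R * R * R) (c : R), nonneg3 al ->
    (forall a, a \in A -> c <= ev al (emb a)) -> forall v, G v -> c <= ev al v;
  newton_axes : exists M, [/\ (0 < M)%N, (M, 0%N, 0%N) \in A,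
    (0%N, M, 0%N) \in A & (0%N, 0%N, M) \in A];
  newton_hpoly : exists2 s, pos_forms s & G = hpoly s }.

Section facts.
Variables (G : set (R * R * R)) (A : seq (nat * nat * nat)).
Hypothesis nd : newton_data G A.

Lemma newton_ge0 v : G v -> nonneg3 v.
Proof. by have [s _ ->] := newton_hpoly nd; case. Qed.

Lemma newton_mix r p q : 0 <= r <= 1 -> G p -> G q -> G (mix r p q).
Proof. by have [s _ ->] := newton_hpoly nd; exact: hpoly_mix. Qed.

Lemma newton_up p q : G p -> le3 p q -> G q.
Proof. by have [s ps ->] := newton_hpoly nd; exact: hpoly_up. Qed.

Lemma newton_neq0 : G !=set0.
Proof. by have [M [_ _ _ /(newton_gen nd) ?]] := newton_axes nd; eexists; eauto. Qed.

(** [G] being closed, there is some room upwards from every point outside. *)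
Lemma room_above v : nonneg3 v -> ~ G v -> exists2 e, 0 < e &
  forall w, w.1.1 <= v.1.1 + e -> w.1.2 <= v.1.2 + e -> w.2 <= v.2 + e -> ~ G w.
Proof.
move=> v0 nG; have [s ps Es] := newton_hpoly nd.
have [a a_s av] : exists2 a, a \in s & ev a v < 1.
  by apply: notin_hpoly => //; rewrite -Es.
have [a1 a2 a3] := ps _ a_s.
have S0 : 0 < a.1.1 + a.1.2 + a.2 by rewrite !addr_gt0.
pose e := (1 - ev a v) / (2 * (a.1.1 + a.1.2 + a.2)).
have e0 : 0 < e by rewrite divr_gt0 ?mulr_gt0 // subr_gt0.
have eE : (a.1.1 + a.1.2 + a.2) * e = (1 - ev a v) / 2.
  by rewrite /e; field; rewrite gt_eqF.
exists e => // w h1 h2 h3; rewrite Es => -[_ /(_ a a_s)]; apply/negP; rewrite -ltNge.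
apply: (@le_lt_trans _ _ (ev a (v.1.1 + e, v.1.2 + e, v.2 + e))); first exact: le_ev.
have -> : ev a (v.1.1 + e, v.1.2 + e, v.2 + e) = ev a v + (a.1.1 + a.1.2 + a.2) * e.
  by rewrite /ev /=; ring.
by rewrite eE -ltrBrDl ltr_pdivrMr // ltr_pMr ?subr_gt0 // ltr1n.
Qed.

Lemma pjoin_hpoly p : nonneg3 p -> exists2 s, pos_forms s & pjoin G p = hpoly s.
Proof.
move=> p0; have [s ps ->] := newton_hpoly nd.
by exists (pjoin_forms s p); [exact: pos_pjoin_forms|exact: pjoin_polyE].
Qed.

Lemma pjoin_up p v w : nonneg3 p -> pjoin G p v -> le3 v w -> pjoin G p w.
Proof. by move=> /pjoin_hpoly[s ps ->]; exact: hpoly_up. Qed.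

Lemma pjoin_mix p r v w : nonneg3 p -> 0 <= r <= 1 ->
  pjoin G p v -> pjoin G p w -> pjoin G p (mix r v w).
Proof. by move=> /pjoin_hpoly[s ps ->]; exact: hpoly_mix. Qed.

Lemma pjoin_ge0 p v : nonneg3 p -> pjoin G p v -> nonneg3 v.
Proof. by move=> /pjoin_hpoly[s ps ->] []. Qed.

Lemma newton_pjoin_half al c p : nonneg3 al -> (forall v, G v -> c <= ev al v) ->
  c <= ev al p -> forall v, pjoin G p v -> c <= ev al v.
Proof.
move=> al0 hG hp v [r [q [/andP[r0 r1] /hG Gq ->]]]; rewrite ev_mix; nra.
Qed.

Lemma newton_data_pjoin (P : nat * nat * nat) : newton_data (pjoin G (emb P)) (P :: A).
Proof.
split.
- move=> a; rewrite inE => /orP[/eqP ->|/(newton_gen nd) h].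
    by apply: pjoin_apex; exact: newton_neq0.
  exact: pjoin_sub.
- move=> al c al0 h; apply: newton_pjoin_half => //.
    by apply: (newton_half nd) => // a aA; apply: h; rewrite inE aA orbT.
  by apply: h; rewrite mem_head.
- have [M [M0 h1 h2 h3]] := newton_axes nd; exists M.
  by rewrite !inE h1 h2 h3 !orbT.
- by apply: pjoin_hpoly; exact: emb_ge0.
Qed.

(** The segment from [p] to a point of the join prolongs to a point of [G], and
    by convexity it cannot leave [G] once it has entered it. *)
Lemma pjoin_beyond p v r : ~ G p -> 0 <= r <= 1 -> pjoin G p v ->
  G (mix r p v) -> G v.
Proof.
move=> Gp /andP[r0 r1] [r' [q [/andP[r'0 r'1] Gq ->]]].
have -> : mix r p (mix r' p q) = mix (r * r') p q by apply: eq3; rewrite /=; ring.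
move=> Gm.
have [E|rr1] := eqVneq (r * r') 1.
  have E' : r' = 1 by nra.
  by move: Gm; rewrite E' (_ : r = 1) ?mulr1 //; nra.
have rr : r * r' < 1 by rewrite lt_neqAle rr1 mulr_ile1.
pose w := (r' - r * r') / (1 - r * r').
have d0 : 1 - r * r' != 0 by lra.
have -> : mix r' p q = mix w (mix (r * r') p q) q.
  by apply: eq3; rewrite /= /w; field.
apply: newton_mix => //; apply/andP; split.
  by rewrite divr_ge0 ?subr_ge0 // ?ler_piMl // ltW.
by rewrite ler_pdivrMr ?subr_gt0 // mul1r lerD2r.
Qed.

End facts.

(** Exchanges of coordinates reduce the three coordinate planes, and the three
    axes, to one of each. *)
Definition sw12 {T : Type} (p : T * T * T) : T * T * T := (p.1.2, p.1.1, p.2).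
Definition sw23 {T : Type} (p : T * T * T) : T * T * T := (p.1.1, p.2, p.1.2).

Lemma sw12K {T : Type} : involutive (@sw12 T). Proof. by move=> [[x y] z]. Qed.
Lemma sw23K {T : Type} : involutive (@sw23 T). Proof. by move=> [[x y] z]. Qed.

Lemma newton_data_swap (sw : forall T : Type, T * T * T -> T * T * T) G A :
  (forall T, involutive (sw T)) ->
  (forall a, emb (sw _ a) = sw _ (emb a)) ->
  (forall a p, ev (sw _ a) (sw _ p) = ev a p) ->
  (forall p : R * R * R, nonneg3 p -> nonneg3 (sw _ p)) ->
  (forall p : R * R * R, pos3 p -> pos3 (sw _ p)) ->
  (forall M, [set (M, 0%N, 0%N); (0%N, M, 0%N); (0%N, 0%N, M)] `<=`
     [set sw _ a | a in [set (M, 0%N, 0%N); (0%N, M, 0%N); (0%N, 0%N, M)]]) ->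
  newton_data G A -> newton_data (sw _ @^-1` G) (map (sw _) A).
Proof.
move=> swK swe swev sw0 swp swax nd; split.
- by move=> a /mapP[b bA ->] /=; rewrite swe swK; exact: (newton_gen nd).
- move=> al c al0 h v Gv; rewrite -swev; apply: (newton_half nd) => //.
    exact: sw0.
  by move=> a aA; rewrite -swev swK -swe; apply: h; exact: map_f.
- have [M [M0 h1 h2 h3]] := newton_axes nd; exists M.
  have H b : [set (M, 0%N, 0%N); (0%N, M, 0%N); (0%N, 0%N, M)] b -> b \in map (sw _) A.
    by move=> /swax [a ha <-]; apply: map_f; case: ha => [[->|->]|->].
  by split => //; apply: H; [left; left|left; right|right].
- have [s ps ->] := newton_hpoly nd; exists (map (sw _) s).
    by move=> a /mapP[b /ps bs ->]; exact: swp.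
  apply/seteqP; split => v [v0 hv]; split.
  + by rewrite -(swK _ v); exact: sw0.
  + by move=> a /mapP[b bs ->]; rewrite -swev swK; exact: hv.
  + exact: sw0.
  + by move=> a aS; rewrite -swev swK; apply: hv; exact: map_f.
Qed.

Lemma newton_data_sw12 G A : newton_data G A ->
  newton_data (sw12 @^-1` G) (map sw12 A).
Proof.
apply: newton_data_swap => //.
- exact: @sw12K.
- by move=> a p; rewrite /ev /=; ring.
- by move=> p [].
- by move=> p [].
- by move=> M b [[->|->]|->];
    [exists (0%N, M, 0%N)|exists (M, 0%N, 0%N)|exists (0%N, 0%N, M)] => //=;
    [left; right|left; left|right].
Qed.

Lemma newton_data_sw23 G A : newton_data G A ->
  newton_data (sw23 @^-1` G) (map sw23 A).
Proof.
apply: newton_data_swap => //.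
- exact: @sw23K.
- by move=> a p; rewrite /ev /=; ring.
- by move=> p [].
- by move=> p [].
- by move=> M b [[->|->]|->];
    [exists (M, 0%N, 0%N)|exists (0%N, 0%N, M)|exists (0%N, M, 0%N)] => //=;
    [left; left|right|left; right].
Qed.

Lemma pjoin_sw12 G p : pjoin (sw12 @^-1` G) (sw12 p) = sw12 @^-1` (pjoin G p).
Proof.
apply/seteqP; split=> v [r [q [r01 Gq E]]]; exists r, (sw12 q); split => //.
- by rewrite E.
- by rewrite /= sw12K.
- by rewrite -(sw12K v) E.
Qed.

Lemma pjoin_sw23 G p : pjoin (sw23 @^-1` G) (sw23 p) = sw23 @^-1` (pjoin G p).
Proof.
apply/seteqP; split=> v [r [q [r01 Gq E]]]; exists r, (sw23 q); split => //.
- by rewrite E.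
- by rewrite /= sw23K.
- by rewrite -(sw23K v) E.
Qed.

End newton_data.

(** * The extreme edge next to a vertical plane *)

Section edges.
Context {R : realType}.
Implicit Types (p q v : R * R * R) (G : set (R * R * R)).

(** Gift wrapping, in coordinates centred at some point: in the plane [Y = 0],
    [a] minimises the slope [Z / X]; then the supporting plane through the line
    of [a] is tilted until it reaches [b]. Ties are resolved by taking [a] as
    near as possible to the centre, then [b] with the smallest slope [(X - X a)
    / Y], and the largest [Y] among these. *)
Lemma extreme_edge (T : eqType) (s : seq T) (X Y Z : T -> R) :
  (exists2 c, c \in s & Y c = 0 /\ 0 < X c) ->
  (exists2 c, c \in s & 0 < Y c) ->
  (forall c, c \in s -> 0 <= Y c) ->
  (forall c, c \in s -> Y c = 0 -> X c = 0 -> 0 < Z c) ->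
  (forall c d, c \in s -> d \in s -> Y c = 0 -> Y d = 0 -> X c < 0 -> 0 < X d ->
     0 < Z c * X d - X c * Z d) ->
  exists a b si ka,
  [/\ a \in s, b \in s, Y a = 0, 0 < X a & 0 < Y b] /\
  [/\ Z a = si * X a, Z b - si * X b + ka * Y b = 0,
      forall c, c \in s -> 0 <= Z c - si * X c + ka * Y c,
      forall c, c \in s -> Y c = 0 -> X c <= 0 -> 0 < Z c - si * X c &
      forall c, c \in s -> Z c - si * X c + ka * Y c = 0 ->
        0 <= (X c - X a) * Y b - (X b - X a) * Y c /\
        ((X c - X a) * Y b - (X b - X a) * Y c = 0 -> Y c <= Y b)].
Proof.
move=> h1 h3 h2 h4 h5.
have [|a1 [a1s /andP[/eqP a1Y a1X]] a1min] :=
    @exists_argmin _ _ (fun c => Z c / X c) s (fun c => (Y c == 0) && (0 < X c)).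
  by have [c cs [c1 c2]] := h1; exists c => //; rewrite c1 eqxx c2.
pose si := Z a1 / X a1.
have [|a [ass /and3P[/eqP aY aX /eqP aZ]] amin] :=
    @exists_argmin _ _ X s (fun c => [&& Y c == 0, 0 < X c & Z c == si * X c]).
  by exists a1 => //; rewrite a1Y eqxx a1X /= /si divfK ?eqxx // gt_eqF.
have Lpos c : c \in s -> Y c = 0 -> 0 < X c -> 0 <= Z c - si * X c.
  by move=> cs cY cX; rewrite subr_ge0 -ler_pdivlMr // a1min // cY eqxx cX.
have Lneg c : c \in s -> Y c = 0 -> X c <= 0 -> 0 < Z c - si * X c.
  move=> cs cY; rewrite le_eqVlt => /orP[/eqP cX|cX].
    by rewrite cX mulr0 subr0; exact: h4.
  by have := h5 _ _ cs ass cY aY cX aX; rewrite aZ; nra.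
have [b1 [b1s b1Y] b1min] := @exists_argmin _ _ (fun c => (Z c - si * X c) / Y c) s
  (fun c => 0 < Y c) h3.
pose ka := - ((Z b1 - si * X b1) / Y b1).
have thpos c : c \in s -> 0 <= Z c - si * X c + ka * Y c.
  move=> cs; have := h2 c cs; rewrite le_eqVlt => /orP[/eqP cY|cY].
    rewrite -cY mulr0 addr0; have [cX|cX] := leP (X c) 0; first exact/ltW/Lneg.
    exact: Lpos.
  by have := b1min c cs cY; rewrite ler_pdivlMr // -/ka; rewrite /ka; lra.
have [|b2 [b2s /andP[b2Y /eqP b2t]] b2min] := @exists_argmin _ _
    (fun c => (X c - X a) / Y c) s (fun c => (0 < Y c) && (Z c - si * X c + ka * Y c == 0)).
  by exists b1 => //; rewrite b1Y /= /ka mulNr divfK ?subrr ?eqxx // gt_eqF.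
pose m := (X b2 - X a) / Y b2.
have [|b [bs /and3P[bY /eqP bt /eqP bm]] bmin] := @exists_argmin _ _
    (fun c => - Y c) s (fun c => [&& 0 < Y c, Z c - si * X c + ka * Y c == 0 &
      X c - X a == m * Y c]).
  by exists b2 => //; rewrite b2Y b2t eqxx /= /m divfK ?eqxx // gt_eqF.
exists a, b, si, ka; split; first by [].
split=> // c cs ct; rewrite bm.
have -> : (X c - X a) * Y b - m * Y b * Y c = Y b * (X c - X a - m * Y c) by ring.
have := h2 c cs; rewrite le_eqVlt => /orP[/eqP cY|cY].
  rewrite -cY mulr0 subr0; split; last by move=> _; exact: ltW.
  rewrite mulr_ge0 ?(ltW bY) // subr_ge0; apply: amin => //.
  move: ct; rewrite -cY mulr0 addr0 eqxx /= => ct.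
  have cX : 0 < X c by rewrite ltNge; apply/negP => /(Lneg _ cs (esym cY)); rewrite ct ltxx.
  by rewrite cX /= -subr_eq0 ct.
have cm : m * Y c <= X c - X a by rewrite -ler_pdivlMr // b2min // cY ct eqxx.
split; first by rewrite mulr_ge0 ?(ltW bY) // subr_ge0.
move=> /eqP; rewrite mulf_eq0 gt_eqF //= subr_eq0 => /eqP cE.
by have := bmin c cs; rewrite cY ct eqxx cE eqxx lerN2; apply.
Qed.

(** Bounds the amount by which a supporting form may be tilted about the points
    where it vanishes. *)
Lemma small_perturbation (T : eqType) (s : seq T) (th ps : T -> R) :
  (forall c, c \in s -> 0 <= th c) ->
  (forall c, c \in s -> th c = 0 -> 0 <= ps c) ->
  exists2 eps0, 0 < eps0 & forall eps, 0 < eps <= eps0 ->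
    forall c, c \in s -> 0 <= th c + eps * ps c.
Proof.
elim: s => [|c s IH] h1 h2; first by exists 1; rewrite ?ltr01.
have [||e0 e0pos IH'] := IH.
- by move=> d ds; apply: h1; rewrite inE ds orbT.
- by move=> d ds; apply: h2; rewrite inE ds orbT.
have c1 := h1 c (mem_head _ _); have c2 := h2 c (mem_head _ _).
have [e1 e1pos he1] : exists2 e1, 0 < e1 & forall eps, 0 < eps <= e1 -> 0 <= th c + eps * ps c.
  have [pc|pc] := leP 0 (ps c).
    by exists 1; rewrite ?ltr01 // => eps /andP[e2 _]; rewrite addr_ge0 // mulr_ge0 // ltW.
  have tc : 0 < th c.
    by rewrite lt_neqAle c1 andbT eq_sym; apply/eqP => /c2; lra.
  exists (th c / - ps c); first by rewrite divr_gt0 // oppr_gt0.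
  by move=> eps /andP[_]; rewrite ler_pdivlMr ?oppr_gt0 //; lra.
exists (Num.min e0 e1); first by rewrite lt_min e0pos.
move=> eps /andP[eps0]; rewrite le_min => /andP[k0 k1] d.
rewrite inE => /orP[/eqP ->|]; first by apply: he1; rewrite eps0.
by apply: IH'; rewrite eps0.
Qed.

Definition bary p q v (la mu : R) : R * R * R :=
  (p.1.1 + la * (q.1.1 - p.1.1) + mu * (v.1.1 - p.1.1),
   p.1.2 + la * (q.1.2 - p.1.2) + mu * (v.1.2 - p.1.2),
   p.2 + la * (q.2 - p.2) + mu * (v.2 - p.2)).

Lemma ev_bary (a p q v : R * R * R) la mu : ev a (bary p q v la mu) =
  ev a p + la * (ev a q - ev a p) + mu * (ev a v - ev a p).
Proof. by rewrite /ev /bary /=; ring. Qed.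

Section side.
Variables (G : set (R * R * R)) (A : seq (nat * nat * nat)).
Hypothesis nd : newton_data G A.

Lemma pjoin_bary p q v la mu : nonneg3 p -> pjoin G p q -> pjoin G p v ->
  0 <= la -> 0 <= mu -> la + mu <= 1 -> pjoin G p (bary p q v la mu).
Proof.
move=> p0 jq jv la0 mu0 lm.
have [E|E] := eqVneq (la + mu) 0.
  have -> : bary p q v la mu = p.
    have -> : la = 0 by lra.
    have -> : mu = 0 by lra.
    by apply: eq3; rewrite /=; ring.
  by apply: pjoin_apex; exact: newton_neq0 nd.
have lm0 : 0 < la + mu by rewrite lt_neqAle eq_sym E addr_ge0.
have -> : bary p q v la mu = mix (la + mu) p (mix (mu / (la + mu)) q v).
  by apply: eq3; rewrite /=; field.
apply: pjoin_segment; last by rewrite ltW.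
apply: (pjoin_mix nd) => //; rewrite divr_ge0 ?(ltW lm0) //=.
by rewrite ler_pdivrMr // mul1r lerDr.
Qed.

Variables (e : R) (k : nat) (z0 : R).
Hypotheses (eP : e = 1 \/ (e = -1 /\ (0 < k)%N)) (z0P : 0 < z0).
Let P : R * R * R := (k%:R, 0, z0).
Hypothesis PG : ~ G P.
Let X (c : nat * nat * nat) : R := e * (c.1.1%:R - k%:R).
Let Y (c : nat * nat * nat) : R := c.1.2%:R.
Let Z (c : nat * nat * nat) : R := c.2%:R - z0.

(** The extreme ray [a] of the directions from [P] to [G] in the plane of the
    first and third coordinates, on the side [e] of [P], and the neighbour [b]
    of that ray on the boundary of the set of all directions. The form [al]
    supports the face through [P], [a] and [b]; that [psi] is non-negative means
    that the line from [a] to [b] separates the generators on this face from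
    [P]. *)
Lemma extreme_side : exists a b al,
  [/\ a \in A, b \in A, a.1.2 = 0%N, 0 < e * (a.1.1%:R - k%:R) & (0 < b.1.2)%N] /\
  [/\ pos3 al, ev al (emb a) = ev al P, ev al (emb b) = ev al P,
      forall v, G v -> ev al P <= ev al v &
      forall c, c \in A -> c.1.2 = 0%N -> e * (c.1.1%:R - k%:R) <= 0 ->
        ev al P < ev al (emb c)] /\
  [/\ forall la mu, 0 <= la -> 0 <= mu -> la + mu < 1 -> ~ G (bary P (emb a) (emb b) la mu),
      forall x z, pjoin G P (x, 0, z) -> e * (a.1.1%:R - k%:R) <= e * (x - k%:R) ->
        G (x, 0, z) &
      forall c, c \in A -> ev al (emb c) = ev al P ->
        let psi := e * (c.1.1%:R - a.1.1%:R) * b.1.2%:R -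
                   e * (b.1.1%:R - a.1.1%:R) * c.1.2%:R in
        0 <= psi /\ (psi = 0 -> (c.1.2 <= b.1.2)%N)].
Proof.
have [M [M0 h1 h2 h3]] := newton_axes nd.
have z0_gt0 := z0P.
have P0 : nonneg3 P by split; rewrite /= ?ler0n // ltW.
have GP q : G q -> le3 q P -> False by move=> Gq qP; apply: PG; exact: newton_up nd _ _ Gq qP.
have kM : (k%:R : R) < M%:R.
  rewrite ltNge; apply/negP => kM; apply: (GP (emb (M, 0%N, 0%N))).
    exact: (newton_gen nd).
  by split => //=; exact: ltW.
have M0' : 0 < M%:R :> R by rewrite ltr0n.
have [|||||a [b [si [ka [[aA bA aY aX bY] [aZ bt th0 Lneg psi]]]]]] :=
    @extreme_edge _ A X Y Z.
- case: eP => [e1|[e1 k0]].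
    by exists (M, 0%N, 0%N) => //; rewrite /X /Y e1 /= mul1r subr_gt0.
  by exists (0%N, 0%N, M) => //; rewrite /X /Y e1 /= sub0r mulrNN mul1r ltr0n.
- by exists (0%N, M, 0%N) => //; rewrite /Y /= ltr0n.
- by move=> c _; rewrite /Y ler0n.
- move=> c /(newton_gen nd) Gc cY cX; rewrite /Z subr_gt0 ltNge; apply/negP => cz.
  apply: (GP _ Gc); split => //=; last by rewrite -[c.1.2%:R]/(Y c) cY.
  by move: cX; rewrite /X; case: eP => [->|[-> _]]; lra.
- move=> c d /(newton_gen nd) Gc /(newton_gen nd) Gd cY dY cX dX.
  rewrite ltNge; apply/negP => h.
  have D0 : 0 < X d - X c by lra.
  pose r := - X c / (X d - X c).
  have rE : r * (X d - X c) = - X c by rewrite divfK ?gt_eqF.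
  apply: (GP (mix r (emb c) (emb d))).
    apply: (newton_mix nd) => //; apply/andP; split; first by rewrite divr_ge0 ?ltW // oppr_gt0.
    by rewrite ler_pdivrMr // mul1r; lra.
  have x0 : (1 - r) * X c + r * X d = 0 by lra.
  split => /=.
  + have : (1 - r) * (c.1.1%:R - k%:R) + r * (d.1.1%:R - k%:R) = 0 :> R.
      move: x0; rewrite /X => x0.
      have : e * ((1 - r) * (c.1.1%:R - k%:R) + r * (d.1.1%:R - k%:R)) = 0 by rewrite -x0; ring.
      by case: eP => [->|[-> _]]; lra.
    by move=> h0; lra.
  + by rewrite -[c.1.2%:R]/(Y c) -[d.1.2%:R]/(Y d) cY dY !mulr0 addr0.
  + have : ((1 - r) * Z c + r * Z d) * (X d - X c) <= 0.
      have -> : ((1 - r) * Z c + r * Z d) * (X d - X c) =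
        (X d - X c - r * (X d - X c)) * Z c + r * (X d - X c) * Z d by ring.
      by rewrite rE; lra.
    by rewrite pmulr_lle0 // /Z => h0; lra.
(* the slope of the extreme ray descends away from P *)
have es : e * si < 0.
  case: eP => [e1|[e1 k0]].
    have := th0 _ h1; rewrite /X /Y /Z e1 /= !mul1r mulr0 addr0 sub0r => h.
    have : 0 < - si * (M%:R - k%:R) by rewrite mulNr oppr_gt0 (le_lt_trans _ (_ : - z0 < 0)) ?oppr_lt0 ?z0P // -subr_ge0.
    by rewrite pmulr_lgt0 ?subr_gt0 // oppr_gt0.
  have Za : 0 < Z a.
    rewrite /Z subr_gt0 ltNge; apply/negP => az.
    apply: (GP _ (newton_gen nd aA)); split => //=.
      by move: aX; rewrite /X e1; lra.
    by rewrite -[a.1.2%:R]/(Y a) aY.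
  by move: Za; rewrite aZ pmulr_lgt0 // e1; lra.
have ka0 : 0 < ka.
  have := th0 _ h2; rewrite /X /Y /Z /= => h.
  have k0 : 0 <= k%:R :> R by rewrite ler0n.
  have : 0 < ka * M%:R by nra.
  by rewrite pmulr_lgt0.
pose al : R * R * R := (- (e * si), ka, 1).
have al0 : pos3 al by split; rewrite /= ?oppr_gt0 ?ltr01.
have alE v : ev al v - ev al P = v.2 - z0 - si * (e * (v.1.1 - k%:R)) + ka * v.1.2.
  by rewrite /ev /P /=; ring.
have thE c : ev al (emb c) - ev al P = Z c - si * X c + ka * Y c by rewrite alE.
have alG v : G v -> ev al P <= ev al v.
  move=> Gv; apply: (newton_half nd) => //; first by case: al0 => *; split; exact: ltW.
  by move=> c cA; rewrite -subr_ge0 thE th0.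
have eva : ev al (emb a) = ev al P.
  by apply/eqP; rewrite -subr_eq0 thE aY aZ mulr0 addr0 subrr.
have evb : ev al (emb b) = ev al P by apply/eqP; rewrite -subr_eq0 thE bt.
exists a, b, al; split.
  split => //; last by rewrite -(ltr0n R).
  by apply/eqP; rewrite -(eqr_nat R); apply/eqP.
split.
  split => // c cA cY cX; rewrite -subr_gt0 thE.
  have cY' : Y c = 0 by rewrite /Y cY.
  by rewrite cY' mulr0 addr0 Lneg.
split.
(* tilted around the line from a to b, the form is still minimal on G at a,
   and is smaller on the side of P *)
- move=> la mu la0 mu0 lm Gv.
  pose ps (c : nat * nat * nat) := (X c - X a) * Y b - (X b - X a) * Y c.
  have [||e0 e0pos he0] := @small_perturbation _ A (fun c => ev al (emb c) - ev al P) ps.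
  + by move=> c cA; rewrite thE th0.
  + by move=> c cA; rewrite thE => ct; have [] := psi c cA ct.
  have [e1 e1pos [he1 he2]] : exists2 e1, 0 < e1 &
      e1 <= e0 /\ (0 <= - (e * si) + e1 * (e * Y b) /\ 0 <= ka - e1 * (X b - X a)).
    have es' : 0 < - (e * si) by rewrite oppr_gt0.
    have [||e2 e2pos he2] := @small_perturbation _ [:: true; false]
      (fun t => if t then - (e * si) else ka) (fun t => if t then e * Y b else - (X b - X a)).
    * by move=> [] _; exact: ltW.
    * by move=> [] _ E; move: es' ka0; rewrite E ltxx.
    exists (Num.min e0 e2); first by rewrite lt_min e0pos.
    have he3 := he2 (Num.min e0 e2); rewrite lt_min e0pos e2pos ge_min lexx orbT in he3.
    split; first by rewrite ge_min lexx.
    have := he3 isT true (mem_head _ _); have := he3 isT false; rewrite !inE => /(_ isT) /=.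
    by rewrite mulrN.
  pose be : R * R * R := (- (e * si) + e1 * (e * Y b), ka - e1 * (X b - X a), 1).
  have beE v : ev be v = ev al v + e1 * ((e * v.1.1) * Y b - (X b - X a) * v.1.2).
    by rewrite /ev /be /al /=; ring.
  have beG : ev be (emb a) <= ev be (bary P (emb a) (emb b) la mu).
    apply: (newton_half nd) => //.
      by split => //=; rewrite ?ler01 //; lra.
    move=> c cA; have := he0 e1; rewrite e1pos he1 => /(_ isT c cA).
    rewrite !beE eva /ps /X /Y /= (_ : (a.1.2)%:R = 0); last exact: aY.
    by lra.
  move: beG; rewrite !ev_bary !beE evb eva /=.
  have := aY; rewrite /Y => ->.
  have -> : ev al P + e1 * (e * k%:R * b.1.2%:R - (X b - X a) * 0) +
    la * (ev al P + e1 * (e * a.1.1%:R * b.1.2%:R - (X b - X a) * 0) -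
          (ev al P + e1 * (e * k%:R * b.1.2%:R - (X b - X a) * 0))) +
    mu * (ev al P + e1 * (e * b.1.1%:R * b.1.2%:R - (X b - X a) * b.1.2%:R) -
         (ev al P + e1 * (e * k%:R * b.1.2%:R - (X b - X a) * 0))) =
    ev al P + e1 * (e * a.1.1%:R * b.1.2%:R - (X b - X a) * 0)
      - e1 * b.1.2%:R * X a * (1 - la - mu) by rewrite /X; ring.
  have lm' : 0 < 1 - la - mu by lra.
  have := mulr_gt0 (mulr_gt0 (mulr_gt0 e1pos bY) aX) lm'; rewrite /Y.
  by lra.
- move=> x z [r [q [/andP[r0 r1] Gq E]]] hX.
  have [xE y0 zE] : [/\ x = (1 - r) * k%:R + r * q.1.1, 0 = (1 - r) * 0 + r * q.1.2 &
     z = (1 - r) * z0 + r * q.2] by case: E.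
  have {}hX : X a <= r * (e * (q.1.1 - k%:R)).
    apply: (le_trans hX); rewrite xE.
    by rewrite le_eqVlt; apply/orP; left; apply/eqP; ring.
  rewrite {}xE {}zE {E}.
  have q0 := newton_ge0 nd Gq.
  have rpos : 0 < r.
    rewrite lt_neqAle r0 andbT eq_sym; apply/eqP => rE.
    by move: hX; rewrite rE mul0r leNgt aX.
  have qy : q.1.2 = 0.
    by move: y0; rewrite mulr0 add0r => /esym/eqP; rewrite mulf_eq0 gt_eqF //= => /eqP.
  set Xq := e * (q.1.1 - k%:R) in hX.
  have Lq : 0 <= q.2 - z0 - si * Xq.
    by have := alG _ Gq; rewrite -subr_ge0 alE qy mulr0 addr0.
  have Xqa : X a <= Xq by nra.
  have [Xqe|Xqne] := eqVneq Xq (X a).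
    have -> : r = 1 by move: hX; rewrite Xqe; nra.
    rewrite subrr !mul0r !add0r !mul1r.
    by rewrite (_ : (_, _, _) = q) //; apply: eq3.
  have D0 : 0 < Xq - X a by rewrite subr_gt0 lt_neqAle Xqa eq_sym Xqne.
  pose ta := (r * Xq - X a) / (Xq - X a).
  have taE : ta * (Xq - X a) = r * Xq - X a by rewrite divfK ?gt_eqF.
  have ta0 : 0 <= ta by rewrite divr_ge0 ?subr_ge0 // ltW.
  have tar : ta <= r by rewrite ler_pdivrMr //; nra.
  apply: (@newton_up _ _ _ nd (mix ta (emb a) q)).
    apply: (newton_mix nd) => //; last exact: (newton_gen nd).
    by rewrite ta0 (le_trans tar).
  split => /=.
  + have : e * ((1 - ta) * a.1.1%:R + ta * q.1.1) = e * ((1 - r) * k%:R + r * q.1.1).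
      have : (1 - ta) * X a + ta * Xq = r * Xq.
        have -> : (1 - ta) * X a + ta * Xq = X a + ta * (Xq - X a) by ring.
        by rewrite taE addrC subrK.
      by rewrite /X /Xq => h; lra.
    have en : e != 0 by case: eP => [->|[-> _]]; rewrite ?oppr_eq0 oner_eq0.
    by move=> /(mulfI en) ->.
  + by rewrite -[a.1.2%:R]/(Y a) aY qy !mulr0 addr0.
  + have : (1 - ta) * Z a + ta * (q.2 - z0) <= r * (q.2 - z0).
      have -> : q.2 - z0 = si * Xq + (q.2 - z0 - si * Xq) by ring.
      rewrite aZ; have : (1 - ta) * (si * X a) + ta * (si * Xq) = si * (r * Xq).
        have -> : r * Xq = X a + ta * (Xq - X a) by rewrite taE addrC subrK.
        by ring.
      by nra.
    by rewrite /Z; lra.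
- move=> c cA ct psi'; have := psi c cA; rewrite -thE ct subrr => /(_ erefl).
  have -> : (X c - X a) * Y b - (X b - X a) * Y c = psi' by rewrite /psi' /X /Y; ring.
  by rewrite /Y ler_nat.
Qed.
End side.
End edges.

(** * Raising the added point *)

Section raising.
Context {R : realType}.
Local Notation mu1 := (@lebesgue_measure R).
Local Notation mu2 := ((@lebesgue_measure R \x @lebesgue_measure R)%E).
Local Notation mu3 := (((@lebesgue_measure R \x @lebesgue_measure R) \x @lebesgue_measure R)%E).
Local Notation R2 := (measurableTypeR R * measurableTypeR R)%type.
Local Notation R3 := (measurableTypeR R * measurableTypeR R * measurableTypeR R)%type.
Implicit Types (s : seq (R * R * R)) (b : R * R) (G : set (R * R * R)).

(** The height at which the vertical line over [b] enters the polyhedron. *)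
Definition floor_fun s b : R :=
  \big[Num.max/0]_(a <- s) ((1 - a.1.1 * b.1 - a.1.2 * b.2) / a.2).

Lemma hpoly_floor s b z : pos_forms s ->
  hpoly s (b.1, b.2, z) <-> [/\ 0 <= b.1, 0 <= b.2 & floor_fun s b <= z].
Proof.
rewrite /floor_fun; elim: s => [|a s IH] ps.
  rewrite big_nil; split; first by case=> -[].
  by move=> [? ? ?]; split.
have [a1 a2 a3] := ps a (mem_head _ _).
have {}IH := IH (fun c cs => ps c (mem_behead (s := a :: s) cs)).
have E : (1 <= ev a (b.1, b.2, z)) = ((1 - a.1.1 * b.1 - a.1.2 * b.2) / a.2 <= z).
  by rewrite ler_pdivrMr // /ev /=; apply/idP/idP; lra.
rewrite big_cons ge_max; split.
  move=> [[h1 h2 h3] h]; have [] := IH.1; first by split => // c cs; apply: h; rewrite inE cs orbT.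
  by move=> _ _ ->; rewrite andbT -E h // mem_head.
move=> [h1 h2 /andP[h3 h4]]; have [[k1 k2 k3] k] := IH.2 (And3 h1 h2 h4).
by split => // c; rewrite inE => /orP[/eqP ->|/k //]; rewrite E.
Qed.

Lemma measurable_floor s : measurable_fun setT (floor_fun s : R2 -> R).
Proof.
rewrite /floor_fun; elim: s => [|a s IH].
  by under eq_fun do rewrite big_nil; exact: measurable_cst.
under eq_fun do rewrite big_cons.
apply: measurable_maxr => //; apply: measurable_funM => //.
apply: measurable_funB; first apply: measurable_funB => //.
  by apply: measurable_funM => //; exact: measurable_fst.
by apply: measurable_funM => //; exact: measurable_snd.
Qed.

Lemma measurable_le_set d (T : measurableType d) (f g : T -> R) :
  measurable_fun setT f -> measurable_fun setT g -> measurable [set x | f x <= g x].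
Proof.
move=> mf mg; have /(_ measurableT [set true]) := measurable_fun_ler mf mg.
by rewrite setTI; apply.
Qed.

Lemma measurable_lt_set d (T : measurableType d) (f g : T -> R) :
  measurable_fun setT f -> measurable_fun setT g -> measurable [set x | f x < g x].
Proof.
move=> mf mg; have /(_ measurableT [set true]) := measurable_fun_ltr mf mg.
by rewrite setTI; apply.
Qed.

Lemma measurable_hpoly s : pos_forms s -> measurable (hpoly s : set R3).
Proof.
move=> ps.
rewrite (_ : hpoly s = [set p : R3 | 0 <= p.1.1] `&` [set p : R3 | 0 <= p.1.2] `&`
    [set p : R3 | floor_fun s p.1 <= p.2]); last first.
  apply/seteqP; split => -[[x y] z] /=.
    by move=> /(hpoly_floor (x, y) z ps)[].
  by move=> [[h1 h2] h3]; apply/(hpoly_floor (x, y) z ps).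
apply: measurableI; first apply: measurableI.
- by apply: measurable_le_set; [exact: measurable_cst|exact: measurable_proj1].
- by apply: measurable_le_set; [exact: measurable_cst|exact: measurable_proj2].
- apply: measurable_le_set; last exact: measurable_snd.
  by apply: (measurableT_comp (measurable_floor s)); exact: measurable_fst.
Qed.

(** The vertical projection of the difference. It controls the speed at which
    the join shrinks when [P] moves upwards. *)
Definition shadow G (P : R * R * R) : set (R * R) :=
  [set b | exists z, pjoin G P (b.1, b.2, z) /\ ~ G (b.1, b.2, z)].

Section steps.
Variables (G : set (R * R * R)) (A : seq (nat * nat * nat)).
Hypothesis nd : newton_data G A.

Lemma measurable_newton : measurable (G : set R3).
Proof. by have [s ps ->] := newton_hpoly nd; exact: measurable_hpoly. Qed.

Lemma measurable_pjoin P : nonneg3 P -> measurable (pjoin G P : set R3).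
Proof. by move=> /(pjoin_hpoly nd)[s ps ->]; exact: measurable_hpoly. Qed.

Lemma measurable_shadow P : nonneg3 P -> measurable (shadow G P : set R2).
Proof.
move=> P0; have [s' ps' E'] := pjoin_hpoly nd P0; have [s ps E] := newton_hpoly nd.
rewrite (_ : shadow G P = [set b : R2 | 0 <= b.1] `&` [set b : R2 | 0 <= b.2] `&`
    [set b : R2 | floor_fun s' b < floor_fun s b]); last first.
  apply/seteqP; split => b /=.
    move=> [z []]; rewrite E' E => /(hpoly_floor _ _ ps')[b1 b2 h] h'; split => //.
    apply: (le_lt_trans h); rewrite ltNge; apply/negP => h2.
    by apply: h'; apply/(hpoly_floor _ _ ps).
  move=> [[b1 b2] h]; exists (floor_fun s' b); rewrite E' E; split.
    exact/(hpoly_floor _ _ ps').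
  by move=> /(hpoly_floor _ _ ps)[_ _]; rewrite leNgt h.
apply: measurableI; first apply: measurableI.
- by apply: measurable_le_set; [exact: measurable_cst|exact: measurable_fst].
- by apply: measurable_le_set; [exact: measurable_cst|exact: measurable_snd].
- by apply: measurable_lt_set; exact: measurable_floor.
Qed.

Lemma measurable_plane_y (D : set (R * R * R)) : measurable (D : set R3) ->
  measurable [set p : R2 | D (p.1, 0, p.2)].
Proof.
move=> mD; have mf : measurable_fun setT ((fun p => (p.1, 0, p.2)) : R2 -> R3).
  apply/measurable_fun_pairP; split; last exact: measurable_snd.
  by apply/measurable_fun_pairP; split; [exact: measurable_fst|exact: measurable_cst].
by rewrite -[X in measurable X]setTI; exact: mf.
Qed.

Lemma measurable_line_x (D : set (R * R)) : measurable (D : set R2) ->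
  measurable [set x : measurableTypeR R | D (x, 0)].
Proof.
move=> mD; have mf : measurable_fun setT ((fun p => (p, 0)) : measurableTypeR R -> R2).
  by apply/measurable_fun_pairP; split; [exact: measurable_id|exact: measurable_cst].
by rewrite -[X in measurable X]setTI; exact: mf.
Qed.

Variables (p1 p2 : R).
Hypotheses (p1P : 0 <= p1) (p2P : 0 <= p2).
Let P t : R * R * R := (p1, p2, t).

Lemma pjoin_lift t t' : 0 <= t -> t <= t' -> pjoin G (P t') `<=` pjoin G (P t).
Proof.
move=> t0 tt' v [r [q [r01 Gq ->]]].
have Pt : nonneg3 (P t) by split.
apply: (pjoin_mix nd) => //; last exact: pjoin_sub.
apply: (pjoin_up nd) (pjoin_apex _ (newton_neq0 nd)) _ => //; split.
Qed.

(** Over [b], the floor of the join with [P t'] is reached on a segment that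
    gives [P t'] at least the weight [u]: with a smaller weight, its end in [G]
    would be above a point of the join outside [G]. Lowering [P t'] to [P t]
    then lowers this point of the floor by at least [u * (t' - t)]. *)
Lemma floor_lower t t' s s' b u : 0 <= t -> t <= t' ->
  pos_forms s -> pjoin G (P t) = hpoly s -> pos_forms s' -> pjoin G (P t') = hpoly s' ->
  ~ G (P t') -> 0 <= u < 1 -> shadow G (P t') (cone_chart p1 b.1 u, cone_chart p2 b.2 u) ->
  [/\ 0 <= b.1, 0 <= b.2 & floor_fun s b <= floor_fun s' b - u * (t' - t)].
Proof.
move=> t0 tt' ps Es ps' Es' nGP /andP[u0 u1] [z1 /= [K1 nG1]].
have P0 : nonneg3 (P t) by split.
have P0' : nonneg3 (P t') by split => //; exact: le_trans tt'.
have [c1 c2 _] := pjoin_ge0 nd P0' K1.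
have v0 : 0 < 1 - u by rewrite subr_gt0.
have b1 : 0 <= b.1.
  by move: c1; rewrite /= /cone_chart pmulr_lge0 ?invr_gt0 // => ?; have := p1P; nra.
have b2 : 0 <= b.2.
  by move: c2; rewrite /= /cone_chart pmulr_lge0 ?invr_gt0 // => ?; have := p2P; nra.
split=> //.
set w := floor_fun s' b.
have Kw : pjoin G (P t') (b.1, b.2, w) by rewrite Es'; apply/hpoly_floor.
have [r [q [/andP[r0 r1] Gq E]]] := Kw.
have [E1 E2 E3] : [/\ b.1 = (1 - r) * p1 + r * q.1.1,
    b.2 = (1 - r) * p2 + r * q.1.2 & w = (1 - r) * t' + r * q.2] by case: E.
have [ru|ru] := leP r (1 - u).
  suff : pjoin G (P t) (b.1, b.2, w - u * (t' - t)) by rewrite Es => /(hpoly_floor _ _ ps)[].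
  have K : pjoin G (P t) (mix r (P t) q) by exists r, q; rewrite r0 r1.
  apply: (pjoin_up nd P0 K); split; rewrite /= ?E1 ?E2 // E3.
  by nra.
have rpos : 0 < r by lra.
pose la := (1 - u) / r.
have la1 : la < 1 by rewrite ltr_pdivrMr // mul1r.
have la0 : 0 <= la by rewrite divr_ge0 // ltW.
pose Y := mix la (P t') (cone_chart p1 b.1 u, cone_chart p2 b.2 u, z1).
have KY : pjoin G (P t') Y by apply: pjoin_segment => //; rewrite la0 ltW.
have nGY : ~ G Y.
  by move=> GY; apply: nG1; apply: (pjoin_beyond nd nGP _ K1 GY); rewrite la0 ltW.
have u1' : 1 - u != 0 by rewrite gt_eqF.
have rn : r != 0 by rewrite gt_eqF.
have Y1 : Y.1.1 = q.1.1 by rewrite /Y /= /la /cone_chart E1; field; rewrite u1'.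
have Y2 : Y.1.2 = q.1.2 by rewrite /Y /= /la /cone_chart E2; field; rewrite u1'.
clearbody Y.
have Y3 : Y.2 < q.2.
  rewrite ltNge; apply/negP => h; apply: nGY; apply: (newton_up nd Gq).
  by split; rewrite ?Y1 ?Y2.
have : pjoin G (P t') (b.1, b.2, (1 - r) * t' + r * Y.2).
  have := pjoin_segment KY (r := r); rewrite r0 r1 => /(_ isT).
  by rewrite /mix /= E1 E2 Y1 Y2.
rewrite Es' => /(hpoly_floor _ _ ps')[_ _]; rewrite -/w E3 => h.
by exfalso; nra.
Qed.

(** Over [b], the floor of the join with [P t] is reached on a segment that
    gives [P t] at most the weight [u], for outside the shadow its end may be
    replaced by a point of [G] nearer to [P t]. Raising [P t] to [P t'] then
    raises this point by at most [u * (t' - t)]. *)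
Lemma floor_upper t t' s s' b u : 0 <= t -> t <= t' -> 0 <= b.1 -> 0 <= b.2 ->
  pos_forms s -> pjoin G (P t) = hpoly s -> pos_forms s' -> pjoin G (P t') = hpoly s' ->
  0 <= u < 1 -> ~ shadow G (P t) (cone_chart p1 b.1 u, cone_chart p2 b.2 u) ->
  floor_fun s' b <= floor_fun s b + u * (t' - t).
Proof.
move=> t0 tt' b1 b2 ps Es ps' Es' /andP[u0 u1] nS.
have P0 : nonneg3 (P t) by split.
have P0' : nonneg3 (P t') by split => //; exact: le_trans tt'.
have v0 : 0 < 1 - u by rewrite subr_gt0.
set w := floor_fun s b.
have Kw : pjoin G (P t) (b.1, b.2, w) by rewrite Es; apply/hpoly_floor.
have [r [q [/andP[r0 r1] Gq E]]] := Kw.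
have [E1 E2 E3] : [/\ b.1 = (1 - r) * p1 + r * q.1.1,
    b.2 = (1 - r) * p2 + r * q.1.2 & w = (1 - r) * t + r * q.2] by case: E.
suff : pjoin G (P t') (b.1, b.2, w + u * (t' - t)) by rewrite Es' => /(hpoly_floor _ _ ps')[].
have [ru|ru] := leP (1 - u) r.
  have K : pjoin G (P t') (mix r (P t') q) by exists r, q; rewrite r0 r1.
  apply: (pjoin_up nd P0' K); split; rewrite /= ?E1 ?E2 // E3.
  by nra.
have u1' : 1 - u != 0 by rewrite gt_eqF.
pose m := mix (r / (1 - u)) (P t) q.
have K : pjoin G (P t) m.
  exists (r / (1 - u)), q; split => //; rewrite divr_ge0 ?(ltW v0) //=.
  by rewrite ler_pdivrMr // mul1r ltW.
have m1 : cone_chart p1 b.1 u = m.1.1 by rewrite /cone_chart E1 /=; field.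
have m2 : cone_chart p2 b.2 u = m.1.2 by rewrite /cone_chart E2 /=; field.
have Gm : G m.
  apply: contrapT => nGm; apply: nS; exists m.2; rewrite /= m1 m2.
  by rewrite (_ : (_, _, _) = m) //; exact: eq3.
exists (1 - u), m; split => //; first by apply/andP; split; lra.
by apply: eq3 => /=; rewrite ?E1 ?E2 ?E3; field.
Qed.

Lemma floor_mono t t' s s' b : 0 <= t -> t <= t' -> 0 <= b.1 -> 0 <= b.2 ->
  pos_forms s -> pjoin G (P t) = hpoly s -> pos_forms s' -> pjoin G (P t') = hpoly s' ->
  floor_fun s b <= floor_fun s' b <= floor_fun s b + (t' - t).
Proof.
move=> t0 tt' b1 b2 ps Es ps' Es'.
have P0 : nonneg3 (P t) by split.
have P0' : nonneg3 (P t') by split => //; exact: le_trans tt'.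
apply/andP; split.
  have : pjoin G (P t') (b.1, b.2, floor_fun s' b) by rewrite Es'; apply/hpoly_floor.
  by move=> /(pjoin_lift t0 tt'); rewrite Es => /(hpoly_floor _ _ ps)[].
have : pjoin G (P t) (b.1, b.2, floor_fun s b) by rewrite Es; apply/hpoly_floor.
move=> [r [q [/andP[r0 r1] Gq E]]].
have [E1 E2 E3] : [/\ b.1 = (1 - r) * p1 + r * q.1.1,
    b.2 = (1 - r) * p2 + r * q.1.2 & floor_fun s b = (1 - r) * t + r * q.2] by case: E.
suff : pjoin G (P t') (b.1, b.2, floor_fun s b + (t' - t)).
  by rewrite Es' => /(hpoly_floor _ _ ps')[].
have K : pjoin G (P t') (mix r (P t') q) by exists r, q; rewrite r0 r1.
apply: (pjoin_up nd P0' K); split; rewrite /= ?E1 ?E2 // E3.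
by nra.
Qed.

Lemma fiber_measure s s' b : pos_forms s -> pos_forms s' -> 0 <= b.1 -> 0 <= b.2 ->
  floor_fun s b <= floor_fun s' b ->
  mu1 [set z | (hpoly s `\` hpoly s') (b.1, b.2, z)] = (floor_fun s' b - floor_fun s b)%:E.
Proof.
move=> ps ps' b1 b2 h.
rewrite (_ : mkset _ = `[floor_fun s b, floor_fun s' b[%classic); last first.
  apply/seteqP; split => z /=; rewrite in_itv /=.
    move=> [/(hpoly_floor _ _ ps)[_ _ ->] /= h']; rewrite ltNge; apply/negP => h2.
    by apply: h'; apply/hpoly_floor.
  move=> /andP[h1 h2]; split; first by apply/hpoly_floor.
  by move=> /(hpoly_floor _ _ ps')[_ _]; rewrite leNgt h2.
rewrite lebesgue_measure_itv /= lte_fin; case: ltP => [_|h']; first by rewrite EFinB.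
by rewrite (_ : floor_fun s' b = floor_fun s b) ?subrr //; apply/eqP; rewrite eq_le h h'.
Qed.

(** By [floor_lower], the thickness of the layer over [b] is at least [t' - t]
    times the length of the vertical fibre over [b] of a cone of height one
    based on the shadow. *)
Lemma volume_step t t' : 0 <= t -> t < t' -> ~ G (P t') ->
  (((t' - t) / 3)%:E * mu2 (shadow G (P t')) <= mu3 (pjoin G (P t) `\` pjoin G (P t')))%E.
Proof.
move=> t0 tt' nG; have tt := ltW tt'.
have P0 : nonneg3 (P t) by split.
have P0' : nonneg3 (P t') by split => //; exact: le_trans tt.
have [s ps Es] := pjoin_hpoly nd P0; have [s' ps' Es'] := pjoin_hpoly nd P0'.
have [mC muC] := cone_measure3 p1 p2 (measurable_shadow P0').
set C := (X in measurable X) in mC; rewrite -/C in muC.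
have mD : measurable (pjoin G (P t) `\` pjoin G (P t') : set R3).
  by apply: measurableD; exact: measurable_pjoin.
have e0 : 0 < t' - t by rewrite subr_gt0.
rewrite EFinM -muleA -muC (lebesgue3_xsection mC) (lebesgue3_xsection mD).
rewrite -ge0_integralZl //; last 2 first.
- have := lebesgue_integral_fubini.measurable_fun_xsection mu1 mC.
  by apply: eq_measurable_fun => p _ /=; rewrite xsectionE.
- by rewrite lee_fin ltW.
apply: ge0_le_integral => //.
- by move=> p _; rewrite mule_ge0 // lee_fin ltW.
- apply: measurable_funeM.
  have := lebesgue_integral_fubini.measurable_fun_xsection mu1 mC.
  by apply: eq_measurable_fun => p _ /=; rewrite xsectionE.
- have := lebesgue_integral_fubini.measurable_fun_xsection mu1 mD.
  by apply: eq_measurable_fun => p _ /=; rewrite xsectionE.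
move=> [x y] _ /=.
have low u : C (x, y, u) -> [/\ 0 <= x, 0 <= y & floor_fun s (x, y) <= floor_fun s' (x, y) - u * (t' - t)].
  by move=> [u01 h]; exact: (@floor_lower t t' s s' (x, y) u t0 tt ps Es ps' Es' nG u01 h).
have [[u Cu]|nC] := pselect (exists u, C (x, y, u)); last first.
  rewrite (_ : [set z | C (x, y, z)] = set0) ?measure0 ?mule0 //.
  by apply/seteqP; split => z // Cz; case: nC; exists z.
have [x0 y0 _] := low _ Cu.
have h : floor_fun s (x, y) <= floor_fun s' (x, y).
  by have /andP[] := floor_mono (b := (x, y)) t0 tt x0 y0 ps Es ps' Es'.
rewrite Es Es' (fiber_measure (b := (x, y)) ps ps' x0 y0 h).
set de := floor_fun s' _ - _.
have -> : (de%:E = (t' - t)%:E * (de / (t' - t))%:E)%E.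
  by rewrite -EFinM mulrC divfK // gt_eqF.
rewrite lee_pmul2l ?lte_fin //.
have -> : ((de / (t' - t))%:E = mu1 `[0%R, (de / (t' - t))%R]%classic)%E.
  rewrite lebesgue_measure_itv /= lte_fin oppr0 adde0; case: ltP => // h1.
  congr EFin; apply/eqP; rewrite eq_le h1 divr_ge0 ?subr_ge0 // ltW //.
apply: le_measure; rewrite ?inE //.
  by have := measurable_xsection (x, y) mC; rewrite xsectionE.
move=> z Cz; have [_ _ hz] := low _ Cz; have [/andP[z0 z1] _] := Cz.
rewrite /= in_itv /= z0 ler_pdivlMr // /de; lra.
Qed.

(** By [floor_upper], the thickness of the layer over [b] is at most [t' - t]
    times the length of the vertical fibre over [b] of a cone of height one
    based on the trace of the shadow. *)
Lemma area_step t t' : p2 = 0 -> 0 <= t -> t < t' ->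
  (mu2 [set p : R * R | (pjoin G (P t) `\` pjoin G (P t')) (p.1, 0%R, p.2)] <=
   ((t' - t) / 2)%:E * mu1 [set x | shadow G (P t) (x, 0%R)])%E.
Proof.
move=> p20 t0 tt'; have tt := ltW tt'.
have P0 : nonneg3 (P t) by split.
have P0' : nonneg3 (P t') by split => //; exact: le_trans tt.
have [s ps Es] := pjoin_hpoly nd P0; have [s' ps' Es'] := pjoin_hpoly nd P0'.
have [mC muC] := cone_measure2 p1 (measurable_line_x (measurable_shadow P0)).
set C := (X in measurable X) in mC; rewrite -/C in muC.
have mD : measurable [set p : R2 | (pjoin G (P t) `\` pjoin G (P t')) (p.1, 0, p.2)].
  by apply: measurable_plane_y; apply: measurableD; exact: measurable_pjoin.
have e0 : 0 < t' - t by rewrite subr_gt0.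
rewrite EFinM -muleA -muC !product_measure_xsection.
rewrite -ge0_integralZl //; last 2 first.
- have := lebesgue_integral_fubini.measurable_fun_xsection mu1 mC.
  by apply: eq_measurable_fun => p _ /=; rewrite xsectionE.
- by rewrite lee_fin ltW.
apply: ge0_le_integral => //.
- have := lebesgue_integral_fubini.measurable_fun_xsection mu1 mD.
  by apply: eq_measurable_fun => p _ /=; rewrite xsectionE.
- apply: measurable_funeM.
  have := lebesgue_integral_fubini.measurable_fun_xsection mu1 mC.
  by apply: eq_measurable_fun => p _ /=; rewrite xsectionE.
move=> x _ /=.
have [x0|x0] := ltP x 0.
  rewrite (_ : [set z | _] = set0) ?measure0 ?mule_ge0 // ?lee_fin ?(ltW e0) //.
  apply/seteqP; split => z // [/(pjoin_ge0 nd P0)[]] /=; lra.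
have /andP[h h'] := floor_mono (b := (x, 0)) t0 tt x0 (lexx 0) ps Es ps' Es'.
rewrite Es Es' (fiber_measure (b := (x, 0)) ps ps' x0 (lexx 0) h).
set de := floor_fun s' _ - _.
have -> : (de%:E = (t' - t)%:E * (de / (t' - t))%:E)%E.
  by rewrite -EFinM mulrC divfK // gt_eqF.
rewrite lee_pmul2l ?lte_fin //.
have -> : ((de / (t' - t))%:E = mu1 `[0%R, (de / (t' - t))%R[%classic)%E.
  rewrite lebesgue_measure_itv /= lte_fin oppr0 adde0; case: ltP => // h1.
  congr EFin; apply/eqP; rewrite eq_le h1 divr_ge0 ?subr_ge0 // ltW //.
apply: le_measure; rewrite ?inE //.
  by have := measurable_xsection x mC; rewrite xsectionE.
move=> u; rewrite /= in_itv /= ltr_pdivlMr // => /andP[u0 ud].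
have u1 : u < 1.
  have : u * (t' - t) < 1 * (t' - t) by rewrite mul1r; apply: (lt_le_trans ud); rewrite /de; lra.
  by rewrite ltr_pM2r.
split; first by rewrite u0.
apply: contrapT => nS.
have := @floor_upper t t' s s' (x, 0) u t0 tt x0 (lexx 0) ps Es ps' Es'.
rewrite u0 u1 => /(_ isT) /=.
have -> : cone_chart p2 0 u = 0 by rewrite /cone_chart p20 mulr0 subr0 mul0r.
by move=> /(_ nS); rewrite /de in ud; lra.
Qed.
End steps.
End raising.

(** * The balance of an ascent *)

Section balance.
Context {R : realType}.
Local Notation mu1 := (@lebesgue_measure R).
Local Notation mu2 := ((@lebesgue_measure R \x @lebesgue_measure R)%E).
Local Notation mu3 := (((@lebesgue_measure R \x @lebesgue_measure R) \x @lebesgue_measure R)%E).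
Local Notation R2 := (measurableTypeR R * measurableTypeR R)%type.
Local Notation R3 := (measurableTypeR R * measurableTypeR R * measurableTypeR R)%type.
Implicit Types (D : set (R * R * R)) (B : set (R * R)) (L : set R) (G : set (R * R * R)).

Definition lebesgue3 : {measure set R3 -> \bar R} := product_measure1 lebesgue2 mu1.

Definition vol D : R := fine (mu3 D).
Definition area B : R := fine (mu2 B).
Definition len L : R := fine (mu1 L).

Definition plane_x D : set (R * R) := [set p | D (0, p.1, p.2)].
Definition plane_y D : set (R * R) := [set p | D (p.1, 0, p.2)].
Definition plane_z D : set (R * R) := [set p | D (p.1, p.2, 0)].
Definition axis_x D : set R := [set t | D (t, 0, 0)].
Definition axis_y D : set R := [set t | D (0, t, 0)].
Definition axis_z D : set R := [set t | D (0, 0, t)].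

(** Measurable sets contained in a box of the orthant, for which the measures
    above are finite. *)
Definition small3 D := measurable (D : set R3) /\
  exists M, forall v, D v -> [/\ 0 <= v.1.1 <= M, 0 <= v.1.2 <= M & 0 <= v.2 <= M].
Definition small2 B := measurable (B : set R2) /\
  exists M, forall v, B v -> 0 <= v.1 <= M /\ 0 <= v.2 <= M.
Definition small1 L := measurable (L : set (measurableTypeR R)) /\
  exists M, forall t, L t -> 0 <= t <= M.

Lemma measurable_slice2 (D : set (R * R * R)) (f : R2 -> R3) :
  measurable (D : set R3) -> measurable_fun setT f -> measurable (f @^-1` D : set R2).
Proof. by move=> mD mf; rewrite -[X in measurable X]setTI; exact: mf. Qed.

Lemma measurable_slice1 (B : set (R * R)) (f : measurableTypeR R -> R2) :
  measurable (B : set R2) -> measurable_fun setT f ->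
  measurable (f @^-1` B : set (measurableTypeR R)).
Proof. by move=> mD mf; rewrite -[X in measurable X]setTI; exact: mf. Qed.

Lemma small2_plane_x D : small3 D -> small2 (plane_x D).
Proof.
move=> [mD [M hM]]; split; last by exists M => v /hM[].
apply: (@measurable_slice2 D (fun p : R2 => (0, p.1, p.2))) => //.
apply/measurable_fun_pairP; split; last exact: measurable_snd.
by apply/measurable_fun_pairP; split; [exact: measurable_cst|exact: measurable_fst].
Qed.

Lemma small2_plane_y D : small3 D -> small2 (plane_y D).
Proof.
move=> [mD [M hM]]; split; last by exists M => v /hM[].
exact: measurable_plane_y.
Qed.

Lemma small2_plane_z D : small3 D -> small2 (plane_z D).
Proof.
move=> [mD [M hM]]; split; last by exists M => v /hM[].
apply: (@measurable_slice2 D (fun p : R2 => (p.1, p.2, 0))) => //.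
apply/measurable_fun_pairP; split; last exact: measurable_cst.
by apply/measurable_fun_pairP; split; [exact: measurable_fst|exact: measurable_snd].
Qed.

Lemma small1_fst B : small2 B -> small1 [set t | B (t, 0)].
Proof.
move=> [mD [M hM]]; split; last by exists M => v /hM[].
apply: (@measurable_slice1 B (fun p : measurableTypeR R => (p, 0))) => //.
Qed.

Lemma small1_snd B : small2 B -> small1 [set t | B (0, t)].
Proof.
move=> [mD [M hM]]; split; last by exists M => v /hM[].
apply: (@measurable_slice1 B (fun p : measurableTypeR R => (0, p))) => //.
by apply/measurable_fun_pairP; split; [exact: measurable_cst|exact: measurable_id].
Qed.

Lemma small1_axis_x D : small3 D -> small1 (axis_x D).
Proof. by move=> /small2_plane_z /small1_fst. Qed.
Lemma small1_axis_y D : small3 D -> small1 (axis_y D).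
Proof. by move=> /small2_plane_z /small1_snd. Qed.
Lemma small1_axis_z D : small3 D -> small1 (axis_z D).
Proof. by move=> /small2_plane_x /small1_snd. Qed.

Lemma lebesgue_box (M : R) : (mu1 `[0%R, M]%classic < +oo)%E.
Proof. by rewrite lebesgue_measure_itv /=; case: ifP => _; rewrite ?ltry // -EFinB ltry. Qed.

Lemma volE D : small3 D -> mu3 D = (vol D)%:E.
Proof.
move=> [mD [M hM]]; rewrite /vol fineK // ge0_fin_numE; last first.
  exact: (measure_ge0 lebesgue3).
pose I := `[0%R, M]%classic : set (measurableTypeR R).
have mI : measurable I by exact: measurable_itv.
have mII : measurable (I `*` I : set R2) by exact: measurableX.
apply: (@le_lt_trans _ _ (lebesgue3 ((I `*` I) `*` I))).
  apply: (le_measure lebesgue3); rewrite ?inE //; first exact: measurableX.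
  by move=> [[x y] z] /hM[/= h1 h2 h3]; rewrite /I /= !in_itv.
rewrite (_ : lebesgue3 _ = (mu1 I * mu1 I * mu1 I)%E).
  rewrite lte_mul_pinfty ?lebesgue_box ?mule_ge0 //.
  by rewrite fin_numM // ge0_fin_numE // lebesgue_box.
etransitivity; first exact: (@product_measure1E _ _ _ _ _ lebesgue2 mu1 _ _ mII mI).
by congr (_ * _)%E; exact: (@product_measure1E _ _ _ _ _ mu1 mu1 _ _ mI mI).
Qed.

Lemma areaE B : small2 B -> mu2 B = (area B)%:E.
Proof.
move=> [mD [M hM]]; rewrite /area fineK // ge0_fin_numE; last first.
  exact: (measure_ge0 lebesgue2).
pose I := `[0%R, M]%classic : set (measurableTypeR R).
have mI : measurable I by exact: measurable_itv.
have mII : measurable (I `*` I : set R2) by exact: measurableX.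
have BI : B `<=` I `*` I by move=> [x y] /hM[/= h1 h2]; rewrite /I /= !in_itv.
have le : (lebesgue2 B <= lebesgue2 (I `*` I))%E.
  by apply: (le_measure lebesgue2) => //; rewrite inE.
apply: (le_lt_trans le).
have -> : lebesgue2 (I `*` I) = (mu1 I * mu1 I)%E.
  exact: (@product_measure1E _ _ _ _ _ mu1 mu1 _ _ mI mI).
by rewrite lte_mul_pinfty ?lebesgue_box ?mule_ge0 // ge0_fin_numE // lebesgue_box.
Qed.

Lemma lenE L : small1 L -> mu1 L = (len L)%:E.
Proof.
move=> [mD [M hM]]; rewrite /len fineK // ge0_fin_numE //.
apply: (@le_lt_trans _ _ (mu1 `[0%R, M]%classic)); last exact: lebesgue_box.
by apply: le_measure; rewrite ?inE // => x /hM; rewrite /= in_itv.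
Qed.

Lemma vol_ge0 D : 0 <= vol D. Proof. exact/fine_ge0/(measure_ge0 lebesgue3). Qed.

Lemma vol0 : vol set0 = 0. Proof. exact: (congr1 fine (measure0 lebesgue3)). Qed.
Lemma area0 : area set0 = 0. Proof. exact: (congr1 fine (measure0 lebesgue2)). Qed.
Lemma len0 : len set0 = 0. Proof. by rewrite /len measure0. Qed.

Lemma le_vol D D' : small3 D -> small3 D' -> D `<=` D' -> vol D <= vol D'.
Proof.
move=> sD sD' DD; rewrite -lee_fin -(volE sD) -(volE sD').
by apply: (le_measure lebesgue3); rewrite ?inE //; [case: sD|case: sD'].
Qed.

Lemma le_area B B' : small2 B -> small2 B' -> B `<=` B' -> area B <= area B'.
Proof.
move=> sD sD' DD; rewrite -lee_fin -(areaE sD) -(areaE sD').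
by apply: (le_measure lebesgue2); rewrite ?inE //; [case: sD|case: sD'].
Qed.

Lemma le_len L L' : small1 L -> small1 L' -> L `<=` L' -> len L <= len L'.
Proof.
move=> sD sD' DD; rewrite -lee_fin -(lenE sD) -(lenE sD').
by apply: le_measure; rewrite ?inE //; [case: sD|case: sD'].
Qed.

Lemma small3U D D' : small3 D -> small3 D' -> small3 (D `|` D').
Proof.
move=> [mD [M h]] [mD' [M' h']]; split; first exact: measurableU.
exists (Num.max M M') => v []; [move=> /h|move=> /h'] => -[/andP[-> k1] /andP[-> k2] /andP[-> k3]];
  by rewrite !le_max k1 k2 k3 ?orbT.
Qed.

Lemma small2U B B' : small2 B -> small2 B' -> small2 (B `|` B').
Proof.
move=> [mD [M h]] [mD' [M' h']]; split; first exact: measurableU.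
exists (Num.max M M') => v []; [move=> /h|move=> /h'] => -[/andP[-> k1] /andP[-> k2]];
  by rewrite !le_max k1 k2 ?orbT.
Qed.

Lemma small1U L L' : small1 L -> small1 L' -> small1 (L `|` L').
Proof.
move=> [mD [M h]] [mD' [M' h']]; split; first exact: measurableU.
exists (Num.max M M') => v []; [move=> /h|move=> /h'] => /andP[-> k1];
  by rewrite !le_max k1 ?orbT.
Qed.

Lemma volU D D' : small3 D -> small3 D' -> D `&` D' = set0 ->
  vol (D `|` D') = vol D + vol D'.
Proof.
move=> sD sD' DD; apply: EFin_inj; rewrite EFinD -(volE (small3U sD sD')) -(volE sD) -(volE sD').
by apply: (measureU lebesgue3) => //; [case: sD|case: sD'].
Qed.

Lemma areaU B B' : small2 B -> small2 B' -> B `&` B' = set0 ->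
  area (B `|` B') = area B + area B'.
Proof.
move=> sD sD' DD; apply: EFin_inj; rewrite EFinD -(areaE (small2U sD sD')) -(areaE sD) -(areaE sD').
by apply: (measureU lebesgue2) => //; [case: sD|case: sD'].
Qed.

Lemma lenU L L' : small1 L -> small1 L' -> L `&` L' = set0 ->
  len (L `|` L') = len L + len L'.
Proof.
move=> sD sD' DD; apply: EFin_inj; rewrite EFinD -(lenE (small1U sD sD')) -(lenE sD) -(lenE sD').
by apply: measureU => //; [case: sD|case: sD'].
Qed.

Lemma small3S D D' : measurable (D : set R3) -> D `<=` D' -> small3 D' -> small3 D.
Proof. by move=> mD DD [_ [M h]]; split=> //; exists M => v /DD /h. Qed.
Lemma small2S B B' : measurable (B : set R2) -> B `<=` B' -> small2 B' -> small2 B.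
Proof. by move=> mD DD [_ [M h]]; split=> //; exists M => v /DD /h. Qed.

(** Over a subdivision into equal steps, [rho] is taken at the end of each step
    and [mu] at its start: as [mu <= rho], the bounds on the increments of [F]
    telescope to a defect that is inversely proportional to the number of steps. *)
Lemma telescoping (F rho mu : R -> R) (z0 l : R) : z0 <= l ->
  (forall t t', z0 <= t -> t < t' -> t' <= l -> (t' - t) * (rho t' - mu t) <= F t - F t') ->
  (forall t, z0 <= t <= l -> mu t <= rho t) -> F l = 0 -> 0 <= F z0.
Proof.
move=> z0l step murho Fl.
have [->|zl] := eqVneq z0 l; first by rewrite Fl.
have ll : 0 < l - z0 by rewrite subr_gt0 lt_neqAle zl.
have main (N : nat) : (0 < N)%N -> (l - z0) / N%:R * (mu l - mu z0) <= F z0.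
  move=> N0; have N0' : 0 < N%:R :> R by rewrite ltr0n.
  pose e := (l - z0) / N%:R.
  have e0 : 0 < e by rewrite divr_gt0.
  have eN : e * N%:R = l - z0 by rewrite divfK ?gt_eqF.
  have H k : (k <= N)%N -> F (z0 + e * k%:R) + e * mu (z0 + e * k%:R) <= F z0 + e * mu z0.
    elim: k => [_|k IH kN]; first by rewrite mulr0 addr0.
    apply: le_trans (IH (ltnW kN)).
    have kN' : e * k.+1%:R <= l - z0 by rewrite -eN ler_pM2l // ler_nat.
    have kE : e * k.+1%:R = e * k%:R + e by rewrite -natr1 mulrDr mulr1.
    have k0 : 0 <= e * k%:R by rewrite mulr_ge0 ?ler0n // ltW.
    have := step (z0 + e * k%:R) (z0 + e * k.+1%:R).
    rewrite kE lerDl k0 => /(_ isT); rewrite addrA ltrDl e0 => /(_ isT) hs.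
    have hl : z0 + e * k%:R + e <= l by lra.
    have {}hs := hs hl.
    have := murho (z0 + e * k%:R + e); rewrite hl andbT => hm.
    have {}hm : mu (z0 + e * k%:R + e) <= rho (z0 + e * k%:R + e) by apply: hm; lra.
    have hd : z0 + e * k%:R + e - (z0 + e * k%:R) = e by ring.
    rewrite hd in hs; nra.
  have := H N (leqnn N); rewrite eN (_ : z0 + (l - z0) = l) ?Fl; last by ring.
  by rewrite -/e; lra.
rewrite leNgt; apply/negP => F0.
pose c := (l - z0) * (mu l - mu z0).
pose y := c / F z0.
have yE : y * F z0 = c by rewrite divfK // lt_eqF.
pose N := Num.bound `|y|.
have yN : y < N%:R by apply: le_lt_trans (ler_norm _) _; exact: archi_boundP.
have N0 : (0 < N)%N.
  by rewrite -(ltr0n R); apply: le_lt_trans (archi_boundP (normr_ge0 y)).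
have N0' : 0 < N%:R :> R by rewrite ltr0n.
have := main N N0; rewrite (_ : _ * _ = c / N%:R); last by rewrite /c; field; rewrite gt_eqF.
by rewrite ler_pdivrMr // -yE; nra.
Qed.

(** The point [P] climbs vertically from height [z0] until it reaches [G] at
    height [l]. The balance [F] compares what the join loses: per unit of
    height, a volume of at least a third of the area of the shadow and, in a
    vertical coordinate plane, an area of at most half the length of its trace. *)
Section climb.
Variables (G : set (R * R * R)) (A : seq (nat * nat * nat)).
Hypothesis nd : newton_data G A.

Lemma newton_bound : exists M : R, forall v, nonneg3 v -> ~ G v ->
  [/\ 0 <= v.1.1 <= M, 0 <= v.1.2 <= M & 0 <= v.2 <= M].
Proof.
have [M [M0 /(newton_gen nd) h1 /(newton_gen nd) h2 /(newton_gen nd) h3]] := newton_axes nd.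
exists M%:R => v [v1 v2 v3] nG.
have H q : G q -> ~ le3 q v by move=> Gq qv; apply: nG; exact: (newton_up nd Gq qv).
have M1 : v.1.1 <= M%:R.
  by rewrite leNgt; apply/negP => h; apply: (H _ h1); split => //=; exact: ltW.
have M2 : v.1.2 <= M%:R.
  by rewrite leNgt; apply/negP => h; apply: (H _ h2); split => //=; exact: ltW.
have M3 : v.2 <= M%:R.
  by rewrite leNgt; apply/negP => h; apply: (H _ h3); split => //=; exact: ltW.
by rewrite v1 v2 v3.
Qed.

Lemma small3_diff P : nonneg3 P -> small3 (pjoin G P `\` G).
Proof.
move=> P0; split.
  by apply: measurableD; [exact: (measurable_pjoin nd)|exact: (measurable_newton nd)].
have [M hM] := newton_bound; exists M => v [Kv nG]; apply: hM => //.
exact: (pjoin_ge0 nd P0 Kv).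
Qed.

Lemma small2_shadow P : nonneg3 P -> small2 (shadow G P).
Proof.
move=> P0; split; first exact: (measurable_shadow nd).
have [M hM] := newton_bound; exists M => v [z [Kv nG]].
by have [] := hM _ (pjoin_ge0 nd P0 Kv) nG.
Qed.

Lemma shadow_newton P : G P -> shadow G P = set0.
Proof.
move=> GP; apply/seteqP; split => // b [z [[r [q [r01 Gq ->]]] nG]].
by apply: nG; exact: (newton_mix nd r01 GP Gq).
Qed.

Variables (p1 p2 : R).
Hypotheses (p1P : 0 <= p1) (p2P : 0 <= p2).
Let P t : R * R * R := (p1, p2, t).

Lemma shadow_mono t t' : 0 <= t -> t <= t' -> shadow G (P t') `<=` shadow G (P t).
Proof.
by move=> t0 tt b [z [K nG]]; exists z; split => //; exact: (pjoin_lift nd p1P p2P t0 tt K).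
Qed.

(** Lets an inequality that holds for the shadows at all later heights be read
    at the initial one. *)
Lemma shadow_limit t0 l : 0 <= t0 -> t0 < l ->
  shadow G (P t0) `<=` \bigcup_n shadow G (P (t0 + (l - t0) / n.+1%:R)).
Proof.
move=> t00 tl b [z [[r [q [/andP[r0 r1] Gq E]]] nG]].
have [s ps Es] := newton_hpoly nd.
have P0 : nonneg3 (P t0) by split.
have v0 : nonneg3 (b.1, b.2, z) by apply: (pjoin_ge0 nd P0); exists r, q; rewrite r0 r1.
have [a aS ha] : exists2 a, a \in s & ev a (b.1, b.2, z) < 1.
  by apply: notin_hpoly => //; rewrite -Es.
have [a1 a2 a3] := ps a aS.
pose y := a.2 * (l - t0) / (1 - ev a (b.1, b.2, z)).
have d0 : 0 < 1 - ev a (b.1, b.2, z) by rewrite subr_gt0.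
have y0 : 0 <= y by rewrite divr_ge0 ?(ltW d0) // mulr_ge0 ?(ltW a3) // subr_ge0 ltW.
pose n := Num.bound y.
have yn : y < n.+1%:R by apply: lt_trans (archi_boundP y0) _; rewrite ltr_nat.
have n0 : 0 < n.+1%:R :> R by rewrite ltr0n.
pose h := (l - t0) / n.+1%:R.
have h0 : 0 <= h by rewrite divr_ge0 ?ler0n // subr_ge0 ltW.
have ah : a.2 * h < 1 - ev a (b.1, b.2, z).
  move: yn; rewrite /y ltr_pdivrMr // -ltr_pdivrMl // => yn.
  by apply: le_lt_trans yn; rewrite /h mulrA mulrC.
exists n => //; exists (z + (1 - r) * h); rewrite -/h; split.
  have [E1 E2 E3] : [/\ b.1 = (1 - r) * p1 + r * q.1.1,
    b.2 = (1 - r) * p2 + r * q.1.2 & z = (1 - r) * t0 + r * q.2] by case: E.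
  exists r, q; rewrite r0 r1; split => //; apply: eq3; rewrite /= ?E1 ?E2 ?E3 //.
  by ring.
rewrite Es => -[_ /(_ a aS)].
have -> : ev a (b.1, b.2, z + (1 - r) * h) = ev a (b.1, b.2, z) + a.2 * ((1 - r) * h).
  by rewrite /ev /=; ring.
by have := mulr_ge0 (ltW a3) (mulr_ge0 r0 h0); lra.
Qed.

Lemma area_step_x t t' : p1 = 0 -> 0 <= t -> t < t' ->
  (mu2 [set p : R * R | (pjoin G (P t) `\` pjoin G (P t')) (0%R, p.1, p.2)] <=
   ((t' - t) / 2)%:E * mu1 [set y | shadow G (P t) (0%R, y)])%E.
Proof.
move=> p10 t0 tt; have := area_step (newton_data_sw12 nd) p2P p1P p10 t0 tt.
by rewrite /shadow !(pjoin_sw12 G (p1, p2, _)).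
Qed.

Variables (cx cy c0 z0 l : R).
Hypotheses (z00 : 0 <= z0) (z0l : z0 < l) (Gl : G (P l)).
Hypotheses (cxP : 0 <= cx) (cyP : 0 <= cy) (c0P : 0 <= c0).
Hypotheses (cx0 : cx = 0 \/ p1 = 0) (cy0 : cy = 0 \/ p2 = 0).
Hypothesis below : forall t, z0 <= t -> t < l -> ~ G (P t).

Let weight t := cx * len [set y | shadow G (P t) (0, y)]
  + cy * len [set x | shadow G (P t) (x, 0)] - c0.
Hypothesis static : forall t, z0 <= t -> t < l ->
  weight t <= 2 * area (shadow G (P t)).

Let D t := pjoin G (P t) `\` G.
Let F t := 6 * vol (D t) - 2 * cx * area (plane_x (D t)) - 2 * cy * area (plane_y (D t))
  + c0 * (l - t).

Lemma D_split t t' : 0 <= t -> t <= t' ->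
  D t = (pjoin G (P t) `\` pjoin G (P t')) `|` D t' /\
  (pjoin G (P t) `\` pjoin G (P t')) `&` D t' = set0.
Proof.
move=> t0 tt; split; apply/seteqP; split => v.
- by move=> [K nG]; have [K'|nK'] := pselect (pjoin G (P t') v); [right|left].
- move=> [[K nK]|[K nG]]; split => //; first by move=> /(@pjoin_sub _ G (P t')).
  exact: (pjoin_lift nd p1P p2P t0 tt K).
- by move=> [[K nK] [K' nG]].
- by [].
Qed.

Let rho t := 2 * area (shadow G (P t)).

Lemma step_arith (kx ky k0 h t t' S v v' x x' y y' lx ly : R) :
  (t' - t) / 3 * S <= v -> kx * x <= kx * ((t' - t) / 2 * lx) ->
  ky * y <= ky * ((t' - t) / 2 * ly) ->
  (t' - t) * (2 * S - (kx * lx + ky * ly - k0)) <=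
  6 * (v + v') - 2 * kx * (x + x') - 2 * ky * (y + y') + k0 * (h - t) -
  (6 * v' - 2 * kx * x' - 2 * ky * y' + k0 * (h - t')).
Proof.
move=> h1 h2 h3.
have -> : 6 * (v + v') - 2 * kx * (x + x') - 2 * ky * (y + y') + k0 * (h - t) -
  (6 * v' - 2 * kx * x' - 2 * ky * y' + k0 * (h - t')) =
  (t' - t) * (2 * S - (kx * lx + ky * ly - k0)) + 6 * (v - (t' - t) / 3 * S)
  + 2 * (kx * ((t' - t) / 2 * lx) - kx * x) + 2 * (ky * ((t' - t) / 2 * ly) - ky * y)
  by field.
by rewrite -!addrA lerDl !addr_ge0 ?mulr_ge0 ?subr_ge0.
Qed.

Lemma climb_step t t' : z0 <= t -> t < t' -> t' <= l ->
  (t' - t) * (rho t' - weight t) <= F t - F t'.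
Proof.
have z0p := z00; have cxp := cxP; have cyp := cyP.
move=> z0t tt' t'l; have tt := ltW tt'.
have t0 : 0 <= t by exact: le_trans z0t.
have t0' : 0 <= t' by exact: le_trans tt.
have Pt : nonneg3 (P t) by split.
have Pt' : nonneg3 (P t') by split.
have [DE DI] := D_split t0 tt.
set E := pjoin G (P t) `\` pjoin G (P t') in DE DI.
have sD : small3 (D t) by exact: small3_diff.
have sD' : small3 (D t') by exact: small3_diff.
have sE : small3 E.
  apply: (small3S _ _ sD); last by rewrite DE => v; left.
  by apply: measurableD; exact: (measurable_pjoin nd).
have vE : vol (D t) = vol E + vol (D t') by rewrite {1}DE volU.
have xE : area (plane_x (D t)) = area (plane_x E) + area (plane_x (D t')).
  have -> : plane_x (D t) = plane_x E `|` plane_x (D t') by exact: (congr1 plane_x DE).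
  rewrite (areaU (small2_plane_x sE) (small2_plane_x sD')) //.
  by apply/seteqP; split => // p [h1 h2]; have : (set0 : set (R * R * R)) (0, p.1, p.2) by rewrite -DI; split.
have yE : area (plane_y (D t)) = area (plane_y E) + area (plane_y (D t')).
  have -> : plane_y (D t) = plane_y E `|` plane_y (D t') by exact: (congr1 plane_y DE).
  rewrite (areaU (small2_plane_y sE) (small2_plane_y sD')) //.
  by apply/seteqP; split => // p [h1 h2]; have : (set0 : set (R * R * R)) (p.1, 0, p.2) by rewrite -DI; split.
have tpos : 0 <= t' - t by rewrite subr_ge0.
have sS : small2 (shadow G (P t)) by exact: small2_shadow.
have v1 : (t' - t) / 3 * area (shadow G (P t')) <= vol E.
  move: t'l; rewrite le_eqVlt => /orP[/eqP t'l|t'l].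
    by rewrite t'l shadow_newton // area0 mulr0 vol_ge0.
  rewrite -lee_fin EFinM -areaE; last exact: small2_shadow.
  rewrite -volE //; apply: (volume_step nd p1P p2P t0 tt').
  by apply: below => //; apply: le_trans tt.
have x1 : cx * area (plane_x E) <= cx * ((t' - t) / 2 * len [set y | shadow G (P t) (0, y)]).
  case: cx0 => [->|p10]; first by rewrite !mul0r.
  apply: ler_wpM2l => //; rewrite -lee_fin EFinM -areaE; last exact: small2_plane_x.
  rewrite -lenE; last exact: small1_snd.
  exact: area_step_x p10 t0 tt'.
have y1 : cy * area (plane_y E) <= cy * ((t' - t) / 2 * len [set x | shadow G (P t) (x, 0)]).
  case: cy0 => [->|p20]; first by rewrite !mul0r.
  apply: ler_wpM2l => //; rewrite -lee_fin EFinM -areaE; last exact: small2_plane_y.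
  rewrite -lenE; last exact: small1_fst.
  exact: (area_step nd p1P p2P p20 t0 tt').
rewrite /F vE xE yE /rho /weight.
exact: step_arith v1 x1 y1.
Qed.

Lemma climb_static t : z0 <= t <= l -> weight t <= rho t.
Proof.
have c0p := c0P.
move=> /andP[z0t]; rewrite le_eqVlt => /orP[/eqP ->|tl]; last exact: static.
rewrite /weight /rho shadow_newton //.
have e1 : [set y : R | (set0 : set (R * R)) (0, y)] = set0 by [].
have e2 : [set x : R | (set0 : set (R * R)) (x, 0)] = set0 by [].
by rewrite e1 ?e2 area0 len0 !mulr0; lra.
Qed.

Lemma climb_end : F l = 0.
Proof.
rewrite /F (_ : D l = set0).
  have -> : plane_x set0 = set0 by [].
  have -> : plane_y set0 = set0 by [].
  by rewrite vol0 area0 (subrr l) !mulr0 !subr0 addr0.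
apply/seteqP; split => // v [[r [q [r01 Gq ->]]] nG].
by apply: nG; exact: (newton_mix nd r01 Gl Gq).
Qed.

Lemma climb_ge0 t : z0 <= t -> t <= l -> 0 <= F t.
Proof.
move=> z0t tl; apply: (telescoping (rho := rho) (mu := weight) tl _ _ climb_end).
  by move=> s s' ts; apply: climb_step; exact: le_trans ts.
by move=> s /andP[ts sl]; apply: climb_static; rewrite sl (le_trans z0t ts).
Qed.

(** If the balance vanishes at the start, the initial weight bounds twice the
    area of each later shadow, hence also that of their increasing union, the
    initial shadow. *)
Theorem climb_eq0 : F z0 = 0 -> rho z0 <= weight z0.
Proof.
have z0p := z00; have z0lp := z0l.
move=> F0.
have H t : z0 < t -> t <= l -> rho t <= weight z0.
  move=> z0t tl; have := climb_step (lexx _) z0t tl; rewrite F0.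
  have := climb_ge0 (ltW z0t) tl; have : 0 < t - z0 by rewrite subr_gt0.
  by nra.
pose S n := shadow G (P (z0 + (l - z0) / n.+1%:R)).
have tn n : z0 < z0 + (l - z0) / n.+1%:R /\ z0 + (l - z0) / n.+1%:R <= l.
  have n0 : 0 < n.+1%:R :> R by rewrite ltr0n.
  split; first by rewrite ltrDl divr_gt0 // subr_gt0.
  rewrite -lerBrDl ler_pdivrMr // ler_peMr ?subr_ge0 ?(ltW z0lp) //.
  by rewrite ler1n.
have tn0 n : 0 <= z0 + (l - z0) / n.+1%:R by apply: le_trans (ltW (tn n).1).
have Pn n : nonneg3 (P (z0 + (l - z0) / n.+1%:R)) by split => //; exact: tn0.
have P0 : nonneg3 (P z0) by split.
have mS n : measurable (S n : set R2) by exact: (measurable_shadow nd).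
have SE : shadow G (P z0) = \bigcup_n S n.
  apply/seteqP; split; first exact: shadow_limit.
  by move=> b [n _]; apply: shadow_mono => //; exact: ltW (tn n).1.
have mono : {homo S : n m / (n <= m)%N >-> (n <= m)%O}.
  move=> n m nm; apply/subsetPset; apply: shadow_mono => //.
  rewrite lerD2l ler_pM2l ?subr_gt0 // lef_pV2 ?posrE ?ltr0n // ler_nat.
  by [].
have mU : measurable (\bigcup_n S n : set R2) by exact: bigcupT_measurable.
have cv := nondecreasing_cvg_mu (mu := lebesgue2) mS mU mono.
have le : (lebesgue2 (\bigcup_n S n) <= (weight z0 / 2)%:E)%E.
  rewrite -(cvg_lim _ cv) //; apply: lime_le; first by apply/cvg_ex; eexists; exact: cv.
  apply: nearW => n /=.
  have [t1 t2] := tn n; have := H _ t1 t2; rewrite /rho -/(S n) => h.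
  have -> : lebesgue2 (S n) = (area (S n))%:E by apply: areaE; exact: small2_shadow.
  by rewrite lee_fin ler_pdivlMr // mulrC.
rewrite /rho; move: le; rewrite -SE.
have -> : lebesgue2 (shadow G (P z0)) = (area (shadow G (P z0)))%:E.
  by apply: areaE; exact: small2_shadow.
by rewrite lee_fin ler_pdivlMr // mulrC.
Qed.
End climb.
End balance.

(** * Shadows seen from a point of a coordinate plane *)

Section triangles.
Context {R : realType}.
Local Notation mu1 := (@lebesgue_measure R).
Local Notation mu2 := ((@lebesgue_measure R \x @lebesgue_measure R)%E).
Implicit Types (G : set (R * R * R)) (A : seq (nat * nat * nat)).

Definition triangle (a b q h : R) : set (R * R) :=
  [set p | [/\ 0 <= p.2, p.2 < h, a + (q - a) * (p.2 / h) < p.1 &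
    p.1 < b + (q - b) * (p.2 / h)]].

Lemma small2_triangle a b q h : 0 <= a -> a <= b -> 0 <= q -> 0 < h ->
  small2 (triangle a b q h) /\ area (triangle a b q h) = (b - a) * h / 2.
Proof.
move=> a0 ab q0 h0; have [mT muT] := triangle_measure q ab h0; split; last first.
  by rewrite /area /triangle muT.
split=> //; exists (b + q + h) => -[x y] [/= y0 yh h1 h2].
have u0 : 0 <= y / h by rewrite divr_ge0 // ltW.
have u1 : y / h < 1 by rewrite ltr_pdivrMr // mul1r.
move: (y / h) u0 u1 h1 h2 => u u0 u1 h1 h2.
split; last by apply/andP; split => //; lra.
by apply/andP; split; nra.
Qed.

(** The set [B] is a small box in the middle of the wedge. *)
Lemma wedge_area_gt0 (S : set (R * R)) (k m m' de : R) : small2 S -> m' < m -> 0 < de ->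
  (forall x y, 0 < y < de -> k + m' * y < x < k + m * y -> S (x, y)) ->
  exists B, [/\ small2 B, B `<=` S, 0 < area B &
    forall p, B p -> k + m' * p.2 < p.1 < k + m * p.2].
Proof.
move=> sS mm de0 h.
pose d := m - m'; have d0 : 0 < d by rewrite subr_gt0.
pose c := `|m| + `|m'| + 1.
have c0 : 0 < c by rewrite ltr_wpDl // addr_ge0.
have mc : `|m| <= c by rewrite /c; have := normr_ge0 m'; lra.
have mc' : `|m'| <= c by rewrite /c; have := normr_ge0 m; lra.
pose y1 := de / 2; have y10 : 0 < y1 by rewrite divr_gt0.
pose s := Num.min (de / 4) (d * y1 / (8 * c)).
have s0 : 0 < s by rewrite lt_min !divr_gt0 // ?mulr_gt0.
have sde : s <= de / 4 by rewrite ge_min lexx.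
have sc : c * s <= d * y1 / 8.
  have : s <= d * y1 / (8 * c) by rewrite ge_min lexx orbT.
  rewrite ler_pdivlMr ?mulr_gt0 // => hs; rewrite ler_pdivlMr //.
  by apply: le_trans hs; rewrite le_eqVlt; apply/orP; left; apply/eqP; ring.
pose x0 := k + (m + m') / 2 * y1.
pose r := d * y1 / 8; have r0 : 0 < r by rewrite divr_gt0 // mulr_gt0.
pose I := `[x0 - r, x0 + r]%classic : set (measurableTypeR R).
pose J := `[y1, y1 + s]%classic : set (measurableTypeR R).
have mI : measurable I by exact: measurable_itv.
have mJ : measurable J by exact: measurable_itv.
have hIJ p : (I `*` J) p -> k + m' * p.2 < p.1 < k + m * p.2 /\ 0 < p.2 < de.
  move=> []; rewrite /I /J /= !in_itv /= => /andP[i1 i2] /andP[j1 j2].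
  have e1 : `|m| * (p.2 - y1) <= r.
    apply: le_trans sc; apply: ler_pM => //; rewrite ?subr_ge0 //; lra.
  have e2 : `|m'| * (p.2 - y1) <= r.
    apply: le_trans sc; apply: ler_pM => //; rewrite ?subr_ge0 //; lra.
  have f1 : - (`|m| * (p.2 - y1)) <= m * (p.2 - y1).
    by rewrite -mulNr ler_wpM2r ?subr_ge0 // lerNl -normrN ler_norm.
  have f2 : m' * (p.2 - y1) <= `|m'| * (p.2 - y1).
    by rewrite ler_wpM2r ?subr_ge0 // ler_norm.
  split; last by apply/andP; split; [exact: lt_le_trans j1|rewrite /y1 in j2 *; lra].
  have rE : d * y1 = 8 * r by rewrite /r; field.
  have mE : m * y1 = m' * y1 + 8 * r by rewrite -rE /d; ring.
  have xE : x0 = k + m' * y1 + 4 * r.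
    by rewrite /x0 mulrAC mulrDl mE; field.
  by apply/andP; split; lra.
exists (I `*` J); split.
- apply: (small2S _ _ sS); first exact: measurableX.
  by move=> [x y] /hIJ[h1 h2]; exact: h.
- by move=> [x y] /hIJ[h1 h2]; exact: h.
- have eI : mu1 I = (2 * r)%:E.
    rewrite /I lebesgue_measure_itv /= lte_fin ifT; last by lra.
    by rewrite -EFinB; congr (_%:E); ring.
  have eJ : mu1 J = s%:E.
    rewrite /J lebesgue_measure_itv /= lte_fin ifT; last by lra.
    by rewrite -EFinB; congr (_%:E); ring.
  have eIJ : mu2 (I `*` J) = (2 * r * s)%:E.
    etransitivity; first exact: (@product_measure1E _ _ _ _ _ mu1 mu1 _ _ mI mJ).
    by rewrite EFinM; congr (_ * _)%E; [exact: eI|exact: eJ].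
  by rewrite /area eIJ /= !mulr_gt0.
- by move=> p /hIJ[].
Qed.

Lemma two_triangles (u u' h h' S L : R) : 0 < u -> 0 < u' -> 1 <= h -> 1 <= h' ->
  u * h / 2 + u' * h' / 2 <= S -> L <= u + u' ->
  L <= 2 * S /\ (2 * S <= L -> [/\ h = 1, h' = 1 & S <= u * h / 2 + u' * h' / 2]).
Proof.
move=> u0 u0' h1 h1' hS hL.
have m1 : 0 <= u * (h - 1) by rewrite mulr_ge0 ?subr_ge0 // ltW.
have m1' : 0 <= u' * (h' - 1) by rewrite mulr_ge0 ?subr_ge0 // ltW.
split=> [|e]; first by lra.
have hE : h = 1 by nra.
have hE' : h' = 1 by nra.
by rewrite hE hE'; split => //; lra.
Qed.

(** What equality forces on [G]: the directions from [P] to [G] are all spanned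
    by that of [Q], those of points of the plane of equation [y = 0], and upward
    ones. *)
Definition apex_y G (P Q : R * R * R) := [/\ G Q, Q.1.2 = 1 & forall v, G v ->
  exists c la, [/\ G c, c.1.2 = 0, 0 <= la & le3 (bary P Q c v.1.2 la) v]].

Section static.
Variables (G : set (R * R * R)) (A : seq (nat * nat * nat)).
Hypothesis nd : newton_data G A.

Lemma le_len_itv (L : set R) (a b : R) : a <= b -> 0 <= a -> small1 L ->
  L `<=` `[a, b]%classic -> len L <= b - a.
Proof.
move=> ab a0 sL h.
have sI : small1 `[a, b]%classic.
  split; first exact: measurable_itv.
  exists b => t; rewrite /= in_itv /= => /andP[h1 ->].
  by rewrite andbT (le_trans a0).
apply: (le_trans (le_len sL sI h)).
by rewrite /len lebesgue_measure_itv /= lte_fin; case: ifP => //= _; rewrite subr_ge0.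
Qed.

Section side_triangle.
Variables (k : nat) (t : R).
Hypotheses (tP : 0 < t) (PG : ~ G (k%:R, 0, t)).
Let P : R * R * R := (k%:R, 0, t).

(** The conclusion of [extreme_side], named so that the configurations on both
    sides of [P] can be compared. *)
Definition side_facts (e : R) (a b : nat * nat * nat) (al : R * R * R) :=
  [/\ a \in A, b \in A, a.1.2 = 0%N, 0 < e * (a.1.1%:R - k%:R) & (0 < b.1.2)%N] /\
  [/\ pos3 al, ev al (emb a) = ev al P, ev al (emb b) = ev al P,
      forall v, G v -> ev al P <= ev al v &
      forall c, c \in A -> c.1.2 = 0%N -> e * (c.1.1%:R - k%:R) <= 0 ->
        ev al P < ev al (emb c)] /\
  [/\ forall la mu, 0 <= la -> 0 <= mu -> la + mu < 1 -> ~ G (bary P (emb a) (emb b) la mu),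
      forall x z, pjoin G P (x, 0, z) -> e * (a.1.1%:R - k%:R) <= e * (x - k%:R) ->
        G (x, 0, z) &
      forall c, c \in A -> ev al (emb c) = ev al P ->
        let psi := e * (c.1.1%:R - a.1.1%:R) * b.1.2%:R -
                   e * (b.1.1%:R - a.1.1%:R) * c.1.2%:R in
        0 <= psi /\ (psi = 0 -> (c.1.2 <= b.1.2)%N)].

Lemma side_factsP e : e = 1 \/ (e = -1 /\ (0 < k)%N) ->
  exists a b al, side_facts e a b al.
Proof. by move=> eP; exact: (extreme_side nd eP tP PG). Qed.

Let P0 : nonneg3 P. Proof. by split; rewrite /= ?ler0n // ltW. Qed.

Lemma side_shadow e a b al la mu : side_facts e a b al ->
  0 <= la -> 0 <= mu -> la + mu < 1 ->
  [/\ pjoin G P (bary P (emb a) (emb b) la mu),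
      ev al (bary P (emb a) (emb b) la mu) = ev al P &
      shadow G P (k%:R + la * (a.1.1%:R - k%:R) + mu * (b.1.1%:R - k%:R), mu * b.1.2%:R)].
Proof.
move=> [[aA bA aY aX bY] [[al0 eva evb alG _] [nG _ _]]] la0 mu0 lm.
have K : pjoin G P (bary P (emb a) (emb b) la mu).
  by apply: (pjoin_bary nd P0) => //; [| |exact: ltW]; apply: pjoin_sub; exact: (newton_gen nd).
split => //; first by rewrite ev_bary eva evb !subrr !mulr0 !addr0.
exists (t + la * (a.2%:R - t) + mu * (b.2%:R - t)).
have E : (k%:R + la * (a.1.1%:R - k%:R) + mu * (b.1.1%:R - k%:R), mu * b.1.2%:R,
    t + la * (a.2%:R - t) + mu * (b.2%:R - t)) = bary P (emb a) (emb b) la mu.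
  by rewrite /bary /= aY !subr0 mulr0 !add0r.
by rewrite E; split => //; exact: nG.
Qed.

Lemma pjoin_side al v : pos3 al -> (forall v, G v -> ev al P <= ev al v) ->
  pjoin G P v -> ev al P <= ev al v.
Proof.
by move=> [a1 a2 a3] alG; apply: newton_pjoin_half => //; split; exact: ltW.
Qed.

Lemma right_triangle a b al : side_facts 1 a b al ->
  triangle k%:R a.1.1%:R b.1.1%:R b.1.2%:R `<=` shadow G P /\
  forall p, triangle k%:R a.1.1%:R b.1.1%:R b.1.2%:R p -> exists la mu,
    [/\ 0 < la, 0 <= mu, la + mu < 1,
        p.1 = k%:R + la * (a.1.1%:R - k%:R) + mu * (b.1.1%:R - k%:R) & p.2 = mu * b.1.2%:R].
Proof.
move=> sf; have [[aA bA aY aX bY] _] := sf.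
have bY' : 0 < b.1.2%:R :> R by rewrite ltr0n.
rewrite mul1r in aX.
have par p : triangle k%:R a.1.1%:R b.1.1%:R b.1.2%:R p -> exists la mu,
    [/\ 0 < la, 0 <= mu, la + mu < 1,
        p.1 = k%:R + la * (a.1.1%:R - k%:R) + mu * (b.1.1%:R - k%:R) & p.2 = mu * b.1.2%:R].
  move=> [y0 yh h1 h2]; exists ((p.1 - k%:R - p.2 / b.1.2%:R * (b.1.1%:R - k%:R)) / (a.1.1%:R - k%:R)), (p.2 / b.1.2%:R).
  split.
  - by rewrite divr_gt0 //; lra.
  - by rewrite divr_ge0 // ltW.
  - by rewrite -ltrBrDr ltr_pdivrMr //; lra.
  - by field; rewrite ?gt_eqF //; apply/andP; split; rewrite gt_eqF.
  - by rewrite divfK // gt_eqF.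
split=> // p /par [la [mu [la0 mu0 lm p1 p2]]].
have [_ _] := side_shadow sf (ltW la0) mu0 lm.
by rewrite -p1 -p2; case: (p).
Qed.

Lemma left_triangle a b al : side_facts (-1) a b al ->
  triangle a.1.1%:R k%:R b.1.1%:R b.1.2%:R `<=` shadow G P /\
  forall p, triangle a.1.1%:R k%:R b.1.1%:R b.1.2%:R p -> exists la mu,
    [/\ 0 < la, 0 <= mu, la + mu < 1,
        p.1 = k%:R + la * (a.1.1%:R - k%:R) + mu * (b.1.1%:R - k%:R) & p.2 = mu * b.1.2%:R].
Proof.
move=> sf; have [[aA bA aY aX bY] _] := sf.
have bY' : 0 < b.1.2%:R :> R by rewrite ltr0n.
have {}aX : 0 < k%:R - a.1.1%:R :> R by lra.
have par p : triangle a.1.1%:R k%:R b.1.1%:R b.1.2%:R p -> exists la mu,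
    [/\ 0 < la, 0 <= mu, la + mu < 1,
        p.1 = k%:R + la * (a.1.1%:R - k%:R) + mu * (b.1.1%:R - k%:R) & p.2 = mu * b.1.2%:R].
  move=> [y0 yh h1 h2]; exists ((k%:R + p.2 / b.1.2%:R * (b.1.1%:R - k%:R) - p.1) / (k%:R - a.1.1%:R)), (p.2 / b.1.2%:R).
  split.
  - by rewrite divr_gt0 //; lra.
  - by rewrite divr_ge0 // ltW.
  - by rewrite -ltrBrDr ltr_pdivrMr //; lra.
  - by field; rewrite ?gt_eqF //; apply/andP; split; rewrite gt_eqF.
  - by rewrite divfK // gt_eqF.
split=> // p /par [la [mu [la0 mu0 lm p1 p2]]].
have [_ _] := side_shadow sf (ltW la0) mu0 lm.
by rewrite -p1 -p2; case: (p).
Qed.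

Lemma shadow_right a b al x : side_facts 1 a b al -> shadow G P (x, 0) -> x < a.1.1%:R.
Proof.
move=> [_ [_ [_ ax _]]] [z [/= K nG]]; rewrite ltNge; apply/negP => h.
by apply: nG; apply: (ax x z K); rewrite !mul1r lerD2r.
Qed.

Lemma shadow_left a b al x : side_facts (-1) a b al -> shadow G P (x, 0) -> a.1.1%:R < x.
Proof.
move=> [_ [_ [_ ax _]]] [z [/= K nG]]; rewrite ltNge; apply/negP => h.
by apply: nG; apply: (ax x z K); rewrite !mulN1r lerN2 lerD2r.
Qed.

Lemma small1_trace : small1 [set x | shadow G P (x, 0)].
Proof. by apply: small1_fst; exact: (small2_shadow nd P0). Qed.

(** Nothing lies to the left of [P], so one triangle accounts for the whole
    trace. *)
Lemma static_corner : k = 0%N -> exists a b al, side_facts 1 a b al /\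
  [/\ a.1.1%:R * b.1.2%:R <= 2 * area (shadow G P),
      len [set x | shadow G P (x, 0)] <= a.1.1%:R & (0 < a.1.1)%N].
Proof.
move=> k0; have [|a [b [al sf]]] := @side_factsP 1; first by left.
exists a, b, al; split=> //.
have [[aA bA aY aX bY] _] := sf; rewrite mul1r k0 subr0 in aX.
have bY' : 0 < b.1.2%:R :> R by rewrite ltr0n.
have [TS _] := right_triangle sf.
have [sT aT] : small2 (triangle k%:R a.1.1%:R b.1.1%:R b.1.2%:R) /\
    area (triangle k%:R a.1.1%:R b.1.1%:R b.1.2%:R) = (a.1.1%:R - k%:R) * b.1.2%:R / 2.
  by apply: small2_triangle; rewrite ?k0 ?ler0n.
split; last by rewrite -(ltr0n R).
  have := le_area sT (small2_shadow nd P0) TS; rewrite aT k0 subr0.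
  by rewrite ler_pdivrMr // [_ * 2]mulrC.
rewrite -[leRHS]subr0; apply: le_len_itv; rewrite ?ler0n //; first exact: small1_trace.
move=> x Sx; rewrite /= in_itv /= (ltW (shadow_right sf Sx)) andbT.
by have [z [/(pjoin_ge0 nd P0)[]]] := Sx.
Qed.

End side_triangle.
End static.
End triangles.

Section plane_shadow.
Context {R : realType}.
Implicit Types (G : set (R * R * R)) (A : seq (nat * nat * nat)).

Section static.
Variables (G : set (R * R * R)) (A : seq (nat * nat * nat)).
Hypothesis nd : newton_data G A.

(** The bases lie on either side of [k] and have length at least one, while the
    summit of the right-hand triangle is to the left of that of the other. *)
Lemma triangles_meet (k a a' q q' : R) : 1 <= a - k -> 1 <= k - a' -> q < q' ->
  exists2 p, triangle k a q 1 p & triangle a' k q' 1 p.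
Proof.
move=> u1 u1' qq.
have d0 : 0 < q' - q by rewrite subr_gt0.
pose ep := (q' - q + 2)^-1.
have ep0 : 0 < ep by rewrite invr_gt0 addr_gt0.
have epE : ep * (q' - q) = 1 - 2 * ep by rewrite /ep; field; rewrite gt_eqF // addr_gt0.
have ep1 : 0 < ep * (q' - q) by rewrite mulr_gt0.
exists (k + ((q + q') / 2 - k) * ep, ep); rewrite /triangle /= divr1; split.
- exact: ltW.
- by lra.
- by lra.
- have h : 0 <= (a - k - 1) * (1 - ep) by apply: mulr_ge0; lra.
  by lra.
- exact: ltW.
- by lra.
- have h : 0 <= (k - a' - 1) * (1 - ep) by apply: mulr_ge0; lra.
  by lra.
- by lra.
Qed.

(** Two points of [G] at distance one from the plane, [b'] to the left of [b],
    leave between them a wedge of the shadow that is covered neither by a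
    triangle on the left with summit [b'] nor by one on the right with summit
    [b]. *)
Lemma shadow_gap (P b b' : R * R * R) : nonneg3 P -> ~ G P -> P.1.2 = 0 ->
  G b /\ b.1.2 = 1 -> G b' /\ b'.1.2 = 1 -> b'.1.1 < b.1.1 ->
  exists B, [/\ small2 B, B `<=` shadow G P, 0 < area B &
    forall p, B p -> P.1.1 + (b'.1.1 - P.1.1) * p.2 < p.1 < P.1.1 + (b.1.1 - P.1.1) * p.2].
Proof.
move=> P0 PG Py [Gb by1] [Gb' by1'] qq.
have [s ps Es] := newton_hpoly nd.
have [a0 a0s a0P] : exists2 a0, a0 \in s & ev a0 P < 1.
  by apply: notin_hpoly => //; rewrite -Es.
have Gev v : G v -> 1 <= ev a0 v by rewrite Es => -[_]; exact.
have evb := Gev _ Gb; have evb' := Gev _ Gb'.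
have p0 : 0 <= ev a0 P by apply: ev_ge0 => //; exact: ps.
have D0 : 0 < ev a0 b + ev a0 b' by rewrite addr_gt0 // (lt_le_trans ltr01).
pose de := (1 - ev a0 P) / (ev a0 b + ev a0 b').
have de0 : 0 < de by rewrite divr_gt0 ?subr_gt0.
have deE : de * (ev a0 b + ev a0 b') = 1 - ev a0 P by rewrite divfK ?gt_eqF.
have sS := small2_shadow nd P0.
apply: (@wedge_area_gt0 R _ P.1.1 (b.1.1 - P.1.1) (b'.1.1 - P.1.1) (Num.min 1 de)) => //.
- by rewrite ltrD2r.
- by rewrite lt_min ltr01.
move=> x y /andP[y0]; rewrite lt_min => /andP[y1 yde] /andP[x1 x2].
have d0 : 0 < (b.1.1 - b'.1.1) * y by rewrite mulr_gt0 // subr_gt0.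
have e2 : y * (ev a0 b + ev a0 b') < 1 - ev a0 P by rewrite -deE ltr_pM2r.
clear de0 deE yde de.
pose ta := (x - P.1.1 - (b'.1.1 - P.1.1) * y) / ((b.1.1 - b'.1.1) * y).
have taE : ta * ((b.1.1 - b'.1.1) * y) = x - P.1.1 - (b'.1.1 - P.1.1) * y by rewrite divfK ?gt_eqF.
have ta0 : 0 <= ta.
  by rewrite divr_ge0 ?(ltW d0) // -addrA -opprD subr_ge0 ltW.
have ta1 : ta <= 1 by rewrite ler_pdivrMr // mul1r; clear -x2; lra.
move: ta taE ta0 ta1 => ta taE ta0 ta1.
have la0 : 0 <= ta * y by rewrite mulr_ge0 // ltW.
have mu0 : 0 <= (1 - ta) * y by rewrite mulr_ge0 ?subr_ge0 // ltW.
pose v := bary P b b' (ta * y) ((1 - ta) * y).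
have Kv : pjoin G P v.
  apply: (pjoin_bary nd P0) => //; do ?exact: pjoin_sub.
  by rewrite -mulrDl subrKC mul1r ltW.
have vx : v.1.1 = x.
  rewrite /v /=.
  have -> : P.1.1 + ta * y * (b.1.1 - P.1.1) + (1 - ta) * y * (b'.1.1 - P.1.1) =
    P.1.1 + (b'.1.1 - P.1.1) * y + ta * ((b.1.1 - b'.1.1) * y) by ring.
  by rewrite taE; ring.
have vy : v.1.2 = y by rewrite /v /= by1 by1' Py; ring.
exists v.2; rewrite -vx -vy; have -> : (v.1.1, v.1.2, v.2) = v by exact: eq3.
split=> // /Gev; rewrite /v ev_bary.
have := mulr_ge0 (ltW y0) p0.
have := mulr_ge0 mu0 (le_trans ler01 evb).
have := mulr_ge0 la0 (le_trans ler01 evb').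
by clear -e2; lra.
Qed.

(** On each side of [P] the shadow contains a triangle of height at least one
    whose base is at least as long as the trace on that side, and the two
    triangles are disjoint. In case of equality both heights are one and the
    triangles fill the shadow, so their summits coincide: otherwise they would
    overlap or leave a wedge uncovered. *)
Lemma static_middle (k : nat) (t : R) (P := (k%:R, 0, t) : R * R * R) :
  (0 < k)%N -> 0 < t -> ~ G P ->
  len [set x | shadow G P (x, 0)] <= 2 * area (shadow G P) /\
  (2 * area (shadow G P) <= len [set x | shadow G P (x, 0)] -> exists Q, apex_y G P Q).
Proof.
move=> k0 tP PG.
have P0 : nonneg3 P by split; rewrite /= ?ler0n // ltW.
have [|a [b [al sf]]] := @side_factsP R G A nd k t tP PG 1; first by left.
have [|a' [b' [al' sf']]] := @side_factsP R G A nd k t tP PG (-1); first by right.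
have [[aA bA aY aX bY] [[al0 eva evb alG strict] _]] := sf.
have [[aA' bA' aY' aX' bY'] [[al0' eva' evb' alG' strict'] _]] := sf'.
rewrite mul1r in aX.
have {}aX' : 0 < k%:R - a'.1.1%:R :> R by lra.
have h0 : 0 < b.1.2%:R :> R by rewrite ltr0n.
have h0' : 0 < b'.1.2%:R :> R by rewrite ltr0n.
have [TS par] := right_triangle nd tP sf; have [TS' par'] := left_triangle nd tP sf'.
set T := triangle _ _ _ _ in TS par; set T' := triangle _ _ _ _ in TS' par'.
have [sT aT] : small2 T /\ area T = (a.1.1%:R - k%:R) * b.1.2%:R / 2.
  by apply: small2_triangle; rewrite ?ler0n //; lra.
have [sT' aT'] : small2 T' /\ area T' = (k%:R - a'.1.1%:R) * b'.1.2%:R / 2.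
  by apply: small2_triangle; rewrite ?ler0n //; lra.
have sS := small2_shadow nd P0.
(* over a common point both faces have the same height, whereas a is strictly
   above the second one *)
have TT : T `&` T' = set0.
  apply/seteqP; split => // p [/par [la [mu [la0 mu0 lm x1 y1]]]].
  move=> /par' [la' [mu' [la0' mu0' lm' x2 y2]]].
  have [K E _] := side_shadow nd tP sf (ltW la0) mu0 lm.
  have [K' E' _] := side_shadow nd tP sf' (ltW la0') mu0' lm'.
  set v := bary _ _ _ la mu in K E; set v' := bary _ _ _ la' mu' in K' E'.
  have vx : v.1.1 = v'.1.1 by rewrite /v /v' /= -x1 -x2.
  have vy : v.1.2 = v'.1.2.
    by rewrite /v /v' /= aY aY' !subr0 !mulr0 !add0r -y1 -y2.
  have h1 := pjoin_side al0 alG K'; have h2 := pjoin_side al0' alG' K.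
  have [_ _ c3] := al0; have [_ _ c3'] := al0'.
  have vz : v.2 = v'.2.
    move: h1 h2; rewrite -E -E' /ev vx vy !lerD2l !ler_pM2l // => h1 h2.
    by apply/eqP; rewrite eq_le h1 h2.
  have vv : v = v' by exact: eq3.
  have : ev al' v = ev al' P by rewrite vv.
  rewrite /v ev_bary => h.
  have s1 : ev al' P < ev al' (emb a) by apply: strict' => //; rewrite mulN1r oppr_le0 ltW.
  have s2 : ev al' P <= ev al' (emb b) by apply: alG'; exact: (newton_gen nd).
  have : 0 < la * (ev al' (emb a) - ev al' P) by rewrite mulr_gt0 // subr_gt0.
  have : 0 <= mu * (ev al' (emb b) - ev al' P) by rewrite mulr_ge0 // subr_ge0.
  by rewrite -addrA in h; move/eqP: h; rewrite -subr_eq0 addrC addrK => /eqP h; clear -h; lra.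
have TU : T `|` T' `<=` shadow G P by move=> p [/TS|/TS'].
have sTU : small2 (T `|` T') by exact: small2U.
have aTU : area (T `|` T') = (a.1.1%:R - k%:R) * b.1.2%:R / 2 + (k%:R - a'.1.1%:R) * b'.1.2%:R / 2.
  by rewrite areaU // aT aT'.
have lenS : len [set x | shadow G P (x, 0)] <= a.1.1%:R - a'.1.1%:R.
  apply: le_len_itv; rewrite ?ler0n //; [by clear -aX aX'; lra|exact: (small1_trace nd k tP)|].
  move=> x Sx; rewrite /= in_itv /=.
  by rewrite (ltW (shadow_right sf Sx)) (ltW (shadow_left sf' Sx)).
have aS := le_area sTU sS TU; rewrite aTU in aS.
have h1 : 1 <= b.1.2%:R :> R by rewrite ler1n.
have h1' : 1 <= b'.1.2%:R :> R by rewrite ler1n.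
have lenS' : len [set x | shadow G P (x, 0)] <= (a.1.1%:R - k%:R) + (k%:R - a'.1.1%:R).
  by apply: (le_trans lenS); rewrite addrA subrK.
have [le2 eq2] := two_triangles aX aX' h1 h1' aS lenS'.
split=> // /eq2[hb hb' aSE]; rewrite -aTU in aSE.
have bx : b.1.1%:R = b'.1.1%:R :> R.
  apply/eqP; rewrite eq_le; apply/andP; split; rewrite leNgt; apply/negP => qq.
    have [|||B [sB BS aB hB]] := @shadow_gap P (emb b) (emb b') P0 PG erefl.
    - by split; [exact: (newton_gen nd)|].
    - by split; [exact: (newton_gen nd)|].
    - by [].
    have BT : (T `|` T') `&` B = set0.
      apply/seteqP; split=> // p [[Tp|Tp] /hB /andP[k1 k2]].
        have [_ _ t1 _] := Tp; rewrite hb divr1 in t1.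
        have k2' : p.1 < k%:R + (b.1.1%:R - k%:R) * p.2 := k2.
        by have := lt_trans t1 k2'; rewrite ltxx.
      have [_ _ _ t1] := Tp; rewrite hb' divr1 in t1.
      have k1' : k%:R + (b'.1.1%:R - k%:R) * p.2 < p.1 := k1.
      by have := lt_trans t1 k1'; rewrite ltxx.
    have US : (T `|` T') `|` B `<=` shadow G P by move=> p [/TU|/BS].
    have := le_trans (le_area (small2U sTU sB) sS US) aSE; rewrite areaU //.
    by rewrite gerDl leNgt aB.
  have u1 : 1 <= a.1.1%:R - k%:R :> R.
    by rewrite lerBrDl natr1 ler_nat -(ltr_nat R) -subr_gt0.
  have u1' : 1 <= k%:R - a'.1.1%:R :> R.
    by rewrite lerBrDl natr1 ler_nat -(ltr_nat R) -subr_gt0.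
  have [p Tp Tp'] := triangles_meet u1 u1' qq.
  by rewrite -[False]/(set0 p) -TT; split; rewrite /T /T' ?hb ?hb'.
have bz : b.2%:R = b'.2%:R :> R.
  have [_ _ c3] := al0; have [_ _ c3'] := al0'.
  have g1 := alG _ (newton_gen nd bA'); have g2 := alG' _ (newton_gen nd bA).
  move: g1 g2; rewrite -evb -evb' /ev /= -bx hb hb' !lerD2l !ler_pM2l // => g1 g2.
  by apply/eqP; rewrite eq_le g1 g2.
have bb : emb b = emb b' :> R * R * R by apply: eq3; rewrite /= ?hb ?hb'.
exists (emb b); split => //; first exact: (newton_gen nd).
move=> v Gv.
have v0 := newton_ge0 nd Gv.
have [c1 c2 c3] := al0; have [c1' c2' c3'] := al0'.
have ga := alG _ Gv; have ga' := alG' _ Gv.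
rewrite -bb in evb'.
pose w := v.1.1 - k%:R - v.1.2 * (b.1.1%:R - k%:R).
have [w0|w0] := leP 0 w.
  exists (emb a), (w / (a.1.1%:R - k%:R)); split.
  - exact: (newton_gen nd).
  - by rewrite /= aY.
  - by rewrite divr_ge0 // ltW.
  - have wE : w / (a.1.1%:R - k%:R) * (a.1.1%:R - k%:R) = w by rewrite divfK // gt_eqF.
    move: (w / _) wE => la wE.
    have E : ev al (bary P (emb b) (emb a) v.1.2 la) = ev al P.
      by rewrite ev_bary eva evb !subrr !mulr0 !addr0.
    have X1 : (bary P (emb b) (emb a) v.1.2 la).1.1 = v.1.1 by rewrite /= wE /w; ring.
    have Y1 : (bary P (emb b) (emb a) v.1.2 la).1.2 = v.1.2.
      by rewrite /= aY hb; ring.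
    split; rewrite ?X1 ?Y1 //.
    by move: ga; rewrite -E /ev X1 Y1 !lerD2l ler_pM2l.
have aXN : a'.1.1%:R - k%:R < 0 :> R by rewrite -oppr_gt0 opprB.
exists (emb a'), (w / (a'.1.1%:R - k%:R)); split.
- exact: (newton_gen nd).
- by rewrite /= aY'.
- by rewrite -mulrNN -invrN divr_ge0 // ?oppr_ge0 (ltW w0, ltW aXN).
- have wE : w / (a'.1.1%:R - k%:R) * (a'.1.1%:R - k%:R) = w by rewrite divfK // lt_eqF.
  move: (w / _) wE => la wE.
  have E : ev al' (bary P (emb b) (emb a') v.1.2 la) = ev al' P.
    by rewrite ev_bary eva' evb' !subrr !mulr0 !addr0.
  have X1 : (bary P (emb b) (emb a') v.1.2 la).1.1 = v.1.1 by rewrite /= wE /w; ring.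
  have Y1 : (bary P (emb b) (emb a') v.1.2 la).1.2 = v.1.2.
    by rewrite /= aY' hb; ring.
  split; rewrite ?X1 ?Y1 //.
  by move: ga'; rewrite -E /ev X1 Y1 !lerD2l ler_pM2l.
Qed.
End static.
End plane_shadow.

(** * Shadows seen from a point of a coordinate axis *)

Section axis_shadow.
Context {R : realType}.
Local Notation mu2 := ((@lebesgue_measure R \x @lebesgue_measure R)%E).
Implicit Types (G : set (R * R * R)) (A : seq (nat * nat * nat)).

Lemma ev_sw12 (a p : R * R * R) : ev (sw12 a) (sw12 p) = ev a p.
Proof. by rewrite /ev /=; ring. Qed.

Lemma shadow_sw12 G (P : R * R * R) :
  shadow (sw12 @^-1` G) (sw12 P) = [set p | shadow G P (p.2, p.1)].
Proof.
by rewrite /shadow pjoin_sw12; apply/seteqP; split=> -[x y] [z h]; exists z.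
Qed.

Lemma small2_swap (S : set (R * R)) : small2 S ->
  small2 [set p | S (p.2, p.1)] /\ area [set p | S (p.2, p.1)] = area S.
Proof.
move=> [mS [M hM]]; have [mS' aS] := lebesgue2_swap mS; split; last first.
  by rewrite /area aS.
by split=> //; exists M => -[x y] /hM[].
Qed.

(** The slope [n / n3] is at most [m / m3]. *)
Lemma slope_compare (m m3 n n3 u zu w zw : R) : 0 < m3 -> 0 < n3 -> 0 < u -> 0 <= w ->
  m * w + m3 * zw = 0 -> 0 <= m * u + m3 * zu -> n * u + n3 * zu = 0 -> n * w + n3 * zw <= 0.
Proof.
move=> m30 n30 u0 w0 e1 e2 e3.
have h : 0 <= m * n3 - n * m3.
  rewrite -(pmulr_rge0 _ u0).
  have -> : u * (m * n3 - n * m3) = n3 * (m * u + m3 * zu) - m3 * (n * u + n3 * zu) by ring.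
  by rewrite e3 mulr0 subr0 mulr_ge0 // ltW.
rewrite -(pmulr_rle0 _ m30).
have -> : m3 * (n * w + n3 * zw) = - (w * (m * n3 - n * m3)) + n3 * (m * w + m3 * zw) by ring.
by rewrite e1 mulr0 addr0 oppr_le0 mulr_ge0.
Qed.

Lemma ev_sub (al v w : R * R * R) : ev al v - ev al w =
  al.1.1 * (v.1.1 - w.1.1) + al.1.2 * (v.1.2 - w.1.2) + al.2 * (v.2 - w.2).
Proof. by rewrite /ev; ring. Qed.

Definition apex_x G (P Q : R * R * R) := apex_y (sw12 @^-1` G) (sw12 P) (sw12 Q).

(** The shape of the equality case: a lattice apex on one of the two planes
    through [P], lower than [P]. When [t] is [1], the apex is a unit vector. *)
Definition low_apex G A (t : R) (P : R * R * R) := exists2 q, q \in A & q.2%:R < t /\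
  (apex_y G P (emb q) /\ q.1.1 = 0%N \/ apex_x G P (emb q) /\ q.1.2 = 0%N).

(** The triangles that two edges of a convex chain span with the origin can only
    meet if the edges lie on one line, which is excluded when [b] is taken as
    far as possible along its edge. *)
Lemma crossing (ax bx by1 ay cx cy la mu la2 mu2 : R) :
  0 < ax -> 0 < bx -> 0 < by1 -> 0 < ay -> 0 < cx -> 0 < cy ->
  0 < la -> 0 < mu -> la + mu < 1 -> 0 < la2 -> 0 < mu2 -> la2 + mu2 < 1 ->
  la * ax + mu * bx = mu2 * cx -> mu * by1 = la2 * ay + mu2 * cy ->
  0 <= - ax * by1 - (bx - ax) * ay -> 0 <= (cx - ax) * by1 - (bx - ax) * cy ->
  0 <= - ay * cx - (cy - ay) * ax -> 0 <= (by1 - ay) * cx - (cy - ay) * bx ->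
  (- ax * by1 - (bx - ax) * ay = 0 -> ay <= by1) -> False.
Proof.
move=> ax0 bx0 by0 ay0 cx0 cy0 la0 mu0 lm la20 mu20 lm2 xx yy p1 p2 q1 q2 p1e.
have X : (la + mu - la2 - mu2) * (ax * by1) =
    la2 * (- ax * by1 - (bx - ax) * ay) + mu2 * ((cx - ax) * by1 - (bx - ax) * cy).
  have : (la * ax + mu * bx - mu2 * cx) * by1 = 0 by rewrite xx subrr mul0r.
  have : (mu * by1 - la2 * ay - mu2 * cy) * (bx - ax) = 0 by rewrite yy -addrA -opprD subrr mul0r.
  by lra.
have Y' : (la2 + mu2 - la - mu) * (ay * cx) =
    la * (- ay * cx - (cy - ay) * ax) + mu * ((by1 - ay) * cx - (cy - ay) * bx).
  have : (la * ax + mu * bx - mu2 * cx) * (cy - ay) = 0 by rewrite xx subrr mul0r.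
  have : (mu * by1 - la2 * ay - mu2 * cy) * cx = 0 by rewrite yy -addrA -opprD subrr mul0r.
  by lra.
have u1 : 0 <= la2 * (- ax * by1 - (bx - ax) * ay) by rewrite mulr_ge0 // ltW.
have u2 : 0 <= mu2 * ((cx - ax) * by1 - (bx - ax) * cy) by rewrite mulr_ge0 // ltW.
have : 0 <= (la2 + mu2 - la - mu) * (ay * cx).
  by rewrite Y' addr_ge0 // mulr_ge0 // ltW.
rewrite pmulr_lge0 ?mulr_gt0 // => d.
have d' : la + mu - la2 - mu2 <= 0 by clear -d; lra.
have w : (la + mu - la2 - mu2) * (ax * by1) <= 0 by rewrite mulr_le0_ge0 // ltW // mulr_gt0.
have : la2 * (- ax * by1 - (bx - ax) * ay) = 0 by clear -w u1 u2 X; lra.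
move/eqP; rewrite mulf_eq0 gt_eqF //= => /eqP e0.
have h := p1e e0.
have : 0 < bx * ay by rewrite mulr_gt0.
have : 0 <= ax * (by1 - ay) by rewrite mulr_ge0 ?subr_ge0 // ltW.
by clear -e0; lra.
Qed.

Section corner.
Variables (G : set (R * R * R)) (A : seq (nat * nat * nat)).
Hypothesis nd : newton_data G A.
Variable t : R.
Hypotheses (t0 : 0 < t) (PG : ~ G (0, 0, t)).
Let P : R * R * R := (0, 0, t).
Let P0 : nonneg3 P. Proof. by split; rewrite /= ?lexx // ltW. Qed.
Let lx := len [set x | shadow G P (x, 0)].
Let ly := len [set y | shadow G P (0, y)].

Lemma corner_x : exists a b al, side_facts G A 0 t 1 a b al /\
  [/\ a.1.1%:R * b.1.2%:R <= 2 * area (shadow G P), lx <= a.1.1%:R & (0 < a.1.1)%N].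
Proof. exact: (@static_corner R G A nd 0%N t t0 PG erefl). Qed.

(** The edge that leaves the plane of equation [x = 0], described as
    [side_facts] describes the edge that leaves the plane of equation [y = 0]. *)
Definition corner_edge a b (al : R * R * R) :=
  [/\ a \in A, b \in A, (0 < a.1.2)%N & (0 < b.1.1)%N] /\
  [/\ a.1.1 = 0%N, pos3 al, ev al (emb a) = ev al P, ev al (emb b) = ev al P &
      forall v, G v -> ev al P <= ev al v] /\
  forall c, c \in A -> ev al (emb c) = ev al P ->
     0 <= (c.1.2%:R - a.1.2%:R) * b.1.1%:R - (b.1.2%:R - a.1.2%:R) * c.1.1%:R :> R.

Lemma corner_y : exists a b al, corner_edge a b al /\
  [/\ a.1.2%:R * b.1.1%:R <= 2 * area (shadow G P), ly <= a.1.2%:R &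
   exists T, [/\ small2 T, T `<=` shadow G P, area T = a.1.2%:R * b.1.1%:R / 2 &
   forall p, T p -> exists la mu, [/\ 0 < la, 0 <= mu, la + mu < 1,
     p.1 = mu * b.1.1%:R & p.2 = la * a.1.2%:R + mu * b.1.2%:R]]].
Proof.
have nd' := newton_data_sw12 nd.
have PG' : ~ (sw12 @^-1` G) (0%N%:R, 0, t) by rewrite mulr0n.
have [a [b [al [sf [h1 h2 h3]]]]] := static_corner nd' t0 PG' erefl.
have [TS par] := right_triangle nd' t0 sf.
have [[aA bA aY aX bY] [[al0 eva evb alG strict] [_ _ hpsi]]] := sf.
have mS : small2 (shadow G P) by exact: (small2_shadow nd P0).
have ES : shadow (sw12 @^-1` G) (0%N%:R, 0, t) = [set p | shadow G P (p.2, p.1)].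
  by rewrite -shadow_sw12.
have [_ aS] := small2_swap mS.
have inA c : c \in map sw12 A -> sw12 c \in A by move=> /mapP[d dA ->]; rewrite sw12K.
have evP : ev (sw12 al) P = ev al (0%N%:R, 0, t).
  by rewrite -[LHS]ev_sw12 sw12K.
exists (sw12 a), (sw12 b), (sw12 al); split; [split; [|split]|].
- by split; [exact: inA|exact: inA|exact: h3|exact: bY].
- split; [exact: aY|by case: al0| | |].
  + by rewrite evP -eva -[LHS]ev_sw12 sw12K.
  + by rewrite evP -evb -[LHS]ev_sw12 sw12K.
  + move=> v Gv; rewrite evP -[leRHS]ev_sw12 sw12K; apply: alG.
    by rewrite /= sw12K.
- move=> c cA; rewrite evP => ec; have [] := hpsi (sw12 c) (map_f _ cA).
    by rewrite -ec -[LHS]ev_sw12.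
  by move=> h _; move: h; rewrite !mul1r.
- rewrite /= ES aS in h1 *.
  split=> //.
    by rewrite /ly; move: h2; rewrite ES.
  have [sT aT] : small2 (triangle (0%N%:R : R) a.1.1%:R b.1.1%:R b.1.2%:R) /\
     area (triangle (0%N%:R : R) a.1.1%:R b.1.1%:R b.1.2%:R) = (a.1.1%:R - 0%N%:R) * b.1.2%:R / 2 :> R.
    by apply: small2_triangle; rewrite ?ler0n ?ltr0n.
  have [sT' aT'] := small2_swap sT.
  eexists; split; first exact: sT'.
  + by move=> [x y] /TS; rewrite ES.
  + by rewrite aT' aT mulr0n subr0.
  + move=> [x y] /par[la [mu [la0 mu0 lm]]] /=; rewrite mulr0n !subr0 add0r => p1 p2.
    by exists la, mu; split; [exact: la0|exact: mu0|exact: lm|exact: p2|exact: p1].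
Qed.

(** An edge from one coordinate plane to the other gives a right triangle with
    integer legs [X] and [Y], for which [X * Y >= X + Y - 1]. Equality holds
    when one leg is [1], and the end of that leg is the apex. *)
Lemma corner_flat p q al : p \in A -> q \in A -> p.1.2 = 0%N -> q.1.1 = 0%N ->
  (0 < p.1.1)%N -> (0 < q.1.2)%N -> pos3 al ->
  ev al (emb p) = ev al P -> ev al (emb q) = ev al P ->
  (forall v, G v -> ev al P <= ev al v) ->
  p.1.1%:R * q.1.2%:R <= 2 * area (shadow G P) -> lx <= p.1.1%:R -> ly <= q.1.2%:R ->
  lx + ly - 1 <= 2 * area (shadow G P) /\
  (2 * area (shadow G P) <= lx + ly - 1 -> low_apex G A t P).
Proof.
move=> pA qA py qx px qy [al1 al2 al3] evp evq alG harea hx hy.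
have Gp := newton_gen nd pA; have Gq := newton_gen nd qA.
have X1 : 1 <= p.1.1%:R :> R by rewrite ler1n.
have Y1 : 1 <= q.1.2%:R :> R by rewrite ler1n.
have X0 : 0 < p.1.1%:R :> R by rewrite ltr0n.
have Y0 : 0 < q.1.2%:R :> R by rewrite ltr0n.
have XY : 0 <= (p.1.1%:R - 1) * (q.1.2%:R - 1) :> R by rewrite mulr_ge0 ?subr_ge0.
have zlt c : c \in A -> ev al (emb c) = ev al P -> (0 < c.1.1)%N || (0 < c.1.2)%N -> c.2%:R < t.
  move=> cA /eqP; rewrite -subr_eq0 ev_sub /= !subr0 => /eqP e c0.
  rewrite -subr_lt0 -(pmulr_rlt0 _ al3).
  have -> : al.2 * (c.2%:R - t) = - (al.1.1 * c.1.1%:R + al.1.2 * c.1.2%:R).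
    by apply/eqP; rewrite -subr_eq0 opprK addrC; exact/eqP.
  rewrite oppr_lt0; have := c0; rewrite -!(ltr0n R) => /orP[c1|c1].
    by rewrite ltr_wpDr ?mulr_gt0 // mulr_ge0 ?ler0n // ltW.
  by rewrite ltr_wpDl ?mulr_gt0 // mulr_ge0 ?ler0n // ltW.
have below v : G v ->
    le3 (bary P (emb p) (emb q) (v.1.1 / p.1.1%:R) (v.1.2 / q.1.2%:R)) v.
  move=> Gv; set w := bary _ _ _ _ _.
  have ew : ev al w = ev al P by rewrite ev_bary evp evq !subrr !mulr0 !addr0.
  have wx : w.1.1 = v.1.1.
    by rewrite /w /= qx mulr0n !subr0 mulr0 addr0 add0r divfK // gt_eqF.
  have wy : w.1.2 = v.1.2.
    by rewrite /w /= py mulr0n !subr0 mulr0 addr0 add0r divfK // gt_eqF.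
  split; rewrite ?wx ?wy //.
  by move: (alG _ Gv); rewrite -ew /ev wx wy !lerD2l ler_pM2l.
have v0 v : G v -> 0 <= v.1.1 / p.1.1%:R /\ 0 <= v.1.2 / q.1.2%:R.
  by move=> /(newton_ge0 nd)[v1 v2 _]; split; rewrite divr_ge0 // ltW.
split; first by clear -XY harea hx hy; lra.
move=> eqn.
have : (p.1.1%:R - 1) * (q.1.2%:R - 1) = 0 :> R by clear -XY harea hx hy eqn; lra.
move/eqP; rewrite mulf_eq0 !subr_eq0 => /orP[/eqP E|/eqP E].
  exists p => //; split; first by apply: zlt; rewrite ?px.
  right; split=> //; split; [by rewrite /= sw12K|exact: E|].
  move=> v Gv; exists (sw12 (emb q)), (v.1.1 / q.1.2%:R); split.
  - by rewrite /= sw12K.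
  - by rewrite /= qx.
  - by have [] := v0 _ Gv.
  - have [b1 b2 b3] := below _ Gv; rewrite E divr1 in b1 b2 b3.
    by split; [exact: b2|exact: b1|exact: b3].
exists q => //; split; first by apply: zlt; rewrite ?qy ?orbT.
left; split=> //; split; [by []|exact: E|].
move=> v Gv; exists (emb p), (v.1.1 / p.1.1%:R); split.
- by [].
- by rewrite /= py.
- by have [] := v0 _ Gv.
- have [b1 b2 b3] := below _ Gv; rewrite E divr1 in b1 b2 b3.
  have sE (x y z : R) : x + y + z = x + z + y by rewrite addrAC.
  by split; rewrite /= sE.
Qed.

(** The edges that leave the two coordinate planes either reach the other plane,
    where [corner_flat] applies, or bound disjoint triangles of the shadow. *)
Lemma static_two_sides : lx + ly - 1 <= 2 * area (shadow G P) /\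
  (2 * area (shadow G P) <= lx + ly - 1 -> low_apex G A t P).
Proof.
have [a [b [al [sf [h1 h2 h3]]]]] := corner_x.
have [a2 [b2 [al2 [[[a2A b2A a2Y b2X] [[a2X al20 eva2 evb2 al2G] psi2]] [k1 k2 [T2 [sT2 T2S aT2 par2]]]]]]] := corner_y.
have [[aA bA aY _ bY] [[al0 eva evb alG _] [_ _ psi]]] := sf.
have Gg := newton_gen nd.
have [al1 al2' al3] := al0; have [be1 be2 be3] := al20.
have bY' : 0 < b.1.2%:R :> R by rewrite ltr0n.
have aX' : 0 < a.1.1%:R :> R by rewrite ltr0n.
have a2Y' : 0 < a2.1.2%:R :> R by rewrite ltr0n.
have b2X' : 0 < b2.1.1%:R :> R by rewrite ltr0n.
have [bx|bx] := posnP b.1.1.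
  apply: (corner_flat aA bA aY bx h3 bY al0 eva evb alG h1 h2).
  apply: (le_trans k2).
  have : ev al2 (emb b) = ev al2 P.
    apply/eqP; rewrite eq_le al2G ?andbT; last exact: Gg.
    rewrite -subr_le0 ev_sub /= bx mulr0n !subr0 mulr0 add0r.
    have := alG _ (Gg _ a2A); rewrite -subr_ge0 ev_sub /= a2X mulr0n !subr0 mulr0 add0r.
    move/eqP: eva2; rewrite -subr_eq0 ev_sub /= a2X mulr0n !subr0 mulr0 add0r.
    move/eqP: evb; rewrite -subr_eq0 ev_sub /= bx mulr0n !subr0 mulr0 add0r.
    by move=> /eqP e1 /eqP e2 e3; exact: (slope_compare al3 be3 a2Y' (ltW bY') e1 e3 e2).
  by move=> /(psi2 _ bA); rewrite bx mulr0n mulr0 subr0 pmulr_lge0 // subr_ge0.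
have [by2|by2] := posnP b2.1.2.
  rewrite mulrC in k1; apply: (corner_flat b2A a2A by2 a2X b2X a2Y al20 evb2 eva2 al2G k1 _ k2).
  apply: (le_trans h2).
  have : ev al (emb b2) = ev al P.
    apply/eqP; rewrite eq_le alG ?andbT; last exact: Gg.
    rewrite -subr_le0 ev_sub /= by2 mulr0n !subr0 mulr0 addr0.
    have := al2G _ (Gg _ aA); rewrite -subr_ge0 ev_sub /= aY mulr0n !subr0 mulr0 addr0.
    move/eqP: eva; rewrite -subr_eq0 ev_sub /= aY mulr0n !subr0 mulr0 addr0.
    move/eqP: evb2; rewrite -subr_eq0 ev_sub /= by2 mulr0n !subr0 mulr0 addr0.
    by move=> /eqP e1 /eqP e2 e3; exact: (slope_compare be3 al3 aX' (ltW b2X') e1 e3 e2).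
  by move=> /(psi _ b2A)[+ _]; rewrite !mul1r by2 mulr0n mulr0 subr0 pmulr_lge0 // subr_ge0.
suff : a.1.1%:R + a2.1.2%:R <= 2 * area (shadow G P).
  by move: (area _) h2 k2 => S h2 k2 h; clear -h h2 k2; split; lra.
have PG' : ~ G (0%N%:R, 0, t) by [].
have [TS par] := right_triangle nd t0 sf.
set T := triangle _ _ _ _ in TS par.
have [sT aT] : small2 T /\ area T = (a.1.1%:R - 0%N%:R) * b.1.2%:R / 2.
  by apply: small2_triangle; rewrite ?ler0n ?ltr0n.
have sS := small2_shadow nd P0.
have TT : T `&` T2 = set0.
  apply/seteqP; split=> // p [/par[la [mu [la0 mu0 lm x1 y1]]]].
  move=> /par2[la2 [mu2 [la20 mu20 lm2 x2 y2]]].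
  have bx' : 0 < b.1.1%:R :> R by rewrite ltr0n.
  have by2' : 0 < b2.1.2%:R :> R by rewrite ltr0n.
  rewrite mulr0n !subr0 add0r in x1.
  have mu2p : 0 < mu2.
    by rewrite -(pmulr_lgt0 _ b2X') -x2 x1 ltr_wpDr ?mulr_gt0 // mulr_ge0 // ltW.
  have mup : 0 < mu.
    by rewrite -(pmulr_lgt0 _ bY') -y1 y2 ltr_wpDr ?mulr_gt0 // mulr_ge0 // ltW.
  have [K E _] := side_shadow nd t0 sf (ltW la0) mu0 lm.
  set v := bary _ _ _ la mu in K E.
  set v2 := bary P (emb a2) (emb b2) la2 mu2.
  have K2 : pjoin G P v2.
    by apply: (pjoin_bary nd P0); rewrite ?(ltW la20) ?(ltW lm2) //; exact/pjoin_sub/Gg.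
  have E2 : ev al2 v2 = ev al2 P by rewrite ev_bary eva2 evb2 !subrr !mulr0 !addr0.
  have vx : v.1.1 = v2.1.1.
    by rewrite /v /v2 /= a2X mulr0n !subr0 mulr0 addr0 !add0r -x2 -x1.
  have vy : v.1.2 = v2.1.2.
    by rewrite /v /v2 /= aY mulr0n !subr0 mulr0 addr0 !add0r -y1 -y2.
  have g1 := pjoin_side al0 alG K2; have g2 := pjoin_side (k := 0) al20 al2G K.
  have vz : v.2 = v2.2.
    have {}g1 : ev al v <= ev al v2 by rewrite E.
    have {}g2 : ev al2 v2 <= ev al2 v by rewrite E2.
    move: g1 g2; rewrite /ev vx vy !lerD2l !ler_pM2l // => g1 g2.
    by apply/eqP; rewrite eq_le g1 g2.
  have vv : v = v2 by exact: eq3.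
  have onb (m n : R) (ga c d : R * R * R) : 0 < m -> 0 < n -> ev ga P <= ev ga c -> ev ga P <= ev ga d ->
      ev ga (bary P c d m n) = ev ga P -> ev ga c = ev ga P /\ ev ga d = ev ga P.
    rewrite ev_bary => m0 n0 gc gd e.
    have mc : 0 <= m * (ev ga c - ev ga P) by rewrite mulr_ge0 ?subr_ge0 // ltW.
    have ndd : 0 <= n * (ev ga d - ev ga P) by rewrite mulr_ge0 ?subr_ge0 // ltW.
    have : m * (ev ga c - ev ga P) = 0 by clear -mc ndd e; lra.
    have : n * (ev ga d - ev ga P) = 0 by clear -mc ndd e; lra.
    by do 2![move=> /eqP; rewrite mulf_eq0 gt_eqF //= subr_eq0 => /eqP ->].
  have [ea ea2] : ev al (emb a2) = ev al P /\ ev al (emb b2) = ev al P.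
    by apply: (onb la2 mu2) => //; [exact/alG/Gg|exact/alG/Gg|rewrite -/v2 -vv].
  have [ea' eb'] : ev al2 (emb a) = ev al2 P /\ ev al2 (emb b) = ev al2 P.
    by apply: (onb la mu) => //; [exact/al2G/Gg|exact/al2G/Gg|rewrite -/v vv].
  have [p1 p1e] := psi _ a2A ea; have [p2 _] := psi _ b2A ea2.
  have q1 := psi2 _ aA ea'; have q2 := psi2 _ bA eb'.
  move: p1 p1e p2 q1 q2; rewrite !mul1r aY a2X mulr0n !sub0r => p1 p1e p2 q1 q2.
  have xx := etrans (esym x1) x2; have yy := etrans (esym y1) y2.
  have {}p1e := fun e => etrans (ler_nat R _ _) (p1e e).
  exact: (crossing aX' bx' bY' a2Y' b2X' by2' la0 mup lm la20 mu2p lm2 xx yy p1 p2 q1 q2 p1e).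
have aTU : area (T `|` T2) = a.1.1%:R * b.1.2%:R / 2 + a2.1.2%:R * b2.1.1%:R / 2.
  have -> : area (T `|` T2) = area T + area T2 by exact: areaU.
  by congr (_ + _); rewrite // aT mulr0n subr0.
have TU : T `|` T2 `<=` shadow G P by move=> p [/TS|/T2S].
have aS := le_area (small2U sT sT2) sS TU; rewrite aTU in aS.
have g1 : 0 <= a.1.1%:R * (b.1.2%:R - 1) :> R.
  by rewrite mulr_ge0 ?ler0n // subr_ge0 ler1n.
have g2 : 0 <= a2.1.2%:R * (b2.1.1%:R - 1) :> R.
  by rewrite mulr_ge0 ?ler0n // subr_ge0 ler1n.
by clear -aS g1 g2; lra.
Qed.

Lemma static_x : lx <= 2 * area (shadow G P).
Proof.
have [a [b [al [[[_ _ _ _ bY] _] [h1 h2 h3]]]]] := corner_x.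
by apply/(le_trans h2)/(le_trans _ h1); rewrite ler_peMr ?ler0n // ler1n.
Qed.

Lemma static_y : ly <= 2 * area (shadow G P).
Proof.
have [a [b [al [[[_ _ _ bX] _] [h1 h2 _]]]]] := corner_y.
by apply/(le_trans h2)/(le_trans _ h1); rewrite ler_peMr ?ler0n // ler1n.
Qed.

End corner.
End axis_shadow.

(** * Half-open pyramids *)

Section pyramids.
Context {R : realType}.
Local Notation mu1 := (@lebesgue_measure R).
Local Notation mu2 := ((@lebesgue_measure R \x @lebesgue_measure R)%E).
Local Notation mu3 := (((@lebesgue_measure R \x @lebesgue_measure R) \x @lebesgue_measure R)%E).
Local Notation R3 := (measurableTypeR R * measurableTypeR R * measurableTypeR R)%type.
Implicit Types (G : set (R * R * R)) (A : seq (nat * nat * nat)).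

Lemma cone_chart_bounds (c q x u e : R) : u < 1 -> c + u * (q - c) <= x ->
  x <= c + u * (q - c) + e * (1 - u) -> c <= cone_chart q x u <= c + e.
Proof.
move=> u1 h1 h2; have d0 : 0 < 1 - u by rewrite subr_gt0.
by rewrite /cone_chart ler_pdivlMr // ler_pdivrMr //; apply/andP; split; lra.
Qed.

(** The ray towards an apex moves by at most [L * e] for parameters close to
    [s]. *)
Lemma ray_drift (c d L s e e1 u x : R) : `|d| <= L -> s <= u <= s + e -> 0 <= e1 ->
  e <= (1 - s) / 2 -> (2 * L + 1) * e <= e1 * (1 - s) / 2 ->
  c + s * d + L * e <= x <= c + s * d + L * e + e ->
  c + u * d <= x /\ x <= c + u * d + e1 * (1 - u).
Proof.
move=> dL /andP[u1 u2] e10 es eL /andP[x1 x2].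
have : `|(u - s) * d| <= L * e.
  by rewrite normrM mulrC; apply: ler_pM; rewrite ?normr_ge0 // ger0_norm ?subr_ge0 // lerBlDl.
rewrite ler_norml => /andP[d1 d2].
have h : e1 * ((1 - s) / 2) <= e1 * (1 - u) by apply: ler_wpM2l => //; lra.
by split; lra.
Qed.

(** The projection onto the plane of equation [y = 0] from an apex [Q] at height
    one. *)
Definition chart_y (Q v : R * R * R) : R * R * R :=
  (cone_chart Q.1.1 v.1.1 v.1.2, 0, cone_chart Q.2 v.2 v.1.2).

Lemma mix_chart_y Q v : Q.1.2 = 1 -> v.1.2 < 1 -> mix v.1.2 (chart_y Q v) Q = v.
Proof.
move=> Qy v1; have d : 1 - v.1.2 != 0 by rewrite gt_eqF // subr_gt0.
by apply: eq3; rewrite /= ?Qy /cone_chart; field.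
Qed.

Lemma chart_mix_y Q b s : Q.1.2 = 1 -> b.1.2 = 0 -> s < 1 -> chart_y Q (mix s b Q) = b.
Proof.
move=> Qy b0 s1; have d : 1 - s != 0 by rewrite gt_eqF // subr_gt0.
have E : (mix s b Q).1.2 = s by rewrite /= b0 Qy mulr0 add0r mulr1.
by apply: eq3; rewrite /chart_y E /= ?b0 // /cone_chart; field.
Qed.

(** A half-open pyramid of height one over the plane of equation [y = 0]. Its
    apex is left out, since it belongs to the polyhedron. *)
Definition cone_y (D : set (R * R * R)) := exists Q, [/\ nonneg3 Q, Q.1.2 = 1 &
  forall v, D v <-> 0 <= v.1.2 < 1 /\ D (chart_y Q v)].

Lemma cone_y_measure (Q : R * R * R) (B : set (R * R)) : small2 B -> nonneg3 Q ->
  let C := [set v : R * R * R | 0 <= v.1.2 < 1 /\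
     B (cone_chart Q.1.1 v.1.1 v.1.2, cone_chart Q.2 v.2 v.1.2)] in
  small3 C /\ 3 * vol C = area B.
Proof.
move=> sB [Q1 _ Q3] C; have [mB [M hM]] := sB.
have [mC eC] := cone_measure3 Q.1.1 Q.2 mB.
have [mC' eC'] := lebesgue3_swap23 mC.
split.
  split; first exact: mC'.
  exists (M + M + Q.1.1 + Q.2 + 1) => x [/andP[x0 x1] /hM[/= /andP[c1 c1'] /andP[c3 c3']]].
  have d0 : 0 < 1 - x.1.2 by rewrite subr_gt0.
  have aux (c q : R) : 0 <= q -> 0 <= cone_chart q c x.1.2 -> cone_chart q c x.1.2 <= M ->
      0 <= c /\ c <= M + q.
    move=> q0; rewrite /cone_chart => g1 g2.
    have ce : c = (1 - x.1.2) * ((c - x.1.2 * q) / (1 - x.1.2)) + x.1.2 * q.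
      by rewrite mulrC divfK ?gt_eqF // subrK.
    have M0 := le_trans g1 g2.
    split; first by rewrite ce; apply: addr_ge0; [exact: (mulr_ge0 (ltW d0) g1)|exact: mulr_ge0].
    rewrite ce; apply: lerD; last by rewrite ler_piMl // ltW.
    apply: le_trans (_ : (1 - x.1.2) * M <= _); first by rewrite ler_wpM2l // ltW.
    by rewrite ler_piMl // gerBl.
  have [g1 g1'] := aux _ _ Q1 c1 c1'; have [g3 g3'] := aux _ _ Q3 c3 c3'.
  have M0 := le_trans c1 c1'.
  clear -M0 Q1 Q3 x0 x1 g1 g1' g3 g3'.
  by split; apply/andP; split; lra.
have eV : mu3 C = (3^-1 * area B)%:E.
  etransitivity; first exact: eC'.
  by rewrite eC EFinM -areaE.
by rewrite /vol eV /= mulrA divff ?mul1r.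
Qed.

Lemma small3_box (w : R * R * R) (e : R) : 0 < e -> nonneg3 w ->
  let B := [set v : R * R * R | w.1.1 <= v.1.1 <= w.1.1 + e /\ w.1.2 <= v.1.2 <= w.1.2 + e /\
    w.2 <= v.2 <= w.2 + e] in small3 B /\ 0 < vol B.
Proof.
move=> e0 [w1 w2 w3] B.
pose I (x : R) := `[x, x + e]%classic : set (measurableTypeR R).
have mI x : measurable (I x) by exact: measurable_itv.
have muI x : mu1 (I x) = e%:E.
  rewrite /I lebesgue_measure_itv /= lte_fin ltrDl e0 -EFinB.
  by congr (_%:E); rewrite addrAC subrr add0r.
have BE : B = I w.1.1 `*` I w.1.2 `*` I w.2.
  apply/seteqP; split=> -[[x y] z]; rewrite /I /B /= !in_itv /=.
    by move=> [-> [-> ->]].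
  by move=> [[-> ->] ->].
have mII : measurable (I w.1.1 `*` I w.1.2) by exact: measurableX.
have mB : measurable (B : set R3) by rewrite BE; exact: measurableX.
split.
  split=> //; exists (w.1.1 + w.1.2 + w.2 + e) => v [/andP[h1 h1'] [/andP[h2 h2'] /andP[h3 h3']]].
  by clear -e0 w1 w2 w3 h1 h1' h2 h2' h3 h3'; split; apply/andP; split; lra.
have e1 : mu2 (I w.1.1 `*` I w.1.2) = (e * e)%:E.
  etransitivity; first exact: (@product_measure1E _ _ _ _ _ mu1 mu1 _ _ (mI _) (mI _)).
  by rewrite EFinM; congr (_ * _)%E; exact: muI.
have e2 : mu3 B = (e * e * e)%:E.
  rewrite BE; etransitivity; first exact: (@product_measure1E _ _ _ _ _ lebesgue2 mu1 _ _ mII (mI _)).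
  by rewrite EFinM; congr (_ * _)%E; [exact: e1|exact: muI].
by rewrite /vol e2 /= !mulr_gt0.
Qed.

Section cone.
Variables (G : set (R * R * R)) (A : seq (nat * nat * nat)).
Hypothesis nd : newton_data G A.
Variable P : R * R * R.
Hypotheses (P0 : nonneg3 P) (PG : ~ G P) (Py : P.1.2 = 0).
Let D := pjoin G P `\` G.

(** Seen from [P], a point [v] of the join is above a combination of [Q] and [c]
    with weights [v.1.2] and [l]. If [v] is outside [G], the sum of the weights
    is less than [1], and projecting from [Q] gives a point above the
    combination of [P] and [c] alone. *)
Lemma apex_y_sub Q v : apex_y G P Q -> D v -> 0 <= v.1.2 < 1 /\ D (chart_y Q v).
Proof.
move=> [GQ Qy hQ] [Kv nG]; have [_ v0 _] := pjoin_ge0 nd P0 Kv.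
have [r [q [/andP[r0 r1] Gq vE]]] := Kv.
have [c [la [Gc cy la0 qw]]] := hQ q Gq.
have vy : v.1.2 = r * q.1.2 by rewrite vE /= Py mulr0 add0r.
have vw : le3 (bary P Q c v.1.2 (r * la)) v.
  case: qw => /= q1 q2 q3; split; rewrite vy ?vE /=.
  - have := ler_wpM2l r0 q1; rewrite -subr_ge0 => e; rewrite -subr_ge0.
    by apply: le_trans e _; rewrite le_eqVlt; apply/orP; left; apply/eqP; ring.
  - have := ler_wpM2l r0 q2; rewrite -subr_ge0 => e; rewrite -subr_ge0.
    by apply: le_trans e _; rewrite Py le_eqVlt; apply/orP; left; apply/eqP; ring.
  - have := ler_wpM2l r0 q3; rewrite -subr_ge0 => e; rewrite -subr_ge0.
    by apply: le_trans e _; rewrite le_eqVlt; apply/orP; left; apply/eqP; ring.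
have l0 : 0 <= r * la by rewrite mulr_ge0.
move: (r * la) l0 vw => l l0 vw.
have ml : v.1.2 + l < 1.
  rewrite ltNge; apply/negP => ml; apply: nG.
  have s0 : 0 < v.1.2 + l by apply: lt_le_trans ml.
  apply: (@pjoin_beyond R G A nd P v (v.1.2 + l)^-1 PG _ Kv).
    by rewrite invr_ge0 (ltW s0) invf_le1.
  have Gw : G (mix (l / (v.1.2 + l)) Q c).
    apply: (newton_mix nd) => //; rewrite divr_ge0 ?(ltW s0) //=.
    by rewrite ler_pdivrMr // mul1r lerDr.
  apply: (newton_up nd Gw).
  have i0 : 0 <= (v.1.2 + l)^-1 by rewrite invr_ge0 ltW.
  have dn : v.1.2 + l != 0 by rewrite gt_eqF.
  case: vw => /= w1 w2 w3; split => /=.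
  - have := ler_wpM2l i0 w1; rewrite -subr_ge0 => e; rewrite -subr_ge0.
    by apply: le_trans e _; rewrite le_eqVlt; apply/orP; left; apply/eqP; field.
  - have := ler_wpM2l i0 w2; rewrite -subr_ge0 => e; rewrite -subr_ge0.
    by apply: le_trans e _; rewrite le_eqVlt; apply/orP; left; apply/eqP; field.
  - have := ler_wpM2l i0 w3; rewrite -subr_ge0 => e; rewrite -subr_ge0.
    by apply: le_trans e _; rewrite le_eqVlt; apply/orP; left; apply/eqP; field.
have v1 : v.1.2 < 1 by apply: le_lt_trans ml; rewrite lerDl.
have d0 : 0 < 1 - v.1.2 by rewrite subr_gt0.
have dn : 1 - v.1.2 != 0 by rewrite gt_eqF.
split; first by rewrite v0.
split; last first.
  by move=> Gb; apply: nG; rewrite -(mix_chart_y Qy v1); apply: (newton_mix nd); rewrite ?v0 ?ltW.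
have Kb : pjoin G P (mix (l / (1 - v.1.2)) P c).
  apply: pjoin_segment; first exact: pjoin_sub.
  rewrite divr_ge0 ?(ltW d0) //= ler_pdivrMr // mul1r lerBrDl.
  exact: ltW.
apply: (pjoin_up nd P0 Kb).
have i0 : 0 <= (1 - v.1.2)^-1 by rewrite invr_ge0 ltW.
case: vw => /= w1 w2 w3; split; rewrite /= /cone_chart.
- have := ler_wpM2l i0 w1; rewrite -subr_ge0 => e; rewrite -subr_ge0.
  by apply: le_trans e _; rewrite le_eqVlt; apply/orP; left; apply/eqP; field.
- by rewrite Py cy !mulr0 addr0.
- have := ler_wpM2l i0 w3; rewrite -subr_ge0 => e; rewrite -subr_ge0.
  by apply: le_trans e _; rewrite le_eqVlt; apply/orP; left; apply/eqP; field.
Qed.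

(** If a ray from a point of the base to the apex enters [G] before the apex, it
    does so together with all rays close to it: the half-open pyramid and [G]
    overlap on a box. *)
Lemma cone_overlap Q b s : G Q -> Q.1.2 = 1 -> D b -> b.1.2 = 0 -> 0 <= s < 1 ->
  G (mix s b Q) -> exists w e, [/\ 0 < e, nonneg3 w & forall v,
    w.1.1 <= v.1.1 <= w.1.1 + e -> w.1.2 <= v.1.2 <= w.1.2 + e -> w.2 <= v.2 <= w.2 + e ->
    [/\ G v, 0 <= v.1.2 < 1 & D (chart_y Q v)]].
Proof.
move=> GQ Qy [Kb nGb] b0 /andP[s0 s1] Gs.
have b00 := pjoin_ge0 nd P0 Kb.
have [e1 e10 he1] := room_above nd b00 nGb.
have near_b c : b.1.1 <= c.1.1 <= b.1.1 + e1 -> c.1.2 = 0 -> b.2 <= c.2 <= b.2 + e1 -> D c.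
  move=> /andP[c1 c1'] c2 /andP[c3 c3']; split.
    by apply: (pjoin_up nd P0 Kb); split; rewrite // b0 c2.
  by apply: he1; rewrite // c2 b0 add0r ltW.
pose dx := Q.1.1 - b.1.1; pose dz := Q.2 - b.2.
pose L := `|dx| + `|dz|.
have L0 : 0 <= L by rewrite addr_ge0.
have Lx : `|dx| <= L by rewrite lerDl.
have Lz : `|dz| <= L by rewrite lerDr.
have s1' : 0 < 1 - s by rewrite subr_gt0.
have L1 : 0 < 2 * L + 1 by rewrite ltr_wpDl // mulr_ge0.
pose e := Num.min ((1 - s) / 2) (e1 * (1 - s) / (2 * (2 * L + 1))).
have e0 : 0 < e by rewrite lt_min divr_gt0 //= divr_gt0 // mulr_gt0.
have es : e <= (1 - s) / 2 by rewrite ge_min lexx.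
have eL : (2 * L + 1) * e <= e1 * (1 - s) / 2.
  have : e <= e1 * (1 - s) / (2 * (2 * L + 1)) by rewrite ge_min lexx orbT.
  rewrite ler_pdivlMr ?mulr_gt0 // => he; rewrite ler_pdivlMr //.
  by apply: le_trans he; rewrite le_eqVlt; apply/orP; left; apply/eqP; ring.
move: e e0 es eL => e e0 es eL.
exists (b.1.1 + s * dx + L * e, s, b.2 + s * dz + L * e), e; split => //.
  have [bb1 _ bb3] := b00; have [q1 _ q3] := newton_ge0 nd GQ.
  have h c q d : 0 <= c -> 0 <= q -> d = q - c -> 0 <= c + s * d + L * e.
    move=> c0 q0 ->; rewrite addr_ge0 ?mulr_ge0 ?(ltW e0) //.
    have -> : c + s * (q - c) = (1 - s) * c + s * q by ring.
    by rewrite addr_ge0 // mulr_ge0 // ltW.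
  by split => //=; [exact: (h _ Q.1.1)|exact: (h _ Q.2)].
move=> v /= vx vy vz.
have [x1 x2] := ray_drift Lx vy (ltW e10) es eL vx.
have [z1 z2] := ray_drift Lz vy (ltW e10) es eL vz.
have /andP[u1 u2] := vy.
have v1 : v.1.2 < 1.
  apply: le_lt_trans u2 _; apply: le_lt_trans (_ : s + (1 - s) / 2 < 1); first by rewrite lerD2l.
  by rewrite -ltrBrDl ltr_pdivrMr // ltr_pMr // ltr1n.
have d0 : 0 < 1 - v.1.2 by rewrite subr_gt0.
split; last 1 first.
- by apply: near_b => //=; exact: cone_chart_bounds.
- have Gm : G (mix ((v.1.2 - s) / (1 - s)) (mix s b Q) Q).
    apply: (newton_mix nd) => //; rewrite divr_ge0 ?subr_ge0 ?(ltW s1) //=.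
    by rewrite ler_pdivrMr // mul1r lerB // ltW.
  apply: (newton_up nd Gm); have sn : 1 - s != 0 by rewrite gt_eqF.
  have -> : mix ((v.1.2 - s) / (1 - s)) (mix s b Q) Q = mix v.1.2 b Q.
    by apply: eq3; rewrite /=; field.
  have mixE (c q : R) : (1 - v.1.2) * c + v.1.2 * q = c + v.1.2 * (q - c) by ring.
  by split; rewrite /= ?mixE // b0 Qy subr0 add0r mulr1.
- by rewrite v1 (le_trans s0).
Qed.

Lemma small3_D : small3 D. Proof. exact: (small3_diff nd P0). Qed.

Lemma cone_y_vol : cone_y D -> 3 * vol D = area (plane_y D).
Proof.
move=> [Q [Q0 Qy DE]].
have [_ <-] := cone_y_measure (small2_plane_y small3_D) Q0.
by congr (3 * vol _); apply/seteqP; split=> v; [move=> /DE|move=> h; apply/DE].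
Qed.

(** [D] is contained in the half-open pyramid over its trace on the plane, and a
    point of this pyramid in [G] would make the volume of [D] strictly smaller
    by [cone_overlap]. *)
Theorem apex_y_cone Q : apex_y G P Q -> area (plane_y D) <= 3 * vol D -> cone_y D.
Proof.
move=> aQ hA; have [GQ Qy _] := aQ; exists Q; split=> // [|v]; first exact: (newton_ge0 nd).
split=> [|[/andP[v0 v1] Dv]]; first exact: apex_y_sub.
set b := chart_y Q v in Dv.
have vE : mix v.1.2 b Q = v by exact: mix_chart_y.
have [Kb nGb] := Dv.
split.
  by rewrite -vE; apply: (pjoin_mix nd P0); rewrite ?v0 ?ltW //; exact: pjoin_sub.
move=> Gv.
have [||w [e [e0 w0 hw]]] := @cone_overlap Q b v.1.2 GQ Qy Dv erefl; first by rewrite v0.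
  by rewrite vE.
have [sB vB] := small3_box e0 w0; set B := [set _ | _] in sB vB.
have [sC eC] := cone_y_measure (small2_plane_y small3_D) (newton_ge0 nd GQ); set C := [set _ | _] in sC eC.
have DC : D `<=` C by move=> x /(apex_y_sub aQ).
have sBD : small3 (B `|` D) by exact: small3U small3_D.
have BC : B `|` D `<=` C by move=> x [[h1 [h2 h3]]|/DC //]; have [] := hw x h1 h2 h3.
have BD0 : B `&` D = set0.
  by apply/seteqP; split=> // x [[h1 [h2 h3]] [_ nG]]; have [] := hw x h1 h2 h3.
have := le_vol sBD sC BC; rewrite volU //; last exact: small3_D.
by rewrite leNgt -(ltr_pM2l (_ : 0 < 3)) // eC => /negP[]; rewrite (le_lt_trans hA) // mulrDr ltrDr mulr_gt0.
Qed.

Lemma above_apex : exists2 e, 0 < e & D (P.1.1, e, P.2).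
Proof.
have [e e0 he] := room_above nd P0 PG.
exists e => //; split; last by apply: he; rewrite /= ?Py ?add0r ?lerDl // ltW.
have KP : pjoin G P P by apply: pjoin_apex; exact: (newton_neq0 nd).
by apply: (pjoin_up nd P0 KP); split; rewrite //= Py ltW.
Qed.

Section over_planes.
Variable Q : R * R * R.
Hypotheses (Q0 : nonneg3 Q) (Qy : Q.1.2 = 1).
Hypothesis DE : forall v, D v <-> 0 <= v.1.2 < 1 /\ D (chart_y Q v).

Let D_ge0 v : D v -> nonneg3 v. Proof. by move=> [/(pjoin_ge0 nd P0)]. Qed.

(** The apex lies in every coordinate plane through [P] other than that of the
    base: otherwise the cone would meet this plane only in its base, contrary to
    [above_apex]. *)
Lemma apex_x0 : P.1.1 = 0 -> Q.1.1 = 0.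
Proof.
move=> Px; have [e e0 De] := above_apex; have [/andP[_ e1] /D_ge0[+ _ _]] := (DE _).1 De.
rewrite /chart_y /= /cone_chart Px sub0r ler_pdivlMr ?subr_gt0 // mul0r oppr_ge0.
rewrite pmulr_rle0 // => h; apply/eqP; rewrite eq_le h; by case: Q0.
Qed.

Lemma apex_z0 : P.2 = 0 -> Q.2 = 0.
Proof.
move=> Px; have [e e0 De] := above_apex; have [/andP[_ e1] /D_ge0[_ _ +]] := (DE _).1 De.
rewrite /chart_y /= /cone_chart Px sub0r ler_pdivlMr ?subr_gt0 // mul0r oppr_ge0.
rewrite pmulr_rle0 // => h; apply/eqP; rewrite eq_le h; by case: Q0.
Qed.

(** In the plane of equation [z = 0], [D] is a half-open triangle of height one
    with its base on the axis, or is empty if [P] is not in that plane. *)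
Lemma plane_z_measure : 2 * area (plane_z D) = len (axis_x D).
Proof.
have P3 : 0 <= P.2 by case: P0.
have sD := small3_D.
move: P3; rewrite le_eqVlt => /orP[/eqP Pz|Pz].
  have Qz := apex_z0 (esym Pz).
  have [mL _] := small1_axis_x sD.
  have [mC eC] := cone_measure2 Q.1.1 mL.
  have E : plane_z D = [set p : R * R | 0 <= p.2 < 1 /\ axis_x D (cone_chart Q.1.1 p.1 p.2)].
    apply/seteqP; split=> -[x y].
      by move=> /DE[y01]; rewrite /chart_y /= Qz /cone_chart mulr0 subr0 mul0r.
    by move=> [y01 h]; apply/DE; split => //; rewrite /chart_y /= Qz {2}/cone_chart mulr0 subr0 mul0r.
  have eA : mu2 (plane_z D) = (2^-1 * len (axis_x D))%:E.
    by rewrite E; etransitivity; [exact: eC|rewrite EFinM lenE //; exact: small1_axis_x].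
  by rewrite /area eA /= mulrA divff ?mul1r.
have nD v : v.2 = 0 -> ~ D v.
  move=> v2 [Kv]; apply; apply: (pjoin_coord0 (f := fun v => v.2)) Kv v2 => //.
  by move=> q /(newton_ge0 nd)[].
have -> : plane_z D = set0 by apply/seteqP; split=> // v /nD; exact.
have -> : axis_x D = set0 by apply/seteqP; split=> // v /nD; exact.
by rewrite area0 len0 mulr0.
Qed.

Lemma plane_x_measure : 2 * area (plane_x D) = len (axis_z D).
Proof.
have P1 : 0 <= P.1.1 by case: P0.
have sD := small3_D.
move: P1; rewrite le_eqVlt => /orP[/eqP Px|Px].
  have Qx := apex_x0 (esym Px).
  have [mL _] := small1_axis_z sD.
  have [mC eC] := cone_measure2 Q.2 mL.
  have E : [set p | plane_x D (p.2, p.1)] =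
      [set p : R * R | 0 <= p.2 < 1 /\ axis_z D (cone_chart Q.2 p.1 p.2)].
    apply/seteqP; split=> -[x y].
      by move=> /DE[y01]; rewrite /chart_y /= Qx {1}/cone_chart mulr0 subr0 mul0r.
    by move=> [y01 h]; apply/DE; split => //; rewrite /chart_y /= Qx {1}/cone_chart mulr0 subr0 mul0r.
  have [_ <-] := small2_swap (small2_plane_x sD).
  have eA : mu2 [set p | plane_x D (p.2, p.1)] = (2^-1 * len (axis_z D))%:E.
    by rewrite E; etransitivity; [exact: eC|rewrite EFinM lenE //; exact: small1_axis_z].
  by rewrite /area eA /= mulrA divff ?mul1r.
have nD v : v.1.1 = 0 -> ~ D v.
  move=> v1 [Kv]; apply; apply: (pjoin_coord0 (f := fun v => v.1.1)) Kv v1 => //.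
  by move=> q /(newton_ge0 nd)[].
have -> : plane_x D = set0 by apply/seteqP; split=> // v /nD; exact.
have -> : axis_z D = set0 by apply/seteqP; split=> // v /nD; exact.
by rewrite area0 len0 mulr0.
Qed.

Lemma axis_y_measure : len (axis_y D) = if (P.1.1 == 0) && (P.2 == 0) then 1 else 0.
Proof.
have [P1 _ P3] := P0.
case: ifPn => [/andP[/eqP Px /eqP Pz]|nP].
  have Qx := apex_x0 Px; have Qz := apex_z0 Pz.
  have KP : D (0, 0, 0).
    have -> : (0, 0, 0) = P by apply: eq3.
    by split=> //; apply: pjoin_apex; exact: (newton_neq0 nd).
  have -> : axis_y D = `[0, 1[%classic.
    apply/seteqP; split=> y /=; rewrite in_itv /=; first by move=> /DE[].
    move=> y01; apply/DE; split=> //.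
    by rewrite /chart_y /= Qx Qz /cone_chart !mulr0 !subr0 !mul0r.
  by rewrite /len lebesgue_measure_itv /= lte_fin ltr01 oppr0 adde0.
have -> : axis_y D = set0; last exact: len0.
apply/seteqP; split=> // y [Kv nG]; apply: nG; apply: (pjoin_coord0 (f := fun v => v.1.1 + v.2)) Kv _.
- by move=> r p q /=; ring.
- by move=> q /(newton_ge0 nd)[q1 _ q3]; rewrite addr_ge0.
- by rewrite lt_neqAle eq_sym paddr_eq0 // nP addr_ge0.
- by rewrite /= addr0.
Qed.

End over_planes.

(** The Newton number without its constant term, as an additive function of the
    region under the polyhedron. *)
Definition nu_drop (D : set (R * R * R)) : R :=
  6 * vol D - 2 * (area (plane_x D) + area (plane_y D) + area (plane_z D)) +
  (len (axis_x D) + len (axis_y D) + len (axis_z D)).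

(** The volume of the pyramid cancels the area of its base, and the areas of its
    sides the lengths of their bases; there remains the length of the edge on
    the axis orthogonal to the base. *)
Theorem cone_y_nu_drop : cone_y D -> nu_drop D = if (P.1.1 == 0) && (P.2 == 0) then 1 else 0.
Proof.
move=> cD; have [Q [Q0 Qy DE]] := cD.
have arith (V x y z lx ly lz : R) : 3 * V = y -> 2 * z = lx -> 2 * x = lz ->
    6 * V - 2 * (x + y + z) + (lx + ly + lz) = ly by move=> <- <- <-; ring.
rewrite -(axis_y_measure Q0 DE); apply: arith; first exact: cone_y_vol.
  exact: (plane_z_measure Q0 DE).
exact: (plane_x_measure Q0 DE).
Qed.

End cone.
End pyramids.

(** * The drop of the Newton number *)

Section drops.
Context {R : realType}.
Implicit Types (G : set (R * R * R)) (A : seq (nat * nat * nat)).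

Implicit Types D : set (R * R * R).
Lemma newton_height G A (p1 p2 z : R) : newton_data G A -> 0 <= p1 -> 0 <= p2 -> 0 <= z ->
  ~ G (p1, p2, z) -> exists l, [/\ z < l, G (p1, p2, l) &
    forall t, t < l -> ~ G (p1, p2, t)].
Proof.
move=> nd h1 h2 z0; have [s ps ->] := newton_hpoly nd => nG.
have F t := hpoly_floor (p1, p2) t ps.
exists (floor_fun s (p1, p2)); split.
- by rewrite ltNge; apply/negP => h; apply: nG; apply/(F z).
- by apply/(F _).
- by move=> t tl /(F t)[_ _]; rewrite leNgt tl.
Qed.

Lemma vol_swap12 D : small3 D -> small3 (sw12 @^-1` D) /\ vol (sw12 @^-1` D) = vol D.
Proof.
move=> [mD [M hM]]; have [mD' e] := lebesgue3_swap12 mD; split.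
  by split=> //; exists M => v /hM[].
by rewrite /vol; congr fine; exact: e.
Qed.

Lemma vol_swap23 D : small3 D -> small3 (sw23 @^-1` D) /\ vol (sw23 @^-1` D) = vol D.
Proof.
move=> [mD [M hM]]; have [mD' e] := lebesgue3_swap23 mD; split.
  by split=> //; exists M => v /hM[].
by rewrite /vol; congr fine; exact: e.
Qed.

Lemma nu_drop_sw12 D : small3 D -> nu_drop (sw12 @^-1` D) = nu_drop D.
Proof.
move=> sD; rewrite /nu_drop; have [_ ->] := vol_swap12 sD.
have [_ e] := small2_swap (small2_plane_z sD).
have -> : area (plane_z (sw12 @^-1` D)) = area (plane_z D) by rewrite -e.
have -> : plane_x (sw12 @^-1` D) = plane_y D by [].
have -> : plane_y (sw12 @^-1` D) = plane_x D by [].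
have -> : axis_x (sw12 @^-1` D) = axis_y D by [].
have -> : axis_y (sw12 @^-1` D) = axis_x D by [].
have -> : axis_z (sw12 @^-1` D) = axis_z D by [].
by rewrite [area (plane_y D) + _]addrC [len (axis_y D) + _]addrC.
Qed.

Lemma nu_drop_sw23 D : small3 D -> nu_drop (sw23 @^-1` D) = nu_drop D.
Proof.
move=> sD; rewrite /nu_drop; have [_ ->] := vol_swap23 sD.
have [_ e] := small2_swap (small2_plane_x sD).
have -> : area (plane_x (sw23 @^-1` D)) = area (plane_x D) by rewrite -e.
have -> : plane_y (sw23 @^-1` D) = plane_z D by [].
have -> : plane_z (sw23 @^-1` D) = plane_y D by [].
have -> : axis_x (sw23 @^-1` D) = axis_x D by [].
have -> : axis_y (sw23 @^-1` D) = axis_z D by [].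
have -> : axis_z (sw23 @^-1` D) = axis_y D by [].
by rewrite (addrAC (area _)) (addrAC (len _)).
Qed.

Lemma nu_dropU D D' : small3 D -> small3 D' -> D `&` D' = set0 ->
  nu_drop (D `|` D') = nu_drop D + nu_drop D'.
Proof.
move=> sD sD' DD.
have arith (v v' a a' b b' c c' x x' y y' z z' : R) :
    6 * (v + v') - 2 * ((a + a') + (b + b') + (c + c')) + ((x + x') + (y + y') + (z + z')) =
    6 * v - 2 * (a + b + c) + (x + y + z) + (6 * v' - 2 * (a' + b' + c') + (x' + y' + z')).
  by ring.
rewrite /nu_drop volU //.
have E (T : Type) (f : T -> R * R * R) : (f @^-1` D) `&` (f @^-1` D') = set0.
  by rewrite -preimage_setI DD preimage_set0.
have -> : area (plane_x (D `|` D')) = area (plane_x D) + area (plane_x D').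
  by apply: areaU; [exact: small2_plane_x|exact: small2_plane_x|exact: (E _ (fun p => (0, p.1, p.2)))].
have -> : area (plane_y (D `|` D')) = area (plane_y D) + area (plane_y D').
  by apply: areaU; [exact: small2_plane_y|exact: small2_plane_y|exact: (E _ (fun p => (p.1, 0, p.2)))].
have -> : area (plane_z (D `|` D')) = area (plane_z D) + area (plane_z D').
  by apply: areaU; [exact: small2_plane_z|exact: small2_plane_z|exact: (E _ (fun p => (p.1, p.2, 0)))].
have -> : len (axis_x (D `|` D')) = len (axis_x D) + len (axis_x D').
  by apply: lenU; [exact: small1_axis_x|exact: small1_axis_x|exact: (E _ (fun t => (t, 0, 0)))].
have -> : len (axis_y (D `|` D')) = len (axis_y D) + len (axis_y D').
  by apply: lenU; [exact: small1_axis_y|exact: small1_axis_y|exact: (E _ (fun t => (0, t, 0)))].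
have -> : len (axis_z (D `|` D')) = len (axis_z D) + len (axis_z D').
  by apply: lenU; [exact: small1_axis_z|exact: small1_axis_z|exact: (E _ (fun t => (0, 0, t)))].
exact: arith.
Qed.

Section cases.
Variables (G : set (R * R * R)) (A : seq (nat * nat * nat)).
Hypothesis nd : newton_data G A.

Section point.
Variable P : R * R * R.
Hypotheses (P0 : nonneg3 P) (PG : ~ G P).
Let D := pjoin G P `\` G.

Lemma no_plane_x : 0 < P.1.1 -> plane_x D = set0.
Proof.
move=> P1; apply/seteqP; split=> // v [Kv nG]; apply: nG.
apply: (pjoin_coord0 (f := fun v => v.1.1)) Kv _ => //.
by move=> q /(newton_ge0 nd)[].
Qed.

Lemma no_plane_y : 0 < P.1.2 -> plane_y D = set0.
Proof.
move=> P1; apply/seteqP; split=> // v [Kv nG]; apply: nG.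
apply: (pjoin_coord0 (f := fun v => v.1.2)) Kv _ => //.
by move=> q /(newton_ge0 nd)[].
Qed.

Lemma no_plane_z : 0 < P.2 -> plane_z D = set0.
Proof.
move=> P1; apply/seteqP; split=> // v [Kv nG]; apply: nG.
apply: (pjoin_coord0 (f := fun v => v.2)) Kv _ => //.
by move=> q /(newton_ge0 nd)[].
Qed.

Lemma axes_planes : [/\ plane_x D = set0 -> axis_y D = set0 /\ axis_z D = set0,
  plane_y D = set0 -> axis_x D = set0 /\ axis_z D = set0 &
  plane_z D = set0 -> axis_x D = set0 /\ axis_y D = set0].
Proof.
split=> h; split; apply/seteqP; split=> // t Dt.
- by suff : plane_x D (t, 0) by rewrite h.
- by suff : plane_x D (0, t) by rewrite h.
- by suff : plane_y D (t, 0) by rewrite h.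
- by suff : plane_y D (0, t) by rewrite h.
- by suff : plane_z D (t, 0) by rewrite h.
- by suff : plane_z D (0, t) by rewrite h.
Qed.

(** Only the volume counts, as [D] does not meet the coordinate planes. *)
Lemma nu_drop_interior : pos3 P -> 0 < nu_drop D.
Proof.
move=> [P1 P2 P3]; have sD := small3_diff nd P0.
have px := no_plane_x P1; have py := no_plane_y P2; have pz := no_plane_z P3.
have [/(_ px)[ay az] /(_ py)[ax _] _] := axes_planes.
rewrite /nu_drop px py pz ax ay az area0 len0 !addr0 mulr0 subr0.
have [e e0 he] := room_above nd P0 PG.
have [sB vB] := small3_box e0 P0; set B := [set _ | _] in sB vB.
rewrite mulr_gt0 //; apply: (lt_le_trans vB); apply: le_vol => // v.
move=> [/andP[h1 h1'] [/andP[h2 h2'] /andP[h3 h3']]]; split.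
  have KP : pjoin G P P by apply: pjoin_apex; exact: (newton_neq0 nd).
  exact: (pjoin_up nd P0 KP).
exact: he.
Qed.

(** With the origin outside and a unit vector inside, replacing the corresponding
    coefficient of a separating form by [1] still separates, lattice points having
    integer coordinates. *)
Lemma unit_cone : P = (0, 0, 0) -> G (0, 1, 0) -> cone_y D.
Proof.
move=> PE Ge; pose Q : R * R * R := (0, 1, 0).
have aQ : apex_y G P Q.
  split=> // v Gv; have [v1 v2 v3] := newton_ge0 nd Gv.
  have [M [M0 /(newton_gen nd) g1 _ /(newton_gen nd) g3]] := newton_axes nd.
  have M0' : 0 < M%:R :> R by rewrite ltr0n.
  rewrite PE.
  have [v1'|v1'] := ltP 0 v.1.1.
    exists (emb (M, 0%N, 0%N)), (v.1.1 / M%:R); split=> //; first by rewrite divr_ge0 // ltW.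
    by split; rewrite /= ?mulr0n ?subr0 ?mulr0 ?add0r ?mulr1 ?addr0 ?divfK // gt_eqF.
  exists (emb (0%N, 0%N, M)), (v.2 / M%:R); split=> //; first by rewrite divr_ge0 // ltW.
  by split; rewrite /= ?mulr0n ?subr0 ?mulr0 ?add0r ?mulr1 ?addr0 ?divfK // gt_eqF.
have Py : P.1.2 = 0 by rewrite PE.
exists Q; split=> // v.
split=> [|[/andP[v0 v1] Db]]; first exact: (apex_y_sub nd P0 PG Py aQ).
have [Kb nGb] := Db; set b := chart_y Q v in Db Kb nGb.
have vE : mix v.1.2 b Q = v by exact: mix_chart_y.
split.
  by rewrite -vE; apply: (pjoin_mix nd P0); rewrite ?v0 ?ltW //; exact: pjoin_sub.
have b0 := pjoin_ge0 nd P0 Kb.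
have [s ps Es] := newton_hpoly nd.
have [a a_s ab] : exists2 a, a \in s & ev a b < 1.
  by apply: notin_hpoly => //; rewrite -Es.
have [a1 a2 a3] := ps _ a_s.
pose a' : R * R * R := (a.1.1, 1, a.2).
have Ga' v' : G v' -> 1 <= ev a' v'.
  apply: (newton_half nd); first by split; rewrite /= ?ltW.
  move=> c cA; have [cy|cy] := posnP c.1.2.
    have := newton_gen nd cA; rewrite Es => -[_ /(_ a a_s)].
    by rewrite /ev /= cy !mulr0.
  rewrite /ev /= mul1r addrAC ler_wpDl ?ler1n //.
  by rewrite addr_ge0 // mulr_ge0 ?ler0n // ltW.
move=> /Ga'; rewrite -vE ev_mix; apply/negP; rewrite -ltNge.
have -> : ev a' Q = 1 by rewrite /ev /= !mulr0 mulr1 add0r addr0.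
have -> : ev a' b = ev a b by rewrite /ev /= !mulr0.
rewrite mulr1 -ltrBrDr gtr_pMr // subr_gt0.
exact: v1.
Qed.
End point.

(** Only the coordinate plane that contains [P] contributes to the weight of the
    climb. In case of equality [static_middle] provides an apex, and the
    vanishing of the drop is the comparison of volumes that [apex_y_cone]
    requires. *)
Lemma nu_drop_plane (k n : nat) : (0 < k)%N -> (0 < n)%N ->
  let P : R * R * R := (k%:R, 0, n%:R) in let D := pjoin G P `\` G in
  ~ G P -> 0 <= nu_drop D /\ (nu_drop D = 0 -> cone_y D).
Proof.
move=> k0 n0 P D PG.
have n0' : 0 < n%:R :> R by rewrite ltr0n.
have k0' : 0 < k%:R :> R by rewrite ltr0n.
have P0 : nonneg3 P by split; rewrite /= ?ler0n.
have px : plane_x D = set0 by exact: no_plane_x.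
have pz : plane_z D = set0 by exact: no_plane_z.
have [/(_ px)[ay az] _ /(_ pz)[ax _]] := axes_planes P.
have E : nu_drop D = 6 * vol D - 2 * area (plane_y D).
  by rewrite /nu_drop px pz ax ay az area0 len0 !addr0 add0r.
have [l [nl Gl below]] := newton_height nd (ltW k0') (lexx 0) (ltW n0') PG.
have static t : n%:R <= t -> t < l ->
    0 * len [set y | shadow G (k%:R, 0, t) (0, y)] +
    1 * len [set x | shadow G (k%:R, 0, t) (x, 0)] - 0 <= 2 * area (shadow G (k%:R, 0, t)).
  move=> nt tl; rewrite mul0r add0r mul1r subr0.
  by have [] := static_middle nd k0 (lt_le_trans n0' nt) (below _ tl).
have FE : 6 * vol D - 2 * 0 * area (plane_x D) - 2 * 1 * area (plane_y D) + 0 * (l - n%:R) = nu_drop D.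
  by rewrite E mulr0 !mul0r subr0 addr0 mulr1.
have F0 := climb_ge0 nd (ltW k0') (lexx 0) (ltW n0') Gl (lexx 0) ler01 (lexx 0)
  (or_introl erefl) (or_intror erefl) (fun t _ => below t) static (lexx _) (ltW nl).
rewrite /= -/P -/D FE in F0; split=> // D0.
have := climb_eq0 nd (ltW k0') (lexx 0) (ltW n0') nl Gl (lexx 0) ler01 (lexx 0)
  (or_introl erefl) (or_intror erefl) (fun t _ => below t) static.
rewrite /= -/P -/D FE => /(_ D0); rewrite mul0r add0r mul1r subr0 => le2.
have [_ /(_ le2)[Q aQ]] := static_middle nd k0 n0' PG.
apply: (apex_y_cone nd P0 PG erefl aQ).
rewrite -(ler_pM2l (_ : 0 < 2)) // mulrA -natrM -subr_ge0.
by move: F0; rewrite E.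
Qed.

End cases.

Section cases2.
Variables (G : set (R * R * R)) (A : seq (nat * nat * nat)).
Hypothesis nd : newton_data G A.

(** The length covered by [D] on the vertical axis is the duration of the climb:
    it makes up for the constant in [static_two_sides]. The inequalities for
    each vertical plane alone then provide the comparison of volumes that
    [apex_y_cone] requires. *)
Lemma nu_drop_axis (n : nat) : (0 < n)%N ->
  let P : R * R * R := (0, 0, n%:R) in let D := pjoin G P `\` G in
  ~ G P -> 0 <= nu_drop D /\ (nu_drop D = 0 -> low_apex G A n%:R P /\
    (cone_y D \/ cone_y (sw12 @^-1` D))).
Proof.
move=> n0 P D PG.
have n0' : 0 < n%:R :> R by rewrite ltr0n.
have P0 : nonneg3 P by split; rewrite /= ?ler0n.
have pz : plane_z D = set0 by exact: (no_plane_z nd).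
have [_ _ /(_ pz)[ax ay]] := axes_planes G P.
have [l [nl Gl below]] := newton_height nd (lexx 0) (lexx 0) (ltW n0') PG.
have az : len (axis_z D) = l - n%:R.
  have -> : axis_z D = `[n%:R, l[%classic.
    apply/seteqP; split=> t; rewrite /= in_itv /=.
      move=> [[r [q [/andP[r0 r1] Gq /= [e1 e2 e3]]]] nG].
      have tl : t < l.
        rewrite ltNge; apply/negP => lt; apply: nG; apply: (newton_up nd Gl).
        by split.
      rewrite tl andbT e3.
      have [q1 q2 q3] := newton_ge0 nd Gq.
      have [->|rn] := eqVneq r 0; first by rewrite mul0r addr0 subr0 mul1r.
      have rp : 0 < r by rewrite lt_neqAle eq_sym rn.
      have q10 : q.1.1 = 0.
        move/eqP: e1; rewrite mulr0 add0r eq_sym mulf_eq0 (gt_eqF rp) /= => /eqP; exact.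
      have q20 : q.1.2 = 0.
        move/eqP: e2; rewrite mulr0 add0r eq_sym mulf_eq0 (gt_eqF rp) /= => /eqP; exact.
      have lq : l <= q.2.
        rewrite leNgt; apply/negP => /below; apply.
        by have -> : (0, 0, q.2) = q by exact: eq3.
      have : 0 <= r * (q.2 - n%:R) by rewrite mulr_ge0 // subr_ge0 (le_trans (ltW nl)).
      by lra.
    move=> /andP[nt tl]; split; last exact: below.
    have KP : pjoin G P P by apply: pjoin_apex; exact: (newton_neq0 nd).
    by apply: (pjoin_up nd P0 KP); split.
  by rewrite /len lebesgue_measure_itv /= lte_fin nl -EFinB.
have E : nu_drop D = 6 * vol D - 2 * 1 * area (plane_x D) - 2 * 1 * area (plane_y D) + 1 * (l - n%:R).
  rewrite /nu_drop pz ax ay az area0 len0.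
  by move: (vol D) (area _) (area _) => V a b; ring.
have bt t : n%:R <= t -> t < l -> 0 < t /\ ~ G (0, 0, t).
  by move=> nt tl; split; [exact: lt_le_trans nt|exact: below].
have S (cx cy c0 : R) : (forall t, n%:R <= t -> t < l ->
     cx * len [set y | shadow G (0, 0, t) (0, y)] +
     cy * len [set x | shadow G (0, 0, t) (x, 0)] - c0 <= 2 * area (shadow G (0, 0, t))) ->
    0 <= cx -> 0 <= cy -> 0 <= c0 ->
    0 <= 6 * vol D - 2 * cx * area (plane_x D) - 2 * cy * area (plane_y D) + c0 * (l - n%:R).
  move=> H h1 h2 h3.
  exact: (climb_ge0 nd (lexx 0) (lexx 0) (ltW n0') Gl h1 h2 h3 (or_intror erefl)
    (or_intror erefl) (fun t _ => below t) H (lexx _) (ltW nl)).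
have H t : n%:R <= t -> t < l -> 1 * len [set y | shadow G (0, 0, t) (0, y)] +
     1 * len [set x | shadow G (0, 0, t) (x, 0)] - 1 <= 2 * area (shadow G (0, 0, t)).
  move=> nt tl; have [t0 Pt] := bt t nt tl; rewrite !mul1r [len _ + _]addrC.
  by have [] := static_two_sides nd t0 Pt.
have F0 : 0 <= nu_drop D by rewrite E; apply: S.
split=> // D0.
have Fy : 2 * area (plane_y D) <= 6 * vol D.
  have := S 0 1 0; rewrite mulr0 !mul0r subr0 addr0 mulr1 subr_ge0; apply=> // t nt tl.
  have [t0 Pt] := bt t nt tl; rewrite mul0r mul1r add0r subr0.
  exact: (static_x nd t0 Pt).
have Fx : 2 * area (plane_x D) <= 6 * vol D.
  have := S 1 0 0; rewrite mulr0 !mul0r subr0 addr0 mulr1 subr_ge0; apply=> // t nt tl.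
  have [t0 Pt] := bt t nt tl; rewrite mul0r mul1r addr0 subr0.
  exact: (static_y nd t0 Pt).
have low : low_apex G A n%:R P.
  have [_] := static_two_sides nd n0' PG; apply.
  have := climb_eq0 nd (lexx 0) (lexx 0) (ltW n0') nl Gl ler01 ler01 ler01
    (or_intror erefl) (or_intror erefl) (fun t _ => below t) H.
  by rewrite /= -/P -/D -E => /(_ D0); rewrite !mul1r [len _ + _]addrC.
split=> //.
have le3 a v : 2 * a <= 6 * v -> a <= 3 * v :> R.
  by rewrite -[in X in _ -> X](ler_pM2l (_ : 0 < 2)) // mulrA -natrM.
have [q _ [_ [[aQ _]|[aQ _]]]] := low.
  by left; apply: (apex_y_cone nd P0 PG erefl aQ); exact: le3.
right; have DE : sw12 @^-1` D = pjoin (sw12 @^-1` G) (sw12 P) `\` (sw12 @^-1` G).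
  by rewrite pjoin_sw12.
have P0' : nonneg3 (sw12 P) by split; rewrite /= ?ler0n.
have PG' : ~ (sw12 @^-1` G) (sw12 P) by [].
have := apex_y_cone (newton_data_sw12 nd) P0' PG' (erefl _) aQ.
rewrite -DE; apply.
have [_ ->] := vol_swap12 (small3_diff nd P0); exact: le3.
Qed.

(** The join with the origin factors through the join with a unit vector. The
    last step then contributes exactly one by [unit_cone], and the first one is
    positive, since the apex given by its equality case would be a unit vector
    in [G]. *)
Lemma nu_drop_origin : let P : R * R * R := (0, 0, 0) in let D := pjoin G P `\` G in
  ~ G P -> ~ G (1, 0, 0) -> ~ G (0, 1, 0) -> ~ G (0, 0, 1) -> 1 < nu_drop D.
Proof.
move=> P D PG Gx Gy Gz.
pose P1 : R * R * R := (0, 0, 1).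
have P0 : nonneg3 P by split; exact: lexx.
have P10 : nonneg3 P1 by split; rewrite /= ?lexx ?ler01.
pose G1 := pjoin G P1.
have nd1 : newton_data G1 ((0%N, 0%N, 1%N) :: A) by exact: (newton_data_pjoin nd (0, 0, 1)%N).
have full v : nonneg3 v -> pjoin G P v.
  move=> [v1 v2 v3].
  have [M [M0 /(newton_gen nd) g1 /(newton_gen nd) g2 /(newton_gen nd) g3]] := newton_axes nd.
  have M0' : 0 < M%:R :> R by rewrite ltr0n.
  have B c : G c -> (exists2 r, 0 <= r <= 1 & le3 (scale3 r c) v) -> pjoin G P v.
    move=> Gc [r r01 h]; apply: (pjoin_up nd P0 (v := mix r P c)).
      by exists r, c.
    by case: h => h1 h2 h3; split; rewrite /= mulr0 add0r.
  apply: (B _ g1); exists 0; first by rewrite lexx ler01.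
  by split; rewrite /= mul0r.
have G10 : ~ G1 P.
  move=> [r [q [/andP[r0 r1] Gq /= [e1 e2 e3]]]].
  have [q1 q2 q3] := newton_ge0 nd Gq.
  have [q31 rE] : r = 1 /\ r * q.2 = 0.
    have rq : 0 <= r * q.2 by rewrite mulr_ge0.
    by move: e3; rewrite mulr1 => e3; split; lra.
  apply: PG; have -> : P = q; last by [].
  move: e1 e2 e3; rewrite q31 subrr !mul0r !mul1r !add0r => e1 e2 e3.
  exact: eq3.
have DE : D = (pjoin G1 P `\` G1) `|` (G1 `\` G).
  apply/seteqP; split=> v.
    move=> [Kv nG]; have [G1v|G1v] := pselect (G1 v); first by right.
    by left; split=> //; apply: pjoin_mono Kv; exact: pjoin_sub.
  move=> [[Kv nG1]|[G1v nG]].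
    split; first by apply: full; exact: (pjoin_ge0 nd1 P0 Kv).
    by move=> Gv; apply: nG1; exact: pjoin_sub.
  by split=> //; apply: full; exact: (pjoin_ge0 nd P10 G1v).
rewrite DE nu_dropU; [|exact: (small3_diff nd1 P0)|exact: (small3_diff nd P10)|]; last first.
  by apply/seteqP; split=> // v [[_ nG1] [/nG1]].
have G1z : G1 (0, 0, 1) by apply: pjoin_apex; exact: (newton_neq0 nd).
have -> : nu_drop (pjoin G1 P `\` G1) = 1.
  rewrite -nu_drop_sw23; last exact: (small3_diff nd1 P0).
  have E : sw23 @^-1` (pjoin G1 P `\` G1) = pjoin (sw23 @^-1` G1) (sw23 P) `\` (sw23 @^-1` G1).
    by rewrite pjoin_sw23.
  have nd2 := newton_data_sw23 nd1.
  rewrite E (@cone_y_nu_drop R _ _ nd2 (sw23 P)) //= ?eqxx //.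
  exact: (@unit_cone _ _ nd2).
rewrite ltrDl.
have [ge0 eq0] := nu_drop_axis (n := 1) erefl Gz.
rewrite lt_neqAle ge0 andbT eq_sym; apply/eqP => /eq0[[q qA [q2 aq]] _].
have {}q2 : q.2 = 0%N by apply/eqP; rewrite -leqn0 -ltnS -(ltr_nat R).
have Gq := newton_gen nd qA.
case: aq => -[[_ q1 _] q0].
  by apply: Gy; rewrite (_ : (0, 1, 0) = emb q) //; apply: eq3; rewrite /= ?q0 ?q2 ?q1.
by apply: Gx; rewrite (_ : (1, 0, 0) = emb q) //; apply: eq3; rewrite /= ?q0 ?q2 //; rewrite -[LHS]q1.
Qed.

End cases2.
End drops.

(** * The bound for triples of coordinates *)

Section bound.
Context {R : realType}.
Implicit Types (G : set (R * R * R)) (A : seq (nat * nat * nat)).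

Implicit Types D : set (R * R * R).

Lemma cone_y_sw13 D : cone_y D -> cone_y [set v | D (v.2, v.1.2, v.1.1)].
Proof.
move=> [Q [[Q1 Q2 Q3] Qy DE]]; exists (Q.2, Q.1.2, Q.1.1); split=> // v.
by rewrite /= (DE (v.2, v.1.2, v.1.1)).
Qed.

(** Each coordinate plane that contains [P] is put in the position of the plane
    of equation [y = 0] by an exchange of coordinates. *)
Definition pyramidal D (P : R * R * R) := [\/ P.1.1 = 0 /\ cone_y (sw12 @^-1` D),
  P.1.2 = 0 /\ cone_y D | P.2 = 0 /\ cone_y (sw23 @^-1` D)].

Lemma pyramidal_sw12 D P : pyramidal (sw12 @^-1` D) (sw12 P) -> pyramidal D P.
Proof.
move=> [[h c]|[h c]|[h c]].
- by constructor 2; split=> //; move: c; rewrite (_ : sw12 @^-1` _ = D) //; apply/seteqP; split=> -[[x y] z].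
- by constructor 1.
- constructor 3; split=> //; have := cone_y_sw13 c.
  by rewrite (_ : [set _ | _] = sw23 @^-1` D) //; apply/seteqP; split=> -[[x y] z].
Qed.

Lemma pyramidal_sw23 D P : pyramidal (sw23 @^-1` D) (sw23 P) -> pyramidal D P.
Proof.
move=> [[h c]|[h c]|[h c]].
- constructor 1; split=> //; have := cone_y_sw13 c.
  by rewrite (_ : [set _ | _] = sw12 @^-1` D) //; apply/seteqP; split=> -[[x y] z].
- by constructor 3.
- by constructor 2; split=> //; move: c; rewrite (_ : sw23 @^-1` _ = D) //; apply/seteqP; split=> -[[x y] z].
Qed.

Definition origin_count (P : R * R * R) : R :=
  if [&& P.1.1 == 0, P.1.2 == 0 & P.2 == 0] then 1 else 0.

Lemma pyramidal_nu_drop G A P : newton_data G A -> nonneg3 P -> ~ G P ->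
  let D := pjoin G P `\` G in pyramidal D P -> nu_drop D = origin_count P.
Proof.
move=> nd P0 PG D; have sD : small3 D := small3_diff nd P0.
have [p1 p2 p3] := P0.
rewrite /origin_count; move=> [[h c]|[h c]|[h c]]; rewrite h eqxx /=.
- rewrite -nu_drop_sw12 //.
  have E : sw12 @^-1` D = pjoin (sw12 @^-1` G) (sw12 P) `\` (sw12 @^-1` G).
    by rewrite pjoin_sw12.
  rewrite E in c *.
  have P0' : nonneg3 (sw12 P) by [].
  have PG' : ~ (sw12 @^-1` G) (sw12 P) by rewrite /= sw12K.
  exact: (cone_y_nu_drop (newton_data_sw12 nd) P0' PG' h c).
- exact: (cone_y_nu_drop nd P0 PG h c).
- rewrite andbT -nu_drop_sw23 //.
  have E : sw23 @^-1` D = pjoin (sw23 @^-1` G) (sw23 P) `\` (sw23 @^-1` G).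
    by rewrite pjoin_sw23.
  rewrite E in c *.
  have P0' : nonneg3 (sw23 P) by [].
  have PG' : ~ (sw23 @^-1` G) (sw23 P) by rewrite /= sw23K.
  exact: (cone_y_nu_drop (newton_data_sw23 nd) P0' PG' h c).
Qed.

(** The part of [nu_drop_bound] that is proved by cases, up to permutations of
    the coordinates. *)
Definition drop_bound G (P : R * R * R) := ~ G P -> let D := pjoin G P `\` G in
  origin_count P <= nu_drop D /\ (nu_drop D = origin_count P -> pyramidal D P).

Lemma drop_bound_sw12 G A P : newton_data G A -> nonneg3 P ->
  drop_bound (sw12 @^-1` G) (sw12 P) -> drop_bound G P.
Proof.
move=> nd P0 H PG; have [|] := H; first by rewrite /= sw12K.
rewrite pjoin_sw12 (_ : _ `\` _ = sw12 @^-1` (pjoin G P `\` G)) // nu_drop_sw12; last exact: (small3_diff nd P0).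
rewrite (_ : origin_count (sw12 P) = origin_count P); last by rewrite /origin_count /= andbCA.
by move=> h1 h2; split=> // /h2; exact: pyramidal_sw12.
Qed.

Lemma drop_bound_sw23 G A P : newton_data G A -> nonneg3 P ->
  drop_bound (sw23 @^-1` G) (sw23 P) -> drop_bound G P.
Proof.
move=> nd P0 H PG; have [|] := H; first by rewrite /= sw23K.
rewrite pjoin_sw23 (_ : _ `\` _ = sw23 @^-1` (pjoin G P `\` G)) // nu_drop_sw23; last exact: (small3_diff nd P0).
rewrite (_ : origin_count (sw23 P) = origin_count P); last by rewrite /origin_count /= (andbC (P.2 == 0)).
by move=> h1 h2; split=> // /h2; exact: pyramidal_sw23.
Qed.

Lemma drop_bound_plane G A k n : newton_data G A -> (0 < k)%N -> (0 < n)%N ->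
  drop_bound G (k%:R, 0, n%:R).
Proof.
move=> nd k0 n0 PG; have [h1 h2] := nu_drop_plane nd k0 n0 PG.
rewrite /origin_count /= (gt_eqF (_ : 0 < k%:R)) ?ltr0n //=.
by split=> // /h2 h; constructor 2.
Qed.

Lemma drop_bound_axis G A n : newton_data G A -> (0 < n)%N -> drop_bound G (0, 0, n%:R).
Proof.
move=> nd n0 PG; have [h1 h2] := nu_drop_axis nd n0 PG.
rewrite /origin_count /= (gt_eqF (_ : 0 < n%:R)) ?ltr0n // !andbF.
by split=> // /h2[_ [h|h]]; [constructor 2|constructor 1].
Qed.

Lemma drop_bound_unit G A : newton_data G A -> G (0, 1, 0) -> drop_bound G (0, 0, 0).
Proof.
move=> nd Gy PG.
have P0 : nonneg3 (0 : R, 0 : R, 0 : R) by split; exact: lexx.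
have py : pyramidal (pjoin G (0, 0, 0) `\` G) (0, 0, 0).
  by constructor 2; split=> //; apply: (unit_cone nd P0 PG).
by rewrite /= (pyramidal_nu_drop nd P0 PG py) lexx.
Qed.

Lemma drop_bound_origin G A : newton_data G A -> drop_bound G (0, 0, 0).
Proof.
move=> nd; have P0 : nonneg3 (0 : R, 0 : R, 0 : R) by split; exact: lexx.
have [Gy|Gy] := pselect (G (0, 1, 0)); first exact: (drop_bound_unit nd).
have [Gx|Gx] := pselect (G (1, 0, 0)).
  by apply: (drop_bound_sw12 nd P0); apply: (drop_bound_unit (newton_data_sw12 nd)).
have [Gz|Gz] := pselect (G (0, 0, 1)).
  by apply: (drop_bound_sw23 nd P0); apply: (drop_bound_unit (newton_data_sw23 nd)).
move=> PG; have h := nu_drop_origin nd PG Gx Gy Gz.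
rewrite /origin_count /= eqxx /=; split; first exact: ltW.
by move=> e; rewrite e ltxx in h.
Qed.

Theorem nu_drop_bound G A (p : nat * nat * nat) : newton_data G A -> ~ G (emb p) ->
  let D := pjoin G (emb p) `\` G in
  origin_count (emb p) <= nu_drop D /\
  (nu_drop D = origin_count (emb p) <-> pyramidal D (emb p)).
Proof.
move=> nd PG D; have P0 : nonneg3 (emb p : R * R * R) by exact: emb_ge0.
suff : drop_bound G (emb p).
  move=> /(_ PG)[h1 h2]; split=> //; split=> //; exact: (pyramidal_nu_drop nd P0 PG).
have nd12 := newton_data_sw12 nd; have nd23 := newton_data_sw23 nd.
case: p @D PG P0 => [[x y] z] D PG P0; rewrite /emb /= in PG P0 *.
case: x D PG P0 => [|x]; case: y => [|y]; case: z => [|z] D PG P0.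
- exact: (drop_bound_origin nd).
- exact: (drop_bound_axis nd).
- by apply: (drop_bound_sw23 nd P0); exact: (drop_bound_axis nd23).
- by apply: (drop_bound_sw12 nd P0); exact: (drop_bound_plane nd12).
- apply: (drop_bound_sw12 nd P0); apply: (drop_bound_sw23 nd12); first by [].
  exact: (drop_bound_axis (newton_data_sw23 nd12)).
- exact: (drop_bound_plane nd).
- by apply: (drop_bound_sw23 nd P0); exact: (drop_bound_plane nd23).
- have P3 : pos3 (x.+1%:R : R, y.+1%:R : R, z.+1%:R : R) by split; rewrite /= ltr0n.
  move=> _; have h := nu_drop_interior nd P0 PG P3.
  rewrite /origin_count /= (gt_eqF (_ : 0 < x.+1%:R)) ?ltr0n //=; split; first exact: ltW.
  by move=> e; rewrite e ltxx in h.
Qed.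

End bound.

(** * From row vectors to triples *)

Section coordinates.
Context {R : realType}.
Implicit Types (G : set (R * R * R)) (A : seq (nat * nat * nat)).

Lemma convex_setP (S : set 'rV[R]_3) : @convex_set R 'rV[R]_3 S <->
  forall x y t, 0 <= t <= 1 -> S x -> S y -> S ((1 - t) *: x + t *: y).
Proof.
split=> [cS x y t /andP[t0 t1] Sx Sy|cS x y l].
  have := cS y x (Itv01 t0 t1); rewrite !inE => /(_ Sy Sx).
  by rewrite addrC.
rewrite !inE => Sx Sy; have := cS y x l%:num; rewrite addrC; apply=> //.
by rewrite ge0 le1.
Qed.

Definition simplex_form (M : nat) : R * R * R := (M%:R^-1, M%:R^-1, M%:R^-1).
Definition unit_points (M : nat) : seq (nat * nat * nat) :=
  [:: (M, 0%N, 0%N); (0%N, M, 0%N); (0%N, 0%N, M)].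

Lemma newton_data_base M : (0 < M)%N ->
  newton_data (hpoly [:: simplex_form M]) (unit_points M).
Proof.
move=> M0; have M0' : 0 < M%:R :> R by rewrite ltr0n.
have evE v : ev (simplex_form M) v = M%:R^-1 * (v.1.1 + v.1.2 + v.2) by rewrite /ev /=; ring.
split.
- move=> a aA; split; first exact: emb_ge0.
  move=> f; rewrite inE => /eqP ->; rewrite evE.
  by move: aA; rewrite !inE => /orP[/eqP ->|/orP[/eqP ->|/eqP ->]]; rewrite /= ?addr0 ?add0r mulVf // gt_eqF.
- move=> al c [al1 al2 al3] h v [[v1 v2 v3]]; move=> /(_ _ (mem_head _ _)).
  rewrite evE ler_pdivlMl // mulr1 => hv.
  have c1 := h (M, 0%N, 0%N); have c2 := h (0%N, M, 0%N); have c3 := h (0%N, 0%N, M).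
  rewrite !inE !eqxx ?orbT /ev /= !mulr0 ?addr0 ?add0r in c1 c2 c3.
  have {}c1 := c1 isT; have {}c2 := c2 isT; have {}c3 := c3 isT.
  have [c0|c0] := leP c 0.
    by apply: (le_trans c0); rewrite !addr_ge0 // mulr_ge0.
  have d1 : c / M%:R <= al.1.1 by rewrite ler_pdivrMr.
  have d2 : c / M%:R <= al.1.2 by rewrite ler_pdivrMr.
  have d3 : c / M%:R <= al.2 by rewrite ler_pdivrMr.
  apply: (@le_trans _ _ (c / M%:R * (v.1.1 + v.1.2 + v.2))).
    by rewrite -mulrA ler_pMr // ler_pdivlMl // mulr1.
  by rewrite !mulrDr /ev !lerD // ler_wpM2r.
- by exists M; rewrite !inE !eqxx !orbT.
- exists [:: simplex_form M] => // f; rewrite inE => /eqP ->.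
  by split; rewrite /= invr_gt0.
Qed.

Lemma newton_data_foldr G A L : newton_data G A ->
  newton_data (foldr (fun c H => pjoin H (emb c)) G L) (L ++ A).
Proof. by move=> nd; elim: L => //= c L IH; exact: newton_data_pjoin. Qed.

(** An enumeration of the three coordinates; the coordinate planes are treated
    alike by putting them in the position of [y = 0]. *)
Record frame (j0 j1 j2 : 'I_3) : Prop := Frame {
  frame01 : j0 != j1; frame02 : j0 != j2; frame12 : j1 != j2;
  frameT : forall i, [\/ i = j0, i = j1 | i = j2] }.

Section frames.
Variables (j0 j1 j2 : 'I_3).
Hypothesis fr : frame j0 j1 j2.

Definition of_triple (p : R * R * R) : 'rV[R]_3 :=
  \row_i (if i == j0 then p.1.1 else if i == j1 then p.1.2 else p.2).
Definition to_triple T (x : 'rV[T]_3) : T * T * T := (x 0 j0, x 0 j1, x 0 j2).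

Lemma of_tripleE p : [/\ of_triple p 0 j0 = p.1.1, of_triple p 0 j1 = p.1.2 &
  of_triple p 0 j2 = p.2].
Proof.
have [h1 h2 h3 _] := fr; rewrite !mxE !eqxx.
by rewrite [j1 == j0]eq_sym [j2 == j0]eq_sym [j2 == j1]eq_sym !ifN.
Qed.

Lemma of_tripleK : cancel of_triple (@to_triple R).
Proof. by move=> [[x y] z]; rewrite /to_triple; have [-> -> ->] := of_tripleE (x, y, z). Qed.

Lemma row_ext T (x y : 'rV[T]_3) : to_triple x = to_triple y -> x = y.
Proof.
case=> h1 h2 h3; apply/rowP => i.
by have [->|->|->] := frameT fr i.
Qed.

Lemma to_tripleK : cancel (@to_triple R) of_triple.
Proof. by move=> x; apply: row_ext; rewrite of_tripleK. Qed.

Lemma of_triple_mix r p q : of_triple (mix r p q) = (1 - r) *: of_triple p + r *: of_triple q.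
Proof.
apply/rowP => i; rewrite !mxE.
by case: ifP => // _; case: ifP.
Qed.

Lemma to_triple_mix r x y :
  to_triple ((1 - r) *: x + r *: y : 'rV[R]_3) = mix r (to_triple x) (to_triple y).
Proof. by apply: eq3; rewrite /= !mxE. Qed.

Lemma to_lattice (a : 'rV[nat]_3) : to_triple (lattice_point R a) = emb (to_triple a).
Proof. by apply: eq3; rewrite /= !mxE. Qed.

Lemma orthantE x : @orthant R 3 x <-> nonneg3 (to_triple x).
Proof.
split=> [h|[h0 h1 h2] i]; first by split; exact: h.
by have [->|->|->] := frameT fr i.
Qed.

Definition in_frame (G : set 'rV[R]_3) : set (R * R * R) := of_triple @^-1` G.

Lemma in_frameE (G : set 'rV[R]_3) x : in_frame G (to_triple x) = G x.
Proof. by rewrite /in_frame /= to_tripleK. Qed.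

Definition convex3 (S : set (R * R * R)) :=
  forall p q t, 0 <= t <= 1 -> S p -> S q -> S (mix t p q).

Lemma hull_sub (S : set 'rV[R]_3) (H : set (R * R * R)) : convex3 H ->
  (forall x, S x -> H (to_triple x)) -> in_frame (convex_hull S) `<=` H.
Proof.
move=> cH SH p Cp.
have := smallest_sub (C := @convex_set R 'rV[R]_3) (G := S) (X := [set x | H (to_triple x)]).
move=> h; rewrite -(of_tripleK p); apply: (h _ SH _ Cp).
by apply/convex_setP => x y t t01 /= Hx Hy; rewrite to_triple_mix; exact: cH.
Qed.

Lemma hull_convex (S : set 'rV[R]_3) : convex3 (in_frame (convex_hull S)).
Proof.
move=> p q t t01 /= hp hq X [cX SX]; rewrite of_triple_mix.
by have /convex_setP := cX; apply=> //; [exact: hp|exact: hq].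
Qed.

Lemma sub_hull (S : set 'rV[R]_3) x : S x -> in_frame (convex_hull S) (to_triple x).
Proof. by move=> Sx; rewrite in_frameE; exact: sub_gen_smallest. Qed.

Section newton.
Variable A : set 'rV[nat]_3.
Let S : set 'rV[R]_3 := \bigcup_(a in A) [set lattice_point R a + v | v in @orthant R 3].
Let G := convex_hull S.
Let g := in_frame G.

Lemma generators_up (H : set (R * R * R)) : (forall a, A a -> H (emb (to_triple a))) ->
  (forall p q, H p -> le3 p q -> H q) -> forall x, S x -> H (to_triple x).
Proof.
move=> HA Hup _ [a Aa [v /orthantE[v0 v1 v2] <-]].
apply: (Hup (emb (to_triple a))); first exact: HA.
by split; rewrite /= !mxE lerDl.
Qed.

(** The points whose translated orthant is contained in the hull form a convex
    set that contains the generators. *)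
Lemma hull_up p q : g p -> le3 p q -> g q.
Proof.
pose H := [set p | forall q, le3 p q -> g q].
suff HG : g `<=` H by move=> /HG; apply.
apply: hull_sub.
  move=> p1 p2 t /andP[t0 t1] H1 H2 w [w1 w2 w3].
  pose d : R * R * R := (w.1.1 - (mix t p1 p2).1.1, w.1.2 - (mix t p1 p2).1.2, w.2 - (mix t p1 p2).2).
  have -> : w = mix t (add3 p1 d) (add3 p2 d) by apply: eq3; rewrite /=; ring.
  apply: hull_convex; first by rewrite t0.
    by apply: H1; split; rewrite /= lerDl subr_ge0.
  by apply: H2; split; rewrite /= lerDl subr_ge0.
move=> _ [a Aa [v /orthantE[v0 v1 v2] <-]] w [w1 w2 w3].
rewrite -(of_tripleK w); apply: sub_hull; exists a => //.
exists (of_triple w - lattice_point R a); last by rewrite addrC subrK.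
have [e1 e2 e3] := of_tripleE w.
have aw : le3 (emb (to_triple a)) w.
  by split; [apply: le_trans w1|apply: le_trans w2|apply: le_trans w3]; rewrite /= !mxE lerDl.
case: aw => a1 a2 a3; apply/orthantE.
rewrite /to_triple; split; rewrite /= [fun_of_matrix (_ - _) _ _]mxE ?e1 ?e2 ?e3;
  by rewrite !mxE subr_ge0.
Qed.

Let emb_le (a b : nat * nat * nat) : (a.1.1 <= b.1.1)%N -> (a.1.2 <= b.1.2)%N -> (a.2 <= b.2)%N ->
  le3 (emb a) (emb b : R * R * R).
Proof. by move=> h1 h2 h3; split; rewrite /= ler_nat. Qed.

Lemma gen_in a : A a -> g (emb (to_triple a)).
Proof.
move=> Aa; rewrite -to_lattice; apply: sub_hull; exists a => //; exists 0; last by rewrite addr0.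
by move=> i; rewrite mxE.
Qed.

(** A generator lies on every coordinate axis that [G] meets: otherwise the sum of
    the other two coordinates would be at least one on [G]. *)
Lemma axis_generator (al : R * R * R) : (exists2 x, G x & ev al (to_triple x) = 0) ->
  nonneg3 al -> exists2 a, A a & ev al (emb (to_triple a)) < 1.
Proof.
move=> [x Gx x0] [al1 al2 al3]; apply: contrapT => /forall2NP h.
have : 1 <= ev al (to_triple x).
  have /(_ (to_triple x)) : g `<=` [set p | 1 <= ev al p].
    apply: hull_sub.
      by move=> p q t /andP[t0 t1] /= hp hq; rewrite ev_mix; nra.
    apply: generators_up.
      by move=> a Aa /=; have [//|/negP] := h a; rewrite -leNgt.
    move=> p q hp [q1 q2 q3]; apply: (le_trans hp).
    by rewrite /ev !lerD // ler_wpM2l.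
  by apply; rewrite /g in_frameE.
by rewrite x0 ler10.
Qed.

(** The hull is obtained from the region above a large simplex by joining, one
    at a time, the finitely many lattice points of the hull in a box. The
    generators outside this box are above vertices of the simplex. *)
Theorem newton_data_hull : convenient G -> exists L, newton_data g L.
Proof.
move=> conv.
have lt1 m n : m%:R + n%:R < 1 :> R -> m = 0%N /\ n = 0%N.
  by rewrite -natrD -[1]/1%:R ltr_nat; case: m => [|m]; case: n.
have [h1 h2 h3 _] := fr.
have [a aA a0] : exists2 a, A a & (to_triple a).1.2 = 0%N /\ (to_triple a).2 = 0%N.
  have [||a aA e] := @axis_generator (0, 1, 1); last 1 first.
  - by exists a => //; apply: lt1; move: e; rewrite /ev /= mul0r add0r !mul1r.
  - have [x [Gx xj]] := conv j0; exists x => //.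
    by rewrite /ev /= mul0r add0r !mul1r !xj ?addr0 // eq_sym.
  - by split; rewrite /= ?lexx ?ler01.
have [b bA b0] : exists2 b, A b & (to_triple b).1.1 = 0%N /\ (to_triple b).2 = 0%N.
  have [||b bA e] := @axis_generator (1, 0, 1); last 1 first.
  - by exists b => //; apply: lt1; move: e; rewrite /ev /= mul0r addr0 !mul1r.
  - have [x [Gx xj]] := conv j1; exists x => //.
    by rewrite /ev /= mul0r addr0 !mul1r !xj ?addr0 // eq_sym.
  - by split; rewrite /= ?lexx ?ler01.
have [c cA c0] : exists2 c, A c & (to_triple c).1.1 = 0%N /\ (to_triple c).1.2 = 0%N.
  have [||c cA e] := @axis_generator (1, 1, 0); last 1 first.
  - by exists c => //; apply: lt1; move: e; rewrite /ev /= mul0r addr0 !mul1r.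
  - have [x [Gx xj]] := conv j2; exists x => //.
    by rewrite /ev /= mul0r addr0 !mul1r !xj ?addr0.
  - by split; rewrite /= ?lexx ?ler01.
pose M := ((to_triple a).1.1 + (to_triple b).1.2 + (to_triple c).2).+1.
have aM : ((to_triple a).1.1 <= M)%N by rewrite /M; lia.
have bM : ((to_triple b).1.2 <= M)%N by rewrite /M; lia.
have cM : ((to_triple c).2 <= M)%N by rewrite /M; lia.
have gM c' : c' \in unit_points M -> g (emb c').
  rewrite !inE => /orP[/eqP ->|/orP[/eqP ->|/eqP ->]].
  - by apply: (hull_up (gen_in aA)); apply: emb_le; rewrite ?a0.1 ?a0.2.
  - by apply: (hull_up (gen_in bA)); apply: emb_le; rewrite ?b0.1 ?b0.2.
  - by apply: (hull_up (gen_in cA)); apply: emb_le; rewrite ?c0.1 ?c0.2.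
pose box : seq (nat * nat * nat) :=
  [seq (xy, z) | xy <- [seq (x, y) | x <- iota 0 M, y <- iota 0 M], z <- iota 0 M].
pose L := [seq c' <- box | `[< g (emb c') >]].
pose H := foldr (fun c' H => pjoin H (emb c')) (hpoly [:: simplex_form M]) L.
have nd0 : newton_data (hpoly [:: simplex_form M]) (unit_points M) by exact: newton_data_base.
have nd : newton_data H (L ++ unit_points M) by exact: newton_data_foldr.
suff -> : g = H by exists (L ++ unit_points M).
have M0 : 0 < M%:R :> R by rewrite ltr0n.
apply/seteqP; split.
  apply: hull_sub; first by move=> p q t t01; exact: (newton_mix nd).
  apply: generators_up; last by move=> p q; exact: (newton_up nd).
  move=> a' Aa'.
  have unit_le c' : c' \in unit_points M -> le3 (emb c') (emb (to_triple a') : R * R * R) -> H (emb (to_triple a')).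
    by move=> cu; apply: (newton_up nd); apply: (newton_gen nd); rewrite mem_cat cu orbT.
  have [big1|small1] := leqP M (to_triple a').1.1.
    by apply: (unit_le (M, 0%N, 0%N)); [rewrite !inE eqxx|exact: emb_le].
  have [big2|small2] := leqP M (to_triple a').1.2.
    by apply: (unit_le (0%N, M, 0%N)); [rewrite !inE eqxx orbT|exact: emb_le].
  have [big3|small3] := leqP M (to_triple a').2.
    by apply: (unit_le (0%N, 0%N, M)); [rewrite !inE eqxx !orbT|exact: emb_le].
  apply: (newton_gen nd); rewrite mem_cat mem_filter; apply/orP; left; apply/andP; split.
    by apply/asboolP; exact: gen_in.
  apply/allpairsPdep; exists (to_triple a').1, (to_triple a').2; split=> //.
    apply/allpairsPdep; exists (to_triple a').1.1, (to_triple a').1.2.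
    by split=> //; rewrite mem_iota.
  by rewrite mem_iota.
have gc c' : c' \in L -> g (emb c') by rewrite mem_filter => /andP[/asboolP].
rewrite /H; elim: (L) gc => [_|c' L' IH gc] /=.
  move=> v [[v1 v2 v3]] /(_ _ (mem_head _ _)).
  have -> : ev (simplex_form M) v = M%:R^-1 * (v.1.1 + v.1.2 + v.2) by rewrite /ev /=; ring.
  rewrite ler_pdivlMl // mulr1; set s := _ + _ + _ => sM.
  have s0 : 0 < s by exact: lt_le_trans sM.
  pose xs := v.1.1 / s; pose ys := v.1.2 / s; pose zs := v.2 / s.
  have xs0 : 0 <= xs by rewrite divr_ge0 // ltW.
  have ys0 : 0 <= ys by rewrite divr_ge0 // ltW.
  have zs0 : 0 <= zs by rewrite divr_ge0 // ltW.
  have sum : xs + ys + zs = 1 by rewrite /xs /ys /zs -!mulrDl divff // gt_eqF.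
  have gw : g (xs * M%:R, ys * M%:R, zs * M%:R).
    have [z1|z1] := eqVneq zs 1.
      have -> : (xs * M%:R, ys * M%:R, zs * M%:R) = emb (0%N, 0%N, M).
        by apply: eq3; rewrite /= ?z1 ?mul1r //; apply/eqP; rewrite mulf_eq0; apply/orP; left; apply/eqP; lra.
      by apply: gM; rewrite !inE eqxx !orbT.
    have d0 : 0 < 1 - zs by rewrite subr_gt0 lt_neqAle z1 /=; lra.
    have -> : (xs * M%:R, ys * M%:R, zs * M%:R) =
        mix zs (mix (ys / (1 - zs)) (emb (M, 0%N, 0%N)) (emb (0%N, M, 0%N))) (emb (0%N, 0%N, M)).
      have xE : xs = 1 - zs - ys by lra.
      by apply: eq3; rewrite /= ?xE; field; rewrite gt_eqF.
    apply: hull_convex; first by lra.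
      apply: hull_convex; first by rewrite divr_ge0 ?(ltW d0) //= ler_pdivrMr // mul1r; lra.
        by apply: gM; rewrite !inE eqxx.
      by apply: gM; rewrite !inE eqxx orbT.
    by apply: gM; rewrite !inE eqxx !orbT.
  apply: (hull_up gw).
  by split; rewrite /= mulrAC ler_pdivrMr // ler_wpM2l.
have {}IH := IH (fun d dL => gc d (mem_behead (s := c' :: L') dL)).
move=> v [r [q [r01 /IH gq ->]]]; apply: hull_convex => //.
by apply: gc; rewrite mem_head.
Qed.

End newton.
End frames.

End coordinates.

Section joins.
Context {R : realType}.
Implicit Types (G : set (R * R * R)) (A : seq (nat * nat * nat)).

Section join.
Variables (j0 j1 j2 : 'I_3).
Hypothesis fr : frame j0 j1 j2.
Local Notation tri := (to_triple j0 j1 j2).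
Local Notation inF := (in_frame j0 j1).

Variables (G : set 'rV[R]_3) (L : seq (nat * nat * nat)).
Hypothesis nd : newton_data (inF G) L.
Variable P : 'rV[nat]_3.
Let GP := convex_hull (G `|` [set lattice_point R P]).

Lemma in_frame_join : inF GP = pjoin (inF G) (emb (tri P)).
Proof.
have P0 : nonneg3 (emb (tri P) : R * R * R) by exact: emb_ge0.
apply/seteqP; split.
  apply: (hull_sub fr); first by move=> p q t t01; exact: (pjoin_mix nd P0).
  move=> x [Gx|->]; first by apply: pjoin_sub; rewrite (in_frameE fr).
  by rewrite to_lattice; apply: pjoin_apex; exact: (newton_neq0 nd).
move=> v [r [q [r01 Gq ->]]]; apply: hull_convex => //.
  by rewrite -to_lattice; apply: sub_hull => //; right.
by rewrite -(of_tripleK fr q); apply: sub_hull => //; left.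
Qed.

Lemma newton_join : newton_polyhedron G -> newton_polyhedron GP.
Proof.
move=> [A GE]; exists (A `|` [set P]).
have cH (S : set 'rV[R]_3) : @convex_set R 'rV[R]_3 (convex_hull S).
  apply/convex_setP => x y t t01 Sx Sy; rewrite -(in_frameE fr) to_triple_mix.
  by apply: hull_convex => //; rewrite (in_frameE fr).
apply/seteqP; split; apply: smallest_sub; try exact: cH.
  move=> x [Gx|->].
    move: x Gx; rewrite GE; apply: smallest_sub; first exact: cH.
    by move=> y [a Aa h]; apply: sub_gen_smallest; exists a => //; left.
  apply: sub_gen_smallest; exists P; first by right.
  by exists 0; [move=> i; rewrite mxE|rewrite addr0].
move=> x [a [Aa|->]] h.
  by apply: sub_gen_smallest; left; rewrite GE; apply: sub_gen_smallest; exists a.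
have [v /(orthantE fr)[v1 v2 v3] <-] := h.
rewrite -(in_frameE fr) in_frame_join.
have P0 : nonneg3 (emb (tri P) : R * R * R) by exact: emb_ge0.
apply: (pjoin_up nd P0 (v := emb (tri P))).
  by apply: pjoin_apex; exact: (newton_neq0 nd).
by split; rewrite /= !mxE lerDl.
Qed.

Lemma convenient_join : convenient G -> convenient GP.
Proof.
by move=> cG i; have [x [Gx xi]] := cG i; exists x; split=> //; apply: sub_gen_smallest; left.
Qed.

End join.

End joins.

(** * The Newton number through closures *)

Section boundary.
Context {R : realType}.
Local Notation mu1 := (@lebesgue_measure R).
Local Notation mu2 := ((@lebesgue_measure R \x @lebesgue_measure R)%E).
Local Notation mu3 := (((@lebesgue_measure R \x @lebesgue_measure R) \x @lebesgue_measure R)%E).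
Local Notation R3 := (measurableTypeR R * measurableTypeR R * measurableTypeR R)%type.
Implicit Types (G : set (R * R * R)) (A : seq (nat * nat * nat)).

Lemma len_subsingleton (L : set R) : (forall t t', L t -> L t' -> t = t') -> mu1 L = 0%E.
Proof.
move=> h; have [[t Lt]|nL] := pselect (L !=set0); last first.
  suff -> : L = set0 by exact: measure0.
  by apply/seteqP; split=> // t Lt; apply: nL; exists t.
have -> : L = [set t] by apply/seteqP; split=> [t' Lt'|_ ->//]; exact: h.
exact: lebesgue_measure_set1.
Qed.

(** A bounded set on which no two points are comparable, such as the Newton
    boundary, meets each line parallel to an axis at most once: neither its
    volume nor the area or length of its traces counts. *)
Lemma nu_drop_antichain (N : set (R * R * R)) : small3 N ->
  (forall v v', N v -> N v' -> le3 v v' -> v = v') -> nu_drop N = 0.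
Proof.
move=> sN anti; have [mN _] := sN.
have chain v v' : N v -> N v' -> le3 v v' \/ le3 v' v -> v = v'.
  by move=> Nv Nv' [h|h]; [|apply/esym]; exact: anti.
have area_0 (B : set (R * R)) : (forall x y y', B (x, y) -> B (x, y') -> y = y') -> area B = 0.
  move=> h; rewrite /area (_ : mu2 B = 0%E) //.
  etransitivity; first exact: (@product_measure_xsection R _ _ _ _ mu1 mu1 B).
  by apply: integral0_eq => x _; apply: len_subsingleton => y y'; exact: h.
have cmp (a b : R) : a <= b \/ b <= a by have [?|/ltW ?] := leP a b; [left|right].
have vol_0 : vol N = 0.
  rewrite /vol (_ : mu3 N = 0%E) // lebesgue3_xsection //.
  apply: integral0_eq => -[x y] _; apply: len_subsingleton => z z' h h'.
  have : (x, y, z) = (x, y, z') by apply: chain => //; case: (cmp z z'); [left|right]; split.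
  by case.
have px : area (plane_x N) = 0.
  apply: area_0 => x z z' h h'.
  have : (0 : R, x, z) = (0 : R, x, z') by apply: chain => //; case: (cmp z z'); [left|right]; split.
  by case.
have py : area (plane_y N) = 0.
  apply: area_0 => x z z' h h'.
  have : (x, 0 : R, z) = (x, 0 : R, z') by apply: chain => //; case: (cmp z z'); [left|right]; split.
  by case.
have pz : area (plane_z N) = 0.
  apply: area_0 => x z z' h h'.
  have : (x, z, 0 : R) = (x, z', 0 : R) by apply: chain => //; case: (cmp z z'); [left|right]; split.
  by case.
have ax : len (axis_x N) = 0.
  rewrite /len (@len_subsingleton (axis_x N)) // => z z' h h'.
  have : (z, 0 : R, 0 : R) = (z', 0 : R, 0 : R) by apply: chain => //; case: (cmp z z'); [left|right]; split.
  by case.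
have ay : len (axis_y N) = 0.
  rewrite /len (@len_subsingleton (axis_y N)) // => z z' h h'.
  have : (0 : R, z, 0 : R) = (0 : R, z', 0 : R) by apply: chain => //; case: (cmp z z'); [left|right]; split.
  by case.
have az : len (axis_z N) = 0.
  rewrite /len (@len_subsingleton (axis_z N)) // => z z' h h'.
  have : (0 : R, 0 : R, z) = (0 : R, 0 : R, z') by apply: chain => //; case: (cmp z z'); [left|right]; split.
  by case.
by rewrite /nu_drop vol_0 px py pz ax ay az !addr0 !mulr0 subr0.
Qed.

(** For [K] the orthant or a join, and [s] the forms of a Newton polyhedron that
    matter on [K], [sbelow K s] is the difference of [K] and this polyhedron,
    and [below K s] its closure. *)
Definition below (K : set (R * R * R)) (s : seq (R * R * R)) : set (R * R * R) :=
  [set v | K v /\ exists2 a, a \in s & ev a v <= 1].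
Definition sbelow (K : set (R * R * R)) (s : seq (R * R * R)) : set (R * R * R) :=
  [set v | K v /\ exists2 a, a \in s & ev a v < 1].

Lemma nonneg3_hpoly : nonneg3 = hpoly [::] :> set (R * R * R).
Proof. by apply/seteqP; split=> [v h|v []]. Qed.

Lemma measurable_below s : pos_forms s -> measurable (below nonneg3 s : set R3).
Proof.
move=> ps; rewrite (_ : below _ s = (nonneg3 : set R3) `&`
    [set v | exists2 a, a \in s & ev a v <= 1]) //.
rewrite nonneg3_hpoly.
apply: measurableI; first exact: measurable_hpoly.
elim: s {ps} => [|a s IH].
  by rewrite (_ : [set _ | _] = set0) //; apply/seteqP; split=> // v [].
rewrite (_ : [set _ | _] = [set v : R3 | ev a v <= 1] `|`
    [set v : R3 | exists2 a, a \in s & ev a v <= 1]).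
  apply: measurableU => //; apply: measurable_le_set; last exact: measurable_cst.
  by apply: measurable_funD; first apply: measurable_funD;
    apply: measurable_funM => //; [exact: measurable_proj1|exact: measurable_proj2].
apply/seteqP; split=> v.
  by move=> [b]; rewrite inE => /orP[/eqP ->|bs] h; [left|right; exists b].
move=> [h|[b bs h]]; first by exists a => //; rewrite mem_head.
by exists b => //; rewrite inE bs orbT.
Qed.

Section under.
Variables (g : set (R * R * R)) (A : seq (nat * nat * nat)).
Hypothesis nd : newton_data g A.
Variable s : seq (R * R * R).
Hypotheses (ps : pos_forms s) (Es : g = hpoly s).

Lemma sbelow_nonneg : sbelow nonneg3 s = nonneg3 `\` g.
Proof.
apply/seteqP; split=> v.
  move=> [v0 [a a_s av]]; split=> //; rewrite Es => -[_ /(_ a a_s)].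
  by rewrite leNgt av.
by move=> [v0 nG]; split=> //; apply: notin_hpoly => //; rewrite -Es.
Qed.

Lemma small3_under : small3 (nonneg3 `\` g) /\ small3 (below nonneg3 s).
Proof.
have [M hM] := newton_bound nd.
split.
  split; last by exists M => v [v0 nG]; exact: hM.
  rewrite nonneg3_hpoly.
  by apply: measurableD; [exact: measurable_hpoly|exact: (measurable_newton nd)].
split; first exact: measurable_below.
exists (M + M) => v [[v1 v2 v3] [a a_s av]].
have [] := hM (v.1.1 / 2, v.1.2 / 2, v.2 / 2).
- by split; rewrite /= divr_ge0.
- rewrite Es => -[_ /(_ a a_s)]; apply/negP; rewrite -ltNge.
  have -> : ev a (v.1.1 / 2, v.1.2 / 2, v.2 / 2) = ev a v / 2 by rewrite /ev /=; ring.
  by rewrite ltr_pdivrMr // mul1r (le_lt_trans av) // ltr1n.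
- move=> /= /andP[_ h1] /andP[_ h2] /andP[_ h3].
  by rewrite !ler_pdivrMr // !mulr_natr !mulr2n in h1 h2 h3; rewrite v1 v2 v3 h1 h2 h3.
Qed.

(** The points added are on the Newton boundary, where [nu_drop_antichain]
    applies. *)
Lemma nu_drop_below : nu_drop (below nonneg3 s) = nu_drop (nonneg3 `\` g).
Proof.
have [sZ sU] := small3_under.
have ZU : nonneg3 `\` g `<=` below nonneg3 s.
  by rewrite -sbelow_nonneg => v [v0 [a a_s av]]; split=> //; exists a => //; exact: ltW.
have -> : below nonneg3 s = (nonneg3 `\` g) `|` (below nonneg3 s `\` (nonneg3 `\` g)).
  by rewrite setDUK.
have sN : small3 (below nonneg3 s `\` (nonneg3 `\` g)).
  by apply: (small3S _ _ sU); [apply: measurableD; [case: sU|case: sZ]|exact: subDsetl].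
rewrite nu_dropU //; last by rewrite setDE setICA setICr setI0.
rewrite [X in _ + X]nu_drop_antichain ?addr0 // => v v' [[v0 _] nv] [[v0' [a a_s av]] _] vv.
have Gv : g v by apply: contrapT => nG; apply: nv.
have [a1 a2 a3] := ps a_s.
have av1 : 1 <= ev a v by move: Gv; rewrite Es => -[_]; exact.
have := le_trans av av1; case: vv => h1 h2 h3.
rewrite /ev => h.
have d1 : 0 <= a.1.1 * (v'.1.1 - v.1.1) by rewrite mulr_ge0 ?subr_ge0 // ltW.
have d2 : 0 <= a.1.2 * (v'.1.2 - v.1.2) by rewrite mulr_ge0 ?subr_ge0 // ltW.
have d3 : 0 <= a.2 * (v'.2 - v.2) by rewrite mulr_ge0 ?subr_ge0 // ltW.
have e1 : a.1.1 * (v'.1.1 - v.1.1) = 0 by lra.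
have e2 : a.1.2 * (v'.1.2 - v.1.2) = 0 by lra.
have e3 : a.2 * (v'.2 - v.2) = 0 by lra.
move: e1 e2 e3 => /eqP + /eqP + /eqP; rewrite !mulf_eq0 (gt_eqF a1) (gt_eqF a2) (gt_eqF a3) /= !subr_eq0.
by move=> /eqP e1 /eqP e2 /eqP e3; apply: eq3.
Qed.

End under.

End boundary.

Section closure.
Context {R : realType}.
Local Notation mu1 := (@lebesgue_measure R).
Local Notation mu2 := ((@lebesgue_measure R \x @lebesgue_measure R)%E).
Local Notation mu3 := (((@lebesgue_measure R \x @lebesgue_measure R) \x @lebesgue_measure R)%E).
Implicit Types (G : set (R * R * R)) (A : seq (nat * nat * nat)).

Section closures.
Variables (j0 j1 j2 : 'I_3).
Hypothesis fr : frame j0 j1 j2.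
Local Notation tri := (@to_triple j0 j1 j2 R).
Local Notation row := (@of_triple R j0 j1).
Local Notation inF := (in_frame j0 j1).

Lemma form_continuous a : continuous (fun x : 'rV[R]_3 => ev a (tri x)).
Proof.
have lin c j : continuous (fun x : 'rV[R]_3 => c * x 0 j).
  move=> x; apply: (@continuous_comp _ _ _ (fun x : 'rV[R]_3 => x 0 j) (fun y : R => c * y)).
    exact: coord_continuous.
  exact: mulrl_continuous.
by move=> x; exact: (cvgD (cvgD (lin a.1.1 j0 x) (lin a.1.2 j1 x)) (lin a.2 j2 x)).
Qed.

Lemma closed_form_le a c : closed [set x : 'rV[R]_3 | ev a (tri x) <= c].
Proof.
by apply: (@closed_comp _ _ _ [set y | y <= c]) => [x _|]; [exact: form_continuous|exact: closed_le].
Qed.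

Lemma closed_form_ge a c : closed [set x : 'rV[R]_3 | c <= ev a (tri x)].
Proof.
by apply: (@closed_comp _ _ _ [set y | c <= y]) => [x _|]; [exact: form_continuous|exact: closed_ge].
Qed.

Lemma open_form_lt a c : open [set x : 'rV[R]_3 | ev a (tri x) < c].
Proof.
by apply: (@open_comp _ _ _ [set y | y < c]) => [x _|]; [exact: form_continuous|exact: open_lt].
Qed.

Lemma open_form_gt a c : open [set x : 'rV[R]_3 | c < ev a (tri x)].
Proof.
by apply: (@open_comp _ _ _ [set y | c < y]) => [x _|]; [exact: form_continuous|exact: open_gt].
Qed.

Lemma closed_hpoly s : closed [set x : 'rV[R]_3 | hpoly s (tri x)].
Proof.
have -> : [set x | hpoly s (tri x)] = [set x | 0 <= ev (1, 0, 0) (tri x)] `&`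
    [set x | 0 <= ev (0, 1, 0) (tri x)] `&` [set x | 0 <= ev (0, 0, 1) (tri x)] `&`
    [set x | forall a, a \in s -> 1 <= ev a (tri x)].
  have E x : [/\ ev (1, 0, 0) (tri x) = (tri x).1.1, ev (0, 1, 0) (tri x) = (tri x).1.2 &
      ev (0, 0, 1) (tri x) = (tri x).2].
    by rewrite /ev /=; split; ring.
  apply/seteqP; split=> x; have [e1 e2 e3] := E x; rewrite /= ?e1 ?e2 ?e3.
    by move=> [[x1 x2 x3] hx].
  by move=> [[[x1 x2] x3] hx].
apply: closedI; first by apply: closedI; first apply: closedI; exact: closed_form_ge.
elim: s => [|a s IH].
  have -> : [set x | forall a, a \in [::] -> 1 <= ev a (tri x)] = setT by apply/seteqP; split.
  exact: closedT.
rewrite (_ : [set _ | _] = [set x | 1 <= ev a (tri x)] `&`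
    [set x | forall a, a \in s -> 1 <= ev a (tri x)]); first by apply: closedI; [exact: closed_form_ge|exact: IH].
apply/seteqP; split=> x.
  by move=> h; split=> [|b bs]; apply: h; rewrite inE ?eqxx // bs orbT.
by move=> [h h'] b; rewrite inE => /orP[/eqP ->|/h'].
Qed.

Lemma closed_below K s : closed [set x : 'rV[R]_3 | K (tri x)] ->
  closed [set x | below K s (tri x)].
Proof.
move=> cK; rewrite (_ : [set x | below K s (tri x)] = [set x | K (tri x)] `&`
  [set x | exists2 a, a \in s & ev a (tri x) <= 1]) //.
apply: closedI => //; elim: s => [|a s IH].
  have -> : [set x | exists2 a, a \in [::] & ev a (tri x) <= 1] = set0.
    by apply/seteqP; split=> // x [].
  exact: closed0.
rewrite (_ : [set _ | _] = [set x | ev a (tri x) <= 1] `|`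
    [set x | exists2 a, a \in s & ev a (tri x) <= 1]); first by apply: closedU; [exact: closed_form_le|exact: IH].
apply/seteqP; split=> x.
  by move=> [b]; rewrite inE => /orP[/eqP ->|bs] h; [left|right; exists b].
move=> [h|[b bs h]]; first by exists a => //; rewrite mem_head.
by exists b => //; rewrite inE bs orbT.
Qed.

Lemma segment_closure (S : set 'rV[R]_3) x y :
  (forall t, 0 < t <= 1 -> S ((1 - t) *: x + t *: y)) -> closure S x.
Proof.
move=> h B Bx.
pose f (t : R^o) : 'rV[R]_3 := (1 - t) *: x + t *: y.
have fc : continuous f.
  move=> t; apply: cvgD; apply: cvgZr_tmp.
    by apply: (@cvgB _ R^o); [exact: cvg_cst|exact: cvg_id].
  exact: cvg_id.
have f0 : f 0 = x by rewrite /f subr0 scale1r scale0r addr0.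
have : nbhs (0 : R^o) (f @^-1` B) by apply: fc; rewrite f0.
move=> /nbhs_ballP[e /= e0 he].
pose t := Num.min (e / 2) 1.
have t0 : 0 < t by rewrite lt_min divr_gt0 // ltr01.
have t1 : t <= 1 by rewrite ge_min lexx orbT.
exists (f t); split; first by apply: h; rewrite t0.
apply: he; rewrite /ball /= sub0r normrN gtr0_norm //.
by apply: (@le_lt_trans _ _ (e / 2)); [rewrite ge_min lexx|rewrite ltr_pdivrMr // ltr_pMr // ltr1n].
Qed.

(** The inequalities that hold strictly at some point [w] may be relaxed to get the
    closure, by moving slightly towards [w]. *)
Lemma closure_sbelow K s w : convex3 K -> closed [set x : 'rV[R]_3 | K (tri x)] -> K w ->
  (forall a, a \in s -> ev a w < 1) ->
  closure [set x : 'rV[R]_3 | sbelow K s (tri x)] = [set x | below K s (tri x)].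
Proof.
move=> cK clK Kw hw; apply/seteqP; split.
  have /closure_id E : closed [set x : 'rV[R]_3 | below K s (tri x)] by exact: closed_below.
  rewrite [X in _ `<=` X]E.
  by apply: closureS => x [Kx [a a_s ax]]; split=> //; exists a => //; exact: ltW.
move=> x [Kx [a a_s ax]]; apply: (@segment_closure _ x (row w)) => t /andP[t0 t1].
rewrite /= to_triple_mix (of_tripleK fr); split; first by apply: cK; rewrite // ltW.
exists a => //; rewrite ev_mix; have := hw a a_s => aw.
apply: (@le_lt_trans _ _ ((1 - t) + t * ev a w)).
  by rewrite lerD2r ler_piMr // subr_ge0.
by rewrite -ltrBrDl opprB addrC subrK gtr_pMr.
Qed.

End closures.

Section newton_number.
Let o0 : 'I_3 := ord0.
Let o1 : 'I_3 := inord 1.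
Let o2 : 'I_3 := inord 2.

Lemma ord3P : [/\ (o0 : nat) = 0%N, (o1 : nat) = 1%N & (o2 : nat) = 2%N].
Proof. by rewrite /o1 /o2 !inordK. Qed.

Lemma frame_standard : frame o0 o1 o2.
Proof.
have [h0 h1 h2] := ord3P.
split; rewrite -?val_eqE /= ?h1 ?h2 // => -[[|[|[|//]]] hi];
  [constructor 1|constructor 2|constructor 3]; apply: val_inj; rewrite /= ?h1 ?h2 //.
Qed.

Lemma frame_perm j0 j1 j2 : frame j0 j1 j2 -> frame j1 j0 j2 /\ frame j0 j2 j1.
Proof.
move=> [h1 h2 h3 hT].
split; split=> //; try (by rewrite eq_sym); move=> i.
  by have [->|->|->] := hT i; [constructor 2|constructor 1|constructor 3].
by have [->|->|->] := hT i; [constructor 1|constructor 3|constructor 2].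
Qed.

Lemma sum_ord3 (F : 'I_3 -> R) : \sum_(i < 3) F i = F o0 + F o1 + F o2.
Proof.
have [h0 h1 h2] := ord3P.
rewrite !big_ord_recl big_ord0 addr0 addrA; congr (_ + _ + _); congr F; apply: val_inj.
  by rewrite /= h1.
by rewrite /= h2.
Qed.

Lemma newton_number_under (G : set 'rV[R]_3) A :
  newton_data (in_frame o0 o1 G) A ->
  newton_number G = nu_drop (nonneg3 `\` in_frame o0 o1 G) -
    (if `[< in_frame o0 o1 G (0, 0, 0) >] then 0 else 1).
Proof.
move=> nd; set g := in_frame o0 o1 G; have fr := frame_standard.
have [h0 h1 h2] := ord3P.
have [s ps Es] := newton_hpoly nd; rewrite -/g in Es.
have cnn : convex3 (nonneg3 : set (R * R * R)) by move=> p q t t01; rewrite nonneg3_hpoly; exact: hpoly_mix.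
have clnn : closed [set x : 'rV[R]_3 | nonneg3 (to_triple o0 o1 o2 x)].
  rewrite nonneg3_hpoly; exact: closed_hpoly.
have RE : region_under G = [set x | below nonneg3 s (to_triple o0 o1 o2 x)].
  have n0 : nonneg3 (0 : R, 0 : R, 0 : R) by split; exact: lexx.
  have hw a : a \in s -> ev a (0 : R, 0 : R, 0 : R) < 1 by rewrite /ev /= !mulr0 !addr0 ltr01.
  rewrite -(closure_sbelow fr cnn clnn n0 hw).
  rewrite /region_under /polyhedral_diff; congr closure; apply/seteqP; split=> x.
    move=> [/(orthantE fr) x0 nG]; rewrite /= (sbelow_nonneg Es); split=> //.
    by rewrite /g (in_frameE fr).
  rewrite /= (sbelow_nonneg Es) => -[x0 nG]; split; first exact/(orthantE fr).
  by rewrite -(in_frameE fr).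
have e i j : delta_mx 0 i 0 j = (j == i)%:R :> R by rewrite mxE eqxx.
have E01 : (o0 == o1) = false by rewrite -val_eqE /= h1.
have E02 : (o0 == o2) = false by rewrite -val_eqE /= h2.
have E12 : (o1 == o2) = false by rewrite -val_eqE /= h1 h2.
have E10 : (o1 == o0) = false by rewrite eq_sym.
have E20 : (o2 == o0) = false by rewrite eq_sym.
have E21 : (o2 == o1) = false by rewrite eq_sym.
pose U := below nonneg3 s.
have T3 (x y z : R) : to_triple o0 o1 o2 (x *: delta_mx 0 o0 + y *: delta_mx 0 o1 + z *: delta_mx 0 o2 : 'rV[R]_3) = (x, y, z).
  by apply: eq3; rewrite /= !mxE !eqxx ?E01 ?E02 ?E12 ?E10 ?E20 ?E21 /= ?mulr1 ?mulr0 ?addr0 ?add0r.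
have T2 i j (x y : R) : to_triple o0 o1 o2 (x *: delta_mx 0 i + y *: delta_mx 0 j : 'rV[R]_3) =
   (x * (o0 == i)%:R + y * (o0 == j)%:R, x * (o1 == i)%:R + y * (o1 == j)%:R, x * (o2 == i)%:R + y * (o2 == j)%:R).
  by apply: eq3; rewrite /= !mxE !eqxx.
have T1 i (x : R) : to_triple o0 o1 o2 (x *: delta_mx 0 i : 'rV[R]_3) =
   (x * (o0 == i)%:R, x * (o1 == i)%:R, x * (o2 == i)%:R).
  by apply: eq3; rewrite /= !mxE !eqxx.
have sum3 (x y z x' y' z' : R) : x = x' -> y = y' -> z = z' -> x + y + z = x' + y' + z'.
  by move=> -> -> ->.
have areaP (S S' : set (R * R)) : S = S' -> fine (mu2 S) = area S' by move=> ->.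
have lenP (S S' : set R) : S = S' -> fine (mu1 S) = len S' by move=> ->.
have arith (v x y z l : R) :
    3`!%:R * v - 2`!%:R * (z + y + x) + 1`!%:R * l = 6 * v - 2 * (x + y + z) + l.
  by rewrite !factS fact0 !muln1; ring.
have v3 : V3 (region_under G) = vol U.
  rewrite /V3 /vol RE; congr (fine (mu3 _)); apply/seteqP.
  by split=> -[[x y] z]; rewrite /= T3.
have v2 : V2 (region_under G) = area (plane_z U) + area (plane_y U) + area (plane_x U).
  have sum2 (F : 'I_3 -> 'I_3 -> R) :
      \sum_(i < 3) \sum_(j < 3 | (i < j)%N) F i j = F o0 o1 + F o0 o2 + F o1 o2.
    under eq_bigr do rewrite big_mkcond sum_ord3 /=.
    by rewrite sum_ord3 /= h1 h2 /= !add0r !addr0.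
  rewrite /V2 RE sum2.
  by apply: sum3; apply: areaP; apply/seteqP; split=> -[x y];
    rewrite /= T2 ?eqxx ?E01 ?E02 ?E12 ?E10 ?E20 ?E21 /= ?mulr1 ?mulr0 ?addr0 ?add0r.
have v1 : V1 (region_under G) = len (axis_x U) + len (axis_y U) + len (axis_z U).
  rewrite /V1 RE sum_ord3.
  by apply: sum3; apply: lenP; apply/seteqP; split=> x;
    rewrite /= T1 ?eqxx ?E01 ?E02 ?E12 ?E10 ?E20 ?E21 /= ?mulr1 ?mulr0 ?addr0 ?add0r.
have v0 : V0 (region_under G) = if `[< g (0, 0, 0) >] then 0 else 1.
  rewrite /V0; have [g0|g0] := pselect (g (0, 0, 0)).
    rewrite (asboolT g0) asboolF // => -[x].
    have -> : region_under G = set0; last by [].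
    rewrite RE; apply/seteqP; split=> // y [y0 [a a_s ay]].
    have [s1 s2 s3] := ps _ a_s.
    move: g0; rewrite Es => -[_ /(_ a a_s)].
    by rewrite /ev /= !mulr0 !addr0 leNgt ltr01.
  rewrite (asboolF g0) asboolT //; exists 0.
  apply: subset_closure; split; first by move=> i; rewrite mxE.
  move=> G0; apply: g0; rewrite /g /in_frame /=.
  have -> : of_triple o0 o1 (0, 0, 0) = 0 :> 'rV[R]_3; last by [].
  by apply/rowP => i; rewrite !mxE; case: ifP => // _; case: ifP.
rewrite /newton_number v3 v2 v1 v0; congr (_ - _).
by rewrite -(nu_drop_below nd ps Es) arith.
Qed.

End newton_number.

End closure.

(** * Pyramids *)

Section pyramid_polyhedra.
Context {R : realType}.
Implicit Types (G : set (R * R * R)) (A : seq (nat * nat * nat)).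

Section coordinate_plane.
Variables (j0 j1 j2 : 'I_3).
Hypothesis fr : frame j0 j1 j2.
Local Notation tri := (@to_triple j0 j1 j2 R).
Local Notation row := (@of_triple R j0 j1).
Local Notation inF := (in_frame j0 j1).
Let H : set 'rV[R]_3 := @coord_hyperplane R 3 j1.

Lemma dotE x y : dot x y = ev (tri x) (tri y).
Proof.
have [h1 h2 h3 hT] := fr.
rewrite /dot (bigD1 j0) //= (bigD1 j1) /=; last by rewrite eq_sym.
rewrite (bigD1 j2) /=; last by rewrite eq_sym h2 eq_sym h3.
rewrite big1 ?addr0 ?addrA // => i /andP[/andP[i0 i1] i2].
by have [e|e|e] := hT i; move: i0 i1 i2; rewrite e eqxx.
Qed.

Lemma hyperplane_coord : hyperplane H.
Proof.
have [e1 e2 e3] := of_tripleE fr (0 : R, 1 : R, 0 : R).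
exists (row (0, 1, 0)), 0; split.
  by apply/eqP => /(congr1 (fun v : 'rV[R]_3 => v 0 j1)); rewrite e2 mxE => /eqP; rewrite oner_eq0.
apply/seteqP; split=> x; rewrite /H /coord_hyperplane /= dotE (of_tripleK fr) /ev /= !mul0r mul1r add0r addr0 //.
Qed.

Lemma dist_to_coord Q : dist_to Q H = `|(tri Q).1.2|.
Proof.
set q := tri Q.
have normE x : H x -> dot (Q - x) (Q - x) =
    (q.1.1 - (tri x).1.1) ^+ 2 + q.1.2 ^+ 2 + (q.2 - (tri x).2) ^+ 2.
  by rewrite dotE /ev /= !mxE /H /coord_hyperplane /= => ->; rewrite subr0 !expr2.
have lb x : H x -> `|q.1.2| <= Num.sqrt (dot (Q - x) (Q - x)).
  move=> Hx; rewrite -sqrtr_sqr ler_wsqrtr // normE // -addrA addrCA lerDl.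
  by rewrite addr_ge0 // sqr_ge0.
have H0 : H (row (q.1.1, 0, q.2)) by have [_ ? _] := of_tripleE fr (q.1.1, 0, q.2).
apply/eqP; rewrite eq_le; apply/andP; split.
  apply: ge_inf; first by exists 0 => _ [x _ <-]; exact: sqrtr_ge0.
  exists (row (q.1.1, 0, q.2)) => //.
  by rewrite normE // (of_tripleK fr) /= !subrr expr0n /= add0r addr0 sqrtr_sqr.
apply: lb_le_inf; first by exists (Num.sqrt (dot (Q - row (q.1.1, 0, q.2)) (Q - row (q.1.1, 0, q.2)))); exists (row (q.1.1, 0, q.2)).
by move=> _ [x Hx <-]; exact: lb.
Qed.

(** The point [w], at which all the inequalities are strict, provides the
    relative interior. *)
Lemma convex_polyhedron_forms (F : seq (R * R * R * R)) w :
  (forall f, f \in F -> (f.1.1.1 != 0) || (f.1.2 != 0)) ->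
  w.1.2 = 0 -> (forall f, f \in F -> ev f.1 w < f.2) ->
  convex_polyhedron_in H [set x | H x /\ forall f, f \in F -> ev f.1 (tri x) <= f.2].
Proof.
move=> nz w0 hw.
have f0 : R * R * R * R := (0, 0, 0, 0).
pose S (k : 'I_(size F)) := H `&` [set x | dot (row (nth f0 F k).1) x <= (nth f0 F k).2].
have He v : v.1.2 = 0 -> H (row v) by move=> v2; have [_ + _] := of_tripleE fr v; rewrite v2.
exists (size F), S; split.
- move=> k; exists (row (nth f0 F k).1), (nth f0 F k).2; split=> //.
  set f := nth f0 F k; have fF : f \in F by exact: mem_nth.
  have [f1|f1] := eqVneq f.1.1.1 0; last first.
    exists (row (0, 0, 0)), (row (1, 0, 0)); split; try exact: He.
    by rewrite !dotE !(of_tripleK fr) /ev /= !mulr0 !addr0 mulr1 eq_sym.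
  exists (row (0, 0, 0)), (row (0, 0, 1)); split; try exact: He.
  rewrite !dotE !(of_tripleK fr) /ev /= !mulr0 !add0r mulr1 eq_sym.
  by have := nz f fF; rewrite f1 eqxx.
- apply/seteqP; split=> x.
    move=> [Hx h]; split=> // k _; split=> //=.
    by rewrite dotE (of_tripleK fr); apply: h; exact: mem_nth.
  move=> [Hx h]; split=> // f fF.
  have kF : (index f F < size F)%N by rewrite index_mem.
  have [_ /=] := h (Ordinal kF) I.
  by rewrite dotE (of_tripleK fr) /= nth_index.
- exists [set x | forall f, f \in F -> ev f.1 (tri x) < f.2]; split.
  + elim: F {nz hw S} => [|f F IH].
      have -> : [set x : 'rV[R]_3 | forall f : R * R * R * R, f \in [::] -> ev f.1 (tri x) < f.2] = setT.
        by apply/seteqP; split.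
      exact: openT.
    rewrite (_ : [set _ | _] = [set x | ev f.1 (tri x) < f.2] `&`
        [set x | forall f, f \in F -> ev f.1 (tri x) < f.2]).
      by apply: openI; [exact: open_form_lt|exact: IH].
    apply/seteqP; split=> x.
      by move=> h; split=> [|b bs]; apply: h; rewrite inE ?eqxx // bs orbT.
    by move=> [h h'] b; rewrite inE => /orP[/eqP ->|/h'].
  + by exists (row w); split; [rewrite /= (of_tripleK fr)|exact: He].
  + by move=> x [h Hx]; split=> // f fF; apply: ltW; exact: h.
Qed.

Section pyramid.
Variables (G GP : set 'rV[R]_3) (A : seq (nat * nat * nat)) (p : R * R * R).
Let g := inF G.
Hypothesis nd : newton_data g A.
Hypotheses (p0 : nonneg3 p) (pG : ~ g p) (py : p.1.2 = 0).
Hypothesis GPE : inF GP = pjoin g p.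
Let D := pjoin g p `\` g.
Let Dr := polyhedral_diff GP G.

(** A form of [G] that holds at the added point holds on the whole join: only
    those that fail there cut out the difference. *)
Lemma diff_closureE : exists s s' sk, [/\ pos_forms s /\ g = hpoly s, pos_forms sk,
  pjoin g p = hpoly sk,
  forall a, a \in s' -> [/\ a \in s, pos3 a & ev a p < 1] &
  Dr = [set x | below (pjoin g p) s' (tri x)]].
Proof.
have [s ps Es] := newton_hpoly nd; have [sk psk Esk] := pjoin_hpoly nd p0.
pose s' := [seq a <- s | ev a p < 1].
have s'P a : a \in s' -> [/\ a \in s, pos3 a & ev a p < 1].
  by rewrite mem_filter => /andP[ap a_s]; split=> //; exact: ps.
exists s, s', sk; split=> //.
have Kp : pjoin g p p by apply: pjoin_apex; exact: (newton_neq0 nd).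
have clK : closed [set x : 'rV[R]_3 | pjoin g p (tri x)].
  by rewrite Esk; exact: closed_hpoly.
have cK : convex3 (pjoin g p) by move=> v w t t01; exact: (pjoin_mix nd p0).
rewrite -(closure_sbelow fr cK clK Kp) => [|a /s'P[]//].
rewrite /Dr /polyhedral_diff; congr closure; apply/seteqP; split=> x.
  move=> [GPx nG']; have Kx : pjoin g p (tri x) by rewrite -GPE (in_frameE fr).
  have nG : ~ g (tri x) by rewrite /g (in_frameE fr).
  split=> //.
  have [a a_s ax] : exists2 a, a \in s & ev a (tri x) < 1.
    by apply: notin_hpoly; [exact: (pjoin_ge0 nd p0 Kx)|rewrite -Es].
  exists a => //; rewrite mem_filter a_s andbT.
  have [r [q [/andP[r0 r1] Gq xE]]] := Kx.
  have aq : 1 <= ev a q by move: Gq; rewrite Es => -[_]; exact.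
  rewrite ltNge; apply/negP => ap; move: ax; rewrite xE ev_mix ltNge => /negP; apply.
  have h1 : 0 <= (1 - r) * (ev a p - 1) by rewrite mulr_ge0 ?subr_ge0.
  have h2 : 0 <= r * (ev a q - 1) by rewrite mulr_ge0 ?subr_ge0.
  by lra.
move=> [Kx [a /s'P[a_s _ _] ax]].
split; first by move: Kx; rewrite -GPE (in_frameE fr).
rewrite -(in_frameE fr G) -/g Es => -[_ /(_ a a_s)]; apply/negP; by rewrite -ltNge.
Qed.

Lemma diff_sub v : D v -> Dr (row v).
Proof.
move=> [Kv nG]; apply: subset_closure; split.
  by rewrite -[GP (row v)]/(inF GP v) GPE.
by [].
Qed.

Lemma closure_join x : Dr x -> pjoin g p (tri x).
Proof. by have [s [s' [sk [_ _ _ _ ->]]]] := diff_closureE; case. Qed.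

(** The apex is in [G]. If another point of the open pyramid were in [G], then
    so would be a box contained in the pyramid, by [cone_overlap]; but the
    closure of the difference does not meet the interior of [G]. *)
Lemma pyramid_cone_y : pyramid_with_height H (Dr `&` H) 1 Dr -> cone_y D.
Proof.
move=> [Q [[_ _ nHQ DrE] hQ]].
have [q qE] : exists q, tri Q = q by exists (tri Q).
have QE : row q = Q by rewrite -qE (to_tripleK fr).
have Dp : D p by split=> //; apply: pjoin_apex; exact: (newton_neq0 nd).
have pyr v : Dr (row v) -> exists b t, [/\ 0 <= t <= 1, Dr (row b), b.1.2 = 0 & v = mix t q b].
  rewrite DrE => -[b [Db Hb] [t]]; rewrite /= in_itv /= => t01 /(congr1 tri).
  rewrite to_triple_mix (of_tripleK fr) qE => vE; exists (tri b), t; split=> //.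
  by rewrite (to_tripleK fr) -DrE.
have DQ : Dr Q.
  rewrite DrE; have [b [t [_ Db b0 _]]] := pyr p (diff_sub Dp).
  exists (row b).
    by split=> //; have [_ e _] := of_tripleE fr b; rewrite /H /coord_hyperplane /= e.
  exists 0; first by rewrite /= in_itv /= lexx ler01.
  by rewrite subr0 scale1r scale0r addr0.
have Kq := closure_join DQ; rewrite qE in Kq.
have q0 := pjoin_ge0 nd p0 Kq.
have qy : q.1.2 = 1.
  by move: hQ; rewrite dist_to_coord qE ger0_norm //; case: q0.
(* otherwise the pyramid would extend above its apex *)
have gq : g q.
  apply: contrapT => nq; have [e e0 he] := room_above nd q0 nq.
  have Dq' : D (q.1.1, q.1.2 + e, q.2).
    split; last by apply: he => //=; rewrite lerDl ltW.
    by apply: (pjoin_up nd p0 Kq); split; rewrite //= lerDl ltW.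
  have [b [t [/andP[t0 t1] _ b0 E]]] := pyr _ (diff_sub Dq').
  have := congr1 (fun v : R * R * R => v.1.2) E.
  rewrite /= b0 qy mulr0 addr0 mulr1 => /addrI eE.
  by move: e0; rewrite eE oppr_gt0 ltNge t0.
have box_free w e : 0 < e -> g w ->
    ~ Dr (row (w.1.1 + e, w.1.2 + e, w.2 + e)).
  move=> e0 gw /(_ [set x | w.1.1 < ev (1, 0, 0) (tri x) /\ w.1.2 < ev (0, 1, 0) (tri x) /\
     w.2 < ev (0, 0, 1) (tri x)]) [].
    apply: open_nbhs_nbhs; split.
      by apply: openI; [|apply: openI]; exact: open_form_gt.
    by rewrite /= (of_tripleK fr) /ev /= !mul0r !mul1r !addr0 !add0r !ltrDl e0.
  move=> x [[_ nG]]; rewrite /ev /= !mul0r !mul1r !addr0 !add0r => -[x1 [x2 x3]].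
  apply: nG; rewrite -(in_frameE fr G); apply: (newton_up nd gw).
  by split; exact: ltW.
exists q; split=> // v; split.
  move=> Dv; have [b [t [/andP[t0 t1] Db b0 vE]]] := pyr v (diff_sub Dv).
  have [Kv nGv] := Dv.
  have Kb := closure_join Db; rewrite (of_tripleK fr) in Kb.
  have nb : ~ g b by move=> gb; apply: nGv; rewrite vE; apply: (newton_mix nd); rewrite ?t0.
  have t0' : 0 < t.
    rewrite lt_neqAle t0 andbT; apply/eqP => t00; apply: nGv.
    by rewrite vE -t00 (_ : mix 0 q b = q) //; apply: eq3; rewrite /= subr0 mul1r mul0r addr0.
  have vy : v.1.2 = 1 - t by rewrite vE /= b0 qy mulr0 addr0 mulr1.
  have -> : v = mix (1 - t) b q by rewrite vE; apply: eq3; rewrite /=; ring.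
  rewrite chart_mix_y ?gtrBl //; split; last by split.
  by rewrite /= b0 qy mulr0 add0r mulr1 subr_ge0 t1 gtrBl.
move=> [/andP[v0 v1] Db]; set b := chart_y q v in Db.
have vE : mix v.1.2 b q = v by exact: mix_chart_y.
have [Kb nGb] := Db.
split.
  by rewrite -vE; apply: (pjoin_mix nd p0); [rewrite v0 ltW|exact: Kb|exact: pjoin_sub].
move=> gv.
have v01 : 0 <= v.1.2 < 1 by rewrite v0.
rewrite -vE in gv.
have [w [e [e0 w0 hw]]] := cone_overlap nd p0 gq qy Db erefl v01 gv.
have e20 : 0 < e / 2 by rewrite divr_gt0.
have e2 : e / 2 <= e by rewrite ler_pdivrMr // ler_pMr // ler1n.
have [gw _ _] : [/\ g w, 0 <= w.1.2 < 1 & D (chart_y q w)].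
  by apply: hw; rewrite lexx lerDl ltW.
pose m : R * R * R := (w.1.1 + e / 2, w.1.2 + e / 2, w.2 + e / 2).
have [_ /andP[m0 m1] Dm] : [/\ g m, 0 <= m.1.2 < 1 & D (chart_y q m)].
  by apply: hw; rewrite /= lerDl lerD2l e2 andbT ltW.
apply: (box_free w (e / 2) e20 gw); rewrite -/m.
rewrite DrE; exists (row (chart_y q m)).
  split; first exact: diff_sub.
  by have [_ ez _] := of_tripleE fr (chart_y q m); rewrite /H /coord_hyperplane /= ez.
exists (1 - m.1.2); first by rewrite /= in_itv /= subr_ge0 (ltW m1) gerBl m0.
by rewrite -[m in RHS](mix_chart_y qy m1) of_triple_mix QE subKr addrC.
Qed.

Lemma closed_coord : closed H.
Proof.
have -> : H = [set x | ev (0, 1, 0) (tri x) <= 0] `&` [set x | 0 <= ev (0, 1, 0) (tri x)].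
  apply/seteqP; split=> x; rewrite /H /coord_hyperplane /ev /= !mul0r mul1r add0r addr0.
    by move=> ->.
  by move=> [h1 h2]; apply/eqP; rewrite eq_le h1 h2.
by apply: closedI; [exact: closed_form_le|exact: closed_form_ge].
Qed.

Lemma compact_base : compact (Dr `&` H).
Proof.
have [s [s' [sk [[ps Es] _ _ s'P DrE]]]] := diff_closureE.
have [_ [_ [M hM]]] := small3_under nd ps Es.
have cl : closed (Dr `&` H) by apply: closedI; [exact: closed_closure|exact: closed_coord].
have cpt := @rV_compact R 3 (fun=> `[0, M]%classic) (fun=> @segment_compact R 0 M).
apply: (subclosed_compact cl cpt) => x [Dx _] i.
have Kx := closure_join Dx; have x0 := pjoin_ge0 nd p0 Kx.
move: Dx; rewrite DrE => -[_ [a /s'P[a_s _ _] ax]].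
have [|h1 h2 h3] := hM (tri x); first by split=> //; exists a.
rewrite /= in_itv /=.
by have [->|->|->] := frameT fr i.
Qed.

(** Each form of [G] that fails at the added point [p] cuts out one convex piece
    of the base, with an interior near [p]. *)
Lemma polyhedron_base : polyhedron_in H (Dr `&` H).
Proof.
have [s [s' [sk [[ps Es] psk Esk s'P DrE]]]] := diff_closureE.
have a0 : R * R * R := (0, 0, 0).
have Kp : pjoin g p p by apply: pjoin_apex; exact: (newton_neq0 nd).
pose F (a : R * R * R) : seq (R * R * R * R) :=
  [:: ((-1, 0, 0), 0); ((0, 0, -1), 0); (a, 1)] ++ [seq (scale3 (-1) f, -1) | f <- sk].
have FE a x : H x -> (forall f, f \in F a -> ev f.1 (tri x) <= f.2) <->
    pjoin g p (tri x) /\ ev a (tri x) <= 1.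
  rewrite /H /coord_hyperplane /= => Hx; rewrite Esk; split=> [h|[[[x1 x2 x3] hk] ax] f].
    split; last by apply: (h (a, 1)); rewrite !inE eqxx !orbT.
    split=> [|f fk].
      split; last 1 first.
      - have /(_ _) := h ((0, 0, -1), 0); rewrite !inE eqxx !orbT => /(_ isT).
        by rewrite /ev /= !mul0r !add0r mulN1r oppr_le0.
      - have /(_ _) := h ((-1, 0, 0), 0); rewrite !inE eqxx => /(_ isT).
        by rewrite /ev /= !mul0r !addr0 mulN1r oppr_le0.
      - by rewrite /= Hx.
    have /(_ _) := h (scale3 (-1) f, -1); rewrite mem_cat (map_f _ fk) orbT => /(_ isT).
    by rewrite /= ev_scale mulN1r lerN2.
  rewrite !inE => /orP[/eqP ->|/orP[/eqP ->|/orP[/eqP ->|/mapP[f' fk ->]]]].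
  - by rewrite /ev /= !mul0r !addr0 mulN1r oppr_le0.
  - by rewrite /ev /= !mul0r !add0r mulN1r oppr_le0.
  - by [].
  - by rewrite /= ev_scale mulN1r lerN2; exact: hk.
exists (size s'), (fun k => [set x | H x /\ forall f, f \in F (nth a0 s' k) -> ev f.1 (tri x) <= f.2]).
split.
  move=> k; have as' : nth a0 s' k \in s' by exact: mem_nth.
  set a := nth a0 s' k in as' *; have [a_s [a1 a2 a3] ap] := s'P a as'.
  have S0 : 0 < a.1.1 + a.2 by rewrite addr_gt0.
  pose e := (1 - ev a p) / (2 * (a.1.1 + a.2)).
  have e0 : 0 < e by rewrite divr_gt0 ?mulr_gt0 // subr_gt0.
  have eE : (a.1.1 + a.2) * e = (1 - ev a p) / 2.
    by rewrite /e; field; rewrite gt_eqF.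
  have evw f : ev f (p.1.1 + e, 0, p.2 + e) = ev f p + (f.1.1 + f.2) * e.
    by rewrite /ev /= py; ring.
  apply: (convex_polyhedron_forms (w := (p.1.1 + e, 0, p.2 + e))) => //.
    move=> f; rewrite !inE => /orP[/eqP ->|/orP[/eqP ->|/orP[/eqP ->|/mapP[f' fk ->]]]] /=.
    - by rewrite oppr_eq0 oner_eq0.
    - by rewrite oppr_eq0 oner_eq0 orbT.
    - by rewrite gt_eqF.
    - by have [f1 _ _] := psk _ fk; rewrite mulN1r oppr_eq0 gt_eqF.
  have [p1 _ p3] := p0.
  move=> f; rewrite !inE => /orP[/eqP ->|/orP[/eqP ->|/orP[/eqP ->|/mapP[f' fk ->]]]].
  - by rewrite /ev /= !mul0r !addr0 mulN1r oppr_lt0 ltr_wpDl.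
  - by rewrite /ev /= !mul0r !add0r mulN1r oppr_lt0 ltr_wpDl.
  - by rewrite /= evw eE -ltrBrDl ltr_pdivrMr // ltr_pMr ?subr_gt0 // ltr1n.
  - have [f1 _ f3] := psk _ fk.
    have fp : 1 <= ev f' p by move: Kp; rewrite Esk => -[_]; exact.
    by rewrite /= ev_scale evw mulN1r ltrN2 (le_lt_trans fp) // ltrDl mulr_gt0 // addr_gt0.
rewrite DrE; apply/seteqP; split=> x.
  move=> [[Kx [a as' ax]] Hx].
  have ks : (index a s' < size s')%N by rewrite index_mem.
  exists (Ordinal ks) => //; split=> //; apply/FE => //.
  by rewrite /= nth_index.
move=> [k _ [Hx /(FE _ _ Hx)[Kx ax]]]; split=> //; split=> //.
by exists (nth a0 s' k) => //; exact: mem_nth.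
Qed.

(** The cone over the closed base is compact, so it contains the closure of the
    difference. Conversely, the contractions towards the apex map the difference
    into itself, hence also its closure. *)
Lemma cone_y_pyramid : cone_y D -> pyramid_with_height H (Dr `&` H) 1 Dr.
Proof.
move=> [q [q0 qy DE]]; exists (row q).
split; last by rewrite dist_to_coord (of_tripleK fr) qy normr1.
have rowH v : v.1.2 = 0 -> H (row v).
  by move=> v2; have [_ e _] := of_tripleE fr v; rewrite /H /coord_hyperplane /= e.
split; [exact: hyperplane_coord|by split; [exact: compact_base|exact: polyhedron_base]| |].
  have [_ e _] := of_tripleE fr q; rewrite /H /coord_hyperplane /= e qy => /eqP.
  by rewrite oner_eq0.
pose f (z : 'rV[R]_3 * R^o) : 'rV[R]_3 := (1 - z.2) *: row q + z.2 *: z.1.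
have coneE : cone_over (row q) (Dr `&` H) = f @` ((Dr `&` H) `*` `[0, 1]).
  apply/seteqP; split=> x.
    by move=> [b Bb [t t01 <-]]; exists (b, t).
  by move=> [[b t] [Bb t01] <-]; exists b => //; exists t.
have fc : continuous f.
  move=> z; apply: cvgD.
    by apply: cvgZr_tmp; apply: (@cvgB _ R^o); [exact: cvg_cst|exact: cvg_snd].
  by apply: cvgZ; [exact: cvg_snd|exact: cvg_fst].
have cptC : compact (cone_over (row q) (Dr `&` H)).
  rewrite coneE; apply: continuous_compact; first exact: continuous_subspaceT.
  by apply: compact_setX; [exact: compact_base|exact: segment_compact].
apply/seteqP; split.
  have clC : closed (cone_over (row q) (Dr `&` H)).
    by apply: compact_closed => //; exact: norm_hausdorff.
  rewrite [X in _ `<=` X](closure_id _).1 //; apply: closureS => x [GPx nG].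
  have Dx : D (tri x) by split; [rewrite -GPE (in_frameE fr)|rewrite /g (in_frameE fr)].
  have [/andP[x0 x1] Db] := (DE _).1 Dx.
  exists (row (chart_y q (tri x))).
    by split; [exact: diff_sub|exact: rowH].
  exists (1 - (tri x).1.2); first by rewrite /= in_itv /= subr_ge0 (ltW x1) gerBl x0.
  rewrite subKr addrC -of_triple_mix mix_chart_y ?(to_tripleK fr) //.
have inner t : 0 <= t < 1 -> forall x, Dr x -> Dr (t *: row q + (1 - t) *: x).
  move=> /andP[t0 t1] x Dx B Bx.
  pose h (y : 'rV[R]_3) : 'rV[R]_3 := t *: row q + (1 - t) *: y.
  have hc : {for x, continuous h}.
    have c0 : {for x, continuous (fun _ : 'rV[R]_3 => t *: row q)} by exact: cst_continuous.
    have c1 : {for x, continuous (fun y : 'rV[R]_3 => (1 - t) *: y)} by exact: scaler_continuous.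
    exact: (cvgD c0 c1).
  have [y [[GPy nGy] By]] := Dx _ (hc _ Bx); exists (h y); split=> //.
  have Dy : D (tri y) by split; [rewrite -GPE (in_frameE fr)|rewrite /g (in_frameE fr)].
  have [/andP[y0 y1] Db] := (DE _).1 Dy.
  suff : D (tri (h y)).
    by move=> [+ nh]; rewrite -GPE (in_frameE fr) => ?; split=> // /= Gh; apply: nh; rewrite /g (in_frameE fr).
  have -> : tri (h y) = mix (1 - t) q (tri y).
    rewrite -[in RHS](of_tripleK fr q) -to_triple_mix; congr tri.
    by rewrite /h subKr.
  pose u := t + (1 - t) * (tri y).1.2.
  have u1 : u < 1.
    have h1 : 0 < (1 - t) * (1 - (tri y).1.2) by rewrite mulr_gt0 ?subr_gt0.
    have -> : u = 1 - (1 - t) * (1 - (tri y).1.2) by rewrite /u; ring.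
    by rewrite gtrBl.
  have u0 : 0 <= u by rewrite addr_ge0 // mulr_ge0 // subr_ge0 ltW.
  have -> : mix (1 - t) q (tri y) = mix u (chart_y q (tri y)) q.
    rewrite -{1}(mix_chart_y qy y1) /u; move: (tri y).1.2 => w.
    by apply: eq3; rewrite /=; ring.
  apply/DE; rewrite chart_mix_y //; split=> //.
  by rewrite /= qy mulr0 add0r mulr1 u0.
move=> x [b [Db Hb] [t]]; rewrite /= in_itv /= => /andP[t0 t1] <-.
have [tE|tn] : t = 0 \/ t != 0 by case: (t =P 0); [left|right].
  rewrite tE subr0 scale1r scale0r addr0.
  have clDr : closed Dr by exact: closed_closure.
  rewrite [Dr](closure_id _).1 //; apply: (segment_closure (y := b)) => w /andP[w0 w1].
  have := inner (1 - w) _ b Db; rewrite subKr; apply.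
  by rewrite subr_ge0 w1 gtrBl.
have := inner (1 - t) _ b Db; rewrite subKr; apply.
by rewrite subr_ge0 t1 gtrBl lt_neqAle eq_sym tn.
Qed.

End pyramid.
End coordinate_plane.
End pyramid_polyhedra.

(** * Newton numbers and the drop *)

Section conclusion.
Context {R : realType}.
Implicit Types (G : set (R * R * R)) (A : seq (nat * nat * nat)).

Section assembly.
Let o0 : 'I_3 := ord0.
Let o1 : 'I_3 := inord 1.
Let o2 : 'I_3 := inord 2.
Let fr : frame o0 o1 o2 := frame_standard.

Variables (G : set 'rV[R]_3) (L : seq (nat * nat * nat)) (P : 'rV[nat]_3).
Let g := in_frame o0 o1 G.
Hypothesis nd : newton_data g L.
Let p : R * R * R := emb (to_triple o0 o1 o2 P).
Hypothesis pG : ~ g p.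
Let GP := convex_hull (G `|` [set lattice_point R P]).
Let D := pjoin g p `\` g.
Let p0 : nonneg3 p. Proof. exact: emb_ge0. Qed.
Let GPE : in_frame o0 o1 GP = pjoin g p. Proof. exact: (in_frame_join fr nd). Qed.

(** The origin being an extreme point of the orthant, a segment from [p] to [G]
    contains it only at an end. *)
Lemma join_origin : pjoin g p (0, 0, 0) <-> origin_count p = 1.
Proof.
have [p1 p2 p3] := p0.
rewrite /origin_count; case: ifPn => [/and3P[/eqP e1 /eqP e2 /eqP e3]|pn].
  split=> // _.
  have -> : (0, 0, 0) = p by apply: eq3.
  by apply: pjoin_apex; exact: (newton_neq0 nd).
split=> [|/eqP]; last by rewrite eq_sym oner_eq0.
move=> [r [q [/andP[r0 r1] Gq /= [/esym e1 /esym e2 /esym e3]]]].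
have [q1 q2 q3] := newton_ge0 nd Gq.
have r1' : 0 <= 1 - r by rewrite subr_ge0.
have z a b : 0 <= a -> 0 <= b -> (1 - r) * a + r * b = 0 -> (1 - r) * a = 0 /\ r * b = 0.
  move=> a0 b0 /eqP; rewrite paddr_eq0 ?mulr_ge0 // => /andP[/eqP ? /eqP ?]; split=> //.
have [a1 b1] := z _ _ p1 q1 e1; have [a2 b2] := z _ _ p2 q2 e2; have [a3 b3] := z _ _ p3 q3 e3.
have rE : r = 1.
  apply/eqP; rewrite eq_sym -subr_eq0; apply: contraNT pn => rn.
  have zz a : (1 - r) * a = 0 -> a == 0 by move/eqP; rewrite mulf_eq0 (negbTE rn).
  by rewrite !zz.
exfalso; apply: pG; apply: (newton_up nd Gq).
by move: b1 b2 b3; rewrite rE !mul1r => b1 b2 b3; split; rewrite ?b1 ?b2 ?b3.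
Qed.

Lemma newton_number_diff :
  newton_number G - newton_number GP = nu_drop D - origin_count p.
Proof.
have ndP : newton_data (in_frame o0 o1 GP) (to_triple o0 o1 o2 P :: L).
  by rewrite GPE; exact: newton_data_pjoin.
rewrite (newton_number_under nd) (newton_number_under ndP) GPE -/g.
have [s ps Es] := newton_hpoly nd.
have [sZ _] := small3_under nd ps Es.
have -> : nonneg3 `\` g = (nonneg3 `\` pjoin g p) `|` D.
  apply/seteqP; split=> v.
    move=> [v0 nG]; have [Kv|nK] := pselect (pjoin g p v); [by right|by left].
  move=> [[v0 nK]|[Kv nG]]; split=> //; last exact: (pjoin_ge0 nd p0 Kv).
  by move=> gv; apply: nK; exact: pjoin_sub.
have sK : small3 (nonneg3 `\` pjoin g p).
  rewrite GPE in ndP; have [s' ps' Es'] := newton_hpoly ndP.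
  by have [] := small3_under ndP ps' Es'.
rewrite nu_dropU //; [|exact: (small3_diff nd p0)|]; last first.
  by apply/seteqP; split=> // v [[_ nK] [Kv _]].
rewrite (asboolF (_ : ~ g (0, 0, 0))); last first.
  by move=> g0; apply: pG; apply: (newton_up nd g0).
have arith (a b c d : R) : c = 1 - d -> a + b - 1 - (a - c) = b - d by move=> ->; ring.
apply: arith; have [j0|j0] := pselect (pjoin g p (0, 0, 0)).
  by rewrite (asboolT j0) (join_origin.1 j0) subrr.
rewrite (asboolF j0); move: j0; rewrite join_origin /origin_count.
by case: ifP => // _ _; rewrite subr0.
Qed.

Lemma pyramidal_pyramid : let Dr := polyhedral_diff GP G in
  pyramidal D p <-> exists i : 'I_3, coord_hyperplane i (lattice_point R P) /\
    pyramid_with_height (coord_hyperplane i) (Dr `&` coord_hyperplane i) 1 Dr.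
Proof.
move=> Dr; have [frx frz] := frame_perm fr.
have frz' : frame o0 o2 o1 by [].
have F12 S : in_frame o1 o0 S = sw12 @^-1` (in_frame o0 o1 S).
  apply/seteqP; split=> v; rewrite /in_frame /=;
  by congr S; apply: (row_ext fr); rewrite (of_tripleK fr); have [h1 h2 h3] := of_tripleE frx v; rewrite /to_triple h1 h2 h3.
have F23 S : in_frame o0 o2 S = sw23 @^-1` (in_frame o0 o1 S).
  apply/seteqP; split=> v; rewrite /in_frame /=;
  by congr S; apply: (row_ext fr); rewrite (of_tripleK fr); have [h1 h2 h3] := of_tripleE frz v; rewrite /to_triple h1 h2 h3.
have ndx : newton_data (in_frame o1 o0 G) (map sw12 L) by rewrite F12; exact: newton_data_sw12.
have ndz : newton_data (in_frame o0 o2 G) (map sw23 L) by rewrite F23; exact: newton_data_sw23.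
have pGx : ~ in_frame o1 o0 G (sw12 p) by rewrite F12 /= sw12K.
have pGz : ~ in_frame o0 o2 G (sw23 p) by rewrite F23 /= sw23K.
have p0x : nonneg3 (sw12 p) by case: p0.
have p0z : nonneg3 (sw23 p) by case: p0.
have GPx : in_frame o1 o0 GP = pjoin (in_frame o1 o0 G) (sw12 p) by rewrite !F12 GPE pjoin_sw12.
have GPz : in_frame o0 o2 GP = pjoin (in_frame o0 o2 G) (sw23 p) by rewrite !F23 GPE pjoin_sw23.
have Dx : pjoin (in_frame o1 o0 G) (sw12 p) `\` in_frame o1 o0 G = sw12 @^-1` D.
  by rewrite F12 pjoin_sw12.
have Dz : pjoin (in_frame o0 o2 G) (sw23 p) `\` in_frame o0 o2 G = sw23 @^-1` D.
  by rewrite F23 pjoin_sw23.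
have cP i : coord_hyperplane i (lattice_point R P) <-> (P 0 i)%:R = 0 :> R.
  by rewrite /coord_hyperplane /= mxE.
split.
  move=> [[h c]|[h c]|[h c]].
  - exists o0; split; first exact/cP.
    by apply: (cone_y_pyramid frx ndx p0x h GPx); rewrite Dx.
  - exists o1; split; first exact/cP.
    exact: (cone_y_pyramid fr nd p0 h GPE).
  - exists o2; split; first exact/cP.
    by apply: (cone_y_pyramid frz ndz p0z h GPz); rewrite Dz.
move=> [i [/cP Pi pyr]]; have [e|e|e] := frameT fr i; rewrite {}e in Pi pyr.
- constructor 1; split=> //.
  by rewrite -Dx; exact: (pyramid_cone_y frx ndx p0x pGx GPx).
- by constructor 2; split=> //; exact: (pyramid_cone_y fr nd p0 pG GPE).
- constructor 3; split=> //.
  by rewrite -Dz; exact: (pyramid_cone_y frz ndz p0z pGz GPz).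
Qed.

End assembly.

End conclusion.

Theorem theorem1 (R : realType) (G : set 'rV[R]_3) (P : 'rV[nat]_3)
    (GN : newton_polyhedron G) (Gconv : convenient G)
    (PG : ~ G (lattice_point R P)) :
  let GP := convex_hull (G `|` [set lattice_point R P]) in
  let D := polyhedral_diff GP G in
  [/\ newton_polyhedron GP /\ convenient GP,
      newton_number GP <= newton_number G &
      newton_number GP = newton_number G <->
      exists i : 'I_3,
        coord_hyperplane i (lattice_point R P) /\
        pyramid_with_height (coord_hyperplane i)
          (D `&` coord_hyperplane i) 1 D].
Proof.
move=> GP D; have fr := frame_standard.
have [A AE] := GN.
have [L nd] : exists L, newton_data (in_frame ord0 (inord 1) G) L.
  by move: Gconv; rewrite AE; exact: (newton_data_hull fr).
have pG : ~ in_frame ord0 (inord 1) G (emb (to_triple ord0 (inord 1) (inord 2) P)).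
  by rewrite -to_lattice (in_frameE fr).
have [h1 h2] := nu_drop_bound nd pG.
have h3 := newton_number_diff nd pG; rewrite -/GP in h3.
split.
- by split; [exact: (newton_join fr nd P GN)|exact: convenient_join].
- by rewrite -subr_ge0 h3 subr_ge0.
- rewrite -(pyramidal_pyramid nd pG) -h2; split=> e.
    by apply/eqP; rewrite -subr_eq0 -h3 e subrr.
  by apply/esym/eqP; rewrite -subr_eq0 h3 e subrr.
Qed.
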